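(* Let $\nu$ be a $\sigma$-finite and non-atomic measure on $(Z,\mathcal Z)$. For every $d\ge2$ and every sequence $\{f^{(k)}:k\ge1\}\subset L^2_s(\nu^d)$ such that $d!\,\|f^{(k)}\|^2_{L^2(\nu^d)}\to1$ as $k\to\infty$, the following relations are equivalent: 1. as $k\to\infty$, $$\sum_{\sigma\in\mathcal M_2([nd],\pi^*([nd]))}\int_{Z^{nd/2}}f^{(k)}_{\sigma,n}\,d\nu^{nd/2}\longrightarrow0,\qquad\forall n\ge3;$$ 2. for every partition $\sigma\in\mathcal M^c_2([4d],\pi^*([4d]))$, as $k\to\infty$, $$\int_{Z^{2d}}f^{(k)}_{\sigma,4}\,d\nu^{2d}\longrightarrow0.$$
   Context: $(Z,\mathcal Z)$ is a Polish space with its Borel $\sigma$-field. $L^2_s(\nu^d)$ is the space of symmetric real functions in $L^2(Z^d,\nu^d)$. $[m]=\{1,\dots,m\}$; $\mathcal P([m])$ is the lattice of partitions of $[m]$ ($\sigma\le\pi$ iff each block of $\sigma$ is contained in a block of $\pi$), with meet $\wedge$, join $\vee$, $\hat0$ the partition into singletons, $\hat1=\{[m]\}$; $i\sim_\sigma j$ means $i,j$ lie in the same block of $\sigma$. $\pi^*([nd])=\{\{1,\dots,d\},\{d+1,\dots,2d\},\dots,\{(n-1)d+1,\dots,nd\}\}$; its blocks, in order, are called rows. $$\mathcal M_2([nd],\pi^*([nd]))=\{\sigma\in\mathcal P([nd]):\sigma\vee\pi^*([nd])=\hat1,\ \sigma\wedge\pi^*([nd])=\hat0,\ |b|=2\ \forall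 b\in\sigma\}$$ (this set is empty if $nd$ is odd, and the sum in item 1 is then $0$). $\mathcal M^c_2([4d],\pi^*([4d]))$ is the set of those $\sigma\in\mathcal M_2([4d],\pi^*([4d]))$ that are circular: with rows $b_1,b_2,b_3,b_4$ and indices taken cyclically ($b_5=b_1$), for each $p$ some block of $\sigma$ has one element in $b_p$ and the other in $b_{p+1}$, and every block of $\sigma$ has its two elements in two cyclically consecutive rows. For $f\in L^2_s(\nu^d)$, $n$ with $nd$ even and $\sigma\in\mathcal M_2([nd],\pi^*([nd]))$, $f_{\sigma,n}$ is the function of $nd/2$ variables obtained from $(x_1,\dots,x_{nd})\mapsto\prod_{j=1}^nf(x_{(j-1)d+1},\dots,x_{jd})$ by identifying $x_i$ and $x_j$ if and only if $i\sim_\sigma j$; $f^{(k)}_{\sigma,n}$ is this function for $f=f^{(k)}$. *)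

(* Defs.v *)
From HB Require Import structures.
From mathcomp Require Import all_boot all_order all_algebra all_fingroup.

Set Implicit Arguments.
Unset Strict Implicit.
Unset Printing Implicit Defensive.

Section PartitionLattice.
Variable T : finType.
Implicit Types (x y : T) (b c : {set T}) (sigma tau rho : {set {set T}}).

Definition is_part sigma := partition sigma [set: T].

Definition ple sigma tau :=
  [forall b in sigma, [exists c in tau, b \subset c]].

Definition pmeet sigma tau : {set {set T}} :=
  [set b :&: c | b in sigma, c in tau] :\ set0.

(* Blocks are the classes of the equivalence generated by sigma and tau; see
   pjoin_lub. *)
Definition pjoin sigma tau : {set {set T}} :=
  equivalence_partition
    (connect [rel x y | (pblock sigma x == pblock sigma y) ||
                        (pblock tau x == pblock tau y)]) [set: T].

Definition pbot : {set {set T}} := [set [set x] | x : T].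

Definition ptop : {set {set T}} := [set [set: T]].

Lemma is_part_cover sigma x : is_part sigma -> x \in cover sigma.
Proof. by move/cover_partition => ->; rewrite inE. Qed.

Lemma pleP sigma tau : is_part sigma -> is_part tau ->
  reflect (forall x y, y \in pblock sigma x -> y \in pblock tau x)
          (ple sigma tau).
Proof.
move=> ps pt; have [_ ts s0] := and3P ps; have [_ tt t0] := and3P pt.
apply: (iffP forall_inP) => [le_st x y xy | sub b bs].
  have [c ct /subsetP bc] := exists_inP (le_st _ (pblock_mem (is_part_cover x ps))).
  have xc : x \in c by apply: bc; rewrite mem_pblock is_part_cover.
  by rewrite (def_pblock tt ct xc); exact: bc.
have [b0|[x xb]] := set_0Vmem b; first by rewrite b0 (negPf s0) in bs.
apply/exists_inP; exists (pblock tau x).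
  by apply: pblock_mem; exact: is_part_cover.
by apply/subsetP => y yb; apply: sub; rewrite (def_pblock ts bs xb).
Qed.

Lemma mem_pmeet_block sigma tau x : is_part sigma -> is_part tau ->
  pblock sigma x :&: pblock tau x \in pmeet sigma tau.
Proof.
move=> ps pt; rewrite !inE; apply/andP; split.
  by apply/set0Pn; exists x; rewrite inE !mem_pblock !is_part_cover.
by apply/imset2P; exists (pblock sigma x) (pblock tau x) => //;
  exact/pblock_mem/is_part_cover.
Qed.

Lemma pmeet_part sigma tau :
  is_part sigma -> is_part tau -> is_part (pmeet sigma tau).
Proof.
move=> ps pt; have [_ ts _] := and3P ps; have [_ tt _] := and3P pt.
apply/and3P; split; last by rewrite !inE eqxx.
  apply/eqP/setP => x; rewrite inE; apply/bigcupP.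
  exists (pblock sigma x :&: pblock tau x); first exact: mem_pmeet_block.
  by rewrite inE !mem_pblock !is_part_cover.
apply/trivIsetP => B C /setD1P[_ /imset2P[b c bs ct ->]].
move=> /setD1P[_ /imset2P[b' c' bs' ct' ->]].
apply: contraNT => /pred0Pn[x /= /andP[/setIP[xb xc] /setIP[xb' xc']]].
by rewrite -(def_pblock ts bs xb) -(def_pblock ts bs' xb')
  -(def_pblock tt ct xc) -(def_pblock tt ct' xc').
Qed.

Lemma pblock_pmeet sigma tau x : is_part sigma -> is_part tau ->
  pblock (pmeet sigma tau) x = pblock sigma x :&: pblock tau x.
Proof.
move=> ps pt; have [_ tm _] := and3P (pmeet_part ps pt).
apply: def_pblock => //; first exact: mem_pmeet_block.
by rewrite inE !mem_pblock !is_part_cover.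
Qed.

Lemma pmeet_glb sigma tau rho : is_part sigma -> is_part tau -> is_part rho ->
  ple rho (pmeet sigma tau) = ple rho sigma && ple rho tau.
Proof.
move=> ps pt pr; have pm := pmeet_part ps pt.
apply/(pleP pr pm)/andP => [le_m | [/(pleP pr ps) le_s /(pleP pr pt) le_t] x y xy].
  by split; [apply/(pleP pr ps)|apply/(pleP pr pt)] => x y /le_m;
    rewrite pblock_pmeet// => /setIP[].
by rewrite pblock_pmeet// inE le_s ?le_t.
Qed.

Let step sigma tau := [rel x y | (pblock sigma x == pblock sigma y) ||
                                 (pblock tau x == pblock tau y)].

Let connect_equiv sigma tau :
  {in [set: T] & &, equivalence_rel (connect (step sigma tau))}.
Proof.
have sc : connect_sym (step sigma tau).
  by apply: sym_connect_sym => x y /=; rewrite eq_sym [X in _ || X]eq_sym.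
move=> x y z _ _ _; split; first exact: connect0.
by move=> xy; apply/idP/idP; apply: connect_trans => //; rewrite sc.
Qed.

Lemma pjoin_part sigma tau : is_part (pjoin sigma tau).
Proof. by apply: equivalence_partitionP; exact: connect_equiv. Qed.

Lemma mem_pblock_pjoin sigma tau x y :
  (y \in pblock (pjoin sigma tau) x) = connect (step sigma tau) x y.
Proof.
by rewrite /pjoin pblock_equivalence_partition ?inE//; exact: connect_equiv.
Qed.

Lemma pjoin_lub sigma tau rho : is_part sigma -> is_part tau -> is_part rho ->
  ple (pjoin sigma tau) rho = ple sigma rho && ple tau rho.
Proof.
move=> ps pt pr; have pj := pjoin_part sigma tau.
have [_ ts _] := and3P ps; have [_ tt _] := and3P pt; have [_ tr _] := and3P pr.
apply/(pleP pj pr)/andP => [le_j | [/(pleP ps pr) le_s /(pleP pt pr) le_t]].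
  split; [apply/(pleP ps pr)|apply/(pleP pt pr)] => x y xy; apply: le_j;
    rewrite mem_pblock_pjoin; apply: connect1 => /=.
  - by rewrite eq_pblock ?is_part_cover// xy.
  - by rewrite orbC eq_pblock ?is_part_cover// xy.
move=> x y; rewrite mem_pblock_pjoin -(@eq_pblock _ rho) ?is_part_cover//.
move=> /connectP[p + ->]; elim: p x => //= z p IHp x /andP[xz /IHp/eqP <-].
rewrite eq_pblock ?is_part_cover//.
by case/orP: xz; rewrite eq_pblock ?is_part_cover//; [exact: le_s|exact: le_t].
Qed.

Lemma pbot_part : is_part pbot.
Proof.
apply/and3P; split.
- apply/eqP/setP => x; rewrite inE; apply/bigcupP.
  by exists [set x]; rewrite ?set11//; exact: imset_f.
- apply/trivIsetP => _ _ /imsetP[x _ ->] /imsetP[y _ ->] xy.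
  by rewrite disjoints1 inE; apply: contraNN xy => /eqP ->.
- by apply/imsetP => -[x _ /setP/(_ x)]; rewrite !inE eqxx.
Qed.

Lemma ple_pbot sigma : is_part sigma -> ple pbot sigma.
Proof.
move=> ps; apply/forall_inP => _ /imsetP[x _ ->]; apply/exists_inP.
exists (pblock sigma x); first exact/pblock_mem/is_part_cover.
by rewrite sub1set mem_pblock is_part_cover.
Qed.

Lemma ptop_part : (0 < #|T|)%N -> is_part ptop.
Proof.
move=> T0; apply/and3P; split.
- by rewrite /cover big_set1.
- by apply/trivIsetP => A B /set1P -> /set1P ->; rewrite eqxx.
- by rewrite inE eq_sym -card_gt0 cardsT.
Qed.

Lemma ple_ptop sigma : ple sigma ptop.
Proof.
apply/forall_inP => b _; apply/exists_inP.
by exists [set: T]; [exact: set11|exact: subsetT].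
Qed.

End PartitionLattice.

Section Diagrams.
Variables n d : nat.

Lemma dpos_subproof (j : 'I_n) (k : 'I_d) : (j * d + k < n * d)%N.
Proof.
by rewrite (leq_trans (n := (j.+1 * d)))// ?leq_mul2r ?ltn_ord ?orbT//
  mulSn addnC ltn_add2r.
Qed.

Definition dpos (j : 'I_n) (k : 'I_d) : 'I_(n * d) := Ordinal (dpos_subproof j k).

Definition drow (j : 'I_n) : {set 'I_(n * d)} := [set dpos j k | k : 'I_d].

Definition pi_star : {set {set 'I_(n * d)}} := [set drow j | j : 'I_n].

Definition M2 : {set {set {set 'I_(n * d)}}} :=
  [set sigma | [&& is_part sigma,
                   pjoin sigma pi_star == ptop 'I_(n * d),
                   pmeet sigma pi_star == pbot 'I_(n * d)
                 & [forall b in sigma, #|b| == 2%N]]].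

Definition links (p q : 'I_n) (b : {set 'I_(n * d)}) :=
  [exists i in drow p, [exists j in drow q, b == [set i; j]]].

Definition block_index (sigma : {set {set 'I_(n * d)}}) (i : 'I_(n * d)) :=
  index (pblock sigma i) (enum sigma).

Lemma eq_block_index (sigma : {set {set 'I_(n * d)}}) i j : is_part sigma ->
  (block_index sigma i == block_index sigma j) = (j \in pblock sigma i).
Proof.
move=> ps; have [_ ts _] := and3P ps.
have in_enum x : pblock sigma x \in enum sigma.
  by rewrite mem_enum pblock_mem ?is_part_cover.
rewrite -(@eq_pblock _ sigma) ?is_part_cover//; apply/eqP/eqP => [|eq_ij].
  move=> e; rewrite -[LHS](nth_index set0 (in_enum i)).
  by rewrite -[RHS](nth_index set0 (in_enum j)); congr nth; exact: e.
by rewrite /block_index eq_ij.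
Qed.

Lemma card_M2 (sigma : {set {set 'I_(n * d)}}) :
  sigma \in M2 -> #|sigma| = (n * d)./2.
Proof.
rewrite inE => /and4P[ps _ _ /forall_inP s2].
have := card_uniform_partition (fun b bs => eqP (s2 b bs)) ps.
by rewrite cardsT card_ord muln2 => /(congr1 half); rewrite doubleK => <-.
Qed.

Lemma block_index_lt (sigma : {set {set 'I_(n * d)}}) i :
  sigma \in M2 -> (block_index sigma i < (n * d)./2)%N.
Proof.
move=> s2; rewrite -(card_M2 s2) cardE index_mem mem_enum.
move: s2; rewrite inE => /andP[ps _].
exact/pblock_mem/is_part_cover.
Qed.

End Diagrams.

Lemma pi_star_part (n d : nat) : (0 < d)%N -> is_part (pi_star n d).
Proof.
move=> d0; apply/and3P; split.
- apply/eqP/setP => i; rewrite inE; apply/bigcupP.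
  have jn : (i %/ d < n)%N by rewrite ltn_divLR.
  have kd : (i %% d < d)%N by rewrite ltn_mod.
  exists (drow d (Ordinal jn)); first exact: imset_f.
  apply/imsetP; exists (Ordinal kd) => //.
  by apply: val_inj; rewrite /= -divn_eq.
- apply/trivIsetP => _ _ /imsetP[j _ ->] /imsetP[j' _ ->].
  apply: contraNT => /pred0Pn[i /= /andP[/imsetP[k _ ->] /imsetP[k' _]]].
  move=> /(congr1 val)/= /(congr1 (divn^~ d)).
  by rewrite !divnMDl// !divn_small// !addn0 => /val_inj ->.
- apply/imsetP => -[j _ /setP/(_ (dpos j (Ordinal d0)))].
  by rewrite inE imset_f.
Qed.

Definition M2c (d : nat) : {set {set {set 'I_(4 * d)}}} :=
  [set sigma in M2 4 d |
    [forall p : 'I_4, [exists b in sigma, links p (ordS p) b]] &&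
    [forall b in sigma, [exists p : 'I_4, links p (ordS p) b]]].

From mathcomp Require Import all_classical all_reals all_analysis.

Import Order.TTheory GRing.Theory Num.Theory.
Import numFieldNormedType.Exports.

Local Open Scope classical_set_scope.
Local Open Scope ring_scope.

Definition complete_distance (R : realType) (T : Type) (dist : T -> T -> R) :=
  forall u : nat -> T,
    (forall e, 0 < e -> exists N, forall m n,
      (N <= m)%N -> (N <= n)%N -> dist (u m) (u n) < e) ->
    exists l : T, forall e, 0 < e -> exists N, forall n,
      (N <= n)%N -> dist (u n) l < e.

Definition polish (R : realType) (Z : topologicalType) :=
  (exists dist : Z -> Z -> R,
    [/\ forall x y, dist x y = 0 <-> x = y,
        forall x y, dist x y = dist y x,
        forall x y z, dist x z <= dist x y + dist y z,
        forall (x : Z) (A : set Z),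
          nbhs x A <-> exists2 e, 0 < e & [set y | dist x y < e] `<=` A
      & complete_distance dist]) /\
  (exists2 S : set Z, countable S & dense S).

Notation borel Z := (g_sigma_algebraType (@open Z)).

Section NonAtomic.
Context (disp : measure_display) (T : measurableType disp) (R : realType).
Implicit Types (mu : {measure set T -> \bar R}) (A B : set T).

Definition atom mu A :=
  [/\ measurable A, (0 < mu A)%E &
      forall B, measurable B -> B `<=` A -> mu B = 0%E \/ mu B = mu A].

Definition non_atomic mu := forall A, ~ atom mu A.

End NonAtomic.

Section ProductMeasure.
Context (disp : measure_display) (T : measurableType disp) (R : realType).

Definition tuple_consp (n : nat) (p : T * n.-tuple T) : n.+1.-tuple T :=
  [tuple of p.1 :: p.2].

Definition tuple_unconsp (n : nat) (t : n.+1.-tuple T) : T * n.-tuple T :=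
  (thead t, [tuple of behead t]).

Lemma tuple_conspK (n : nat) : cancel (@tuple_consp n) (@tuple_unconsp n).
Proof.
move=> [x t]; rewrite /tuple_unconsp /tuple_consp /= theadE.
by congr pair; apply: val_inj.
Qed.

Lemma measurable_tuple_consp (n : nat) : measurable_fun setT (@tuple_consp n).
Proof. by apply: measurable_cons. Qed.

Lemma measurable_tuple_unconsp (n : nat) :
  measurable_fun setT (@tuple_unconsp n).
Proof.
apply: measurable_fun_pair; last exact: measurable_behead.
exact: measurable_tnth.
Qed.

Section cons_measure.
Variables (nu : {sigma_finite_measure set T -> \bar R}) (n : nat).
Variable mu : {sigma_finite_measure set (n.-tuple T) -> \bar R}.

Definition cons_measure : set (n.+1.-tuple T) -> \bar R :=
  pushforward (nu \x mu)%E (@tuple_consp n).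

Let mcons := @measurable_tuple_consp n.

Let cons_measure0 : cons_measure set0 = 0%E.
Proof. exact: measure0. Qed.

Let cons_measure_ge0 A : (0 <= cons_measure A)%E.
Proof. exact: measure_ge0. Qed.

Let cons_measure_sigma_additive : semi_sigma_additive cons_measure.
Proof. exact: measure_semi_sigma_additive. Qed.

HB.instance Definition _ := isMeasure.Build _ _ _ cons_measure
  cons_measure0 cons_measure_ge0 cons_measure_sigma_additive.

Let cons_measure_sigma_finite : sigma_finite setT cons_measure.
Proof.
have /sigma_finiteP[F [UF ndF Foo]] := sigma_finiteT nu.
have /sigma_finiteP[G [UG ndG Goo]] := sigma_finiteT mu.
exists (fun i => @tuple_unconsp n @^-1` (F i `*` G i)).
  apply/seteqP; split => // t _.
  have [i _ Fi] : (\bigcup_i F i) (tuple_unconsp t).1 by rewrite -UF.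
  have [j _ Gj] : (\bigcup_i G i) (tuple_unconsp t).2 by rewrite -UG.
  exists (maxn i j) => //; split.
    by move: Fi; exact/subsetPset/ndF/leq_maxl.
  by move: Gj; exact/subsetPset/ndG/leq_maxr.
move=> i; have [mF Fi] := Foo i; have [mG Gi] := Goo i; split.
  rewrite -[X in measurable X]setTI; apply: measurable_tuple_unconsp => //.
  exact: measurableX.
rewrite /cons_measure /pushforward -comp_preimage.
rewrite (_ : _ \o _ = id); last by rewrite funeqE => p; exact: tuple_conspK.
by rewrite preimage_id product_measure1E// lte_mul_pinfty// ge0_fin_numE.
Qed.

HB.instance Definition _ := Measure_isSigmaFinite.Build _ _ _ cons_measure
  cons_measure_sigma_finite.

End cons_measure.

(* The n-fold product measure; power_measure_box characterizes it, nu being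
   sigma-finite. *)
Fixpoint power_measure (nu : {sigma_finite_measure set T -> \bar R}) (n : nat) :
    {sigma_finite_measure set (n.-tuple T) -> \bar R} :=
  match n with
  | 0 => [the {sigma_finite_measure set (0.-tuple T) -> \bar R}
            of dirac [tuple]]
  | n'.+1 => [the {sigma_finite_measure set (n'.+1.-tuple T) -> \bar R}
            of cons_measure nu (power_measure nu n')]
  end.

Lemma power_measure_box (nu : {sigma_finite_measure set T -> \bar R})
    (n : nat) (A : 'I_n -> set T) : (forall i, measurable (A i)) ->
  power_measure nu n [set t | forall i, A i (tnth t i)] =
    (\prod_(i < n) nu (A i))%E.
Proof.
elim: n A => [|n IHn] A mA.
  rewrite big_ord0 /= (_ : [set t | _] = setT) ?diracT// -subTset => t _ /=.
  by case.
have mbox : measurable [set t : n.-tuple T | forall i, A (lift ord0 i) (tnth t i)].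
  rewrite (_ : [set t | _] = \bigcap_(i in [set: 'I_n])
      ((fun t : n.-tuple T => tnth t i) @^-1` A (lift ord0 i))); last first.
    by apply/seteqP; split => t /= tA i; [move=> _; exact: tA|exact: (tA i I)].
  apply: fin_bigcap_measurable => // i _.
  by rewrite -[X in measurable X]setTI; exact: measurable_tnth.
rewrite big_ord_recl -IHn// -product_measure1E//=.
rewrite /cons_measure /pushforward; congr (_ _).
apply/seteqP; split => -[x t] /= => [tA|[xA tA] i].
  by split => [|i]; [exact: (tA ord0)|have := tA (lift ord0 i); rewrite tnthS].
by case: (unliftP ord0 i) => [j ->|->] //=; rewrite tnthS.
Qed.

End ProductMeasure.

Definition tuple_perm (T : Type) (d : nat) (s : 'S_d) (x : d.-tuple T) :
  d.-tuple T := [tuple tnth x (s i) | i < d].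

(* Elements of L^2 are represented by functions, hence symmetry is required only
   almost everywhere. *)
Definition L2s (disp : measure_display) (T : measurableType disp)
    (R : realType) (nu : {sigma_finite_measure set T -> \bar R}) (d : nat)
    (f : d.-tuple T -> R) : Prop :=
  f \in Lfun (power_measure nu d) 2%:E /\
  forall s : 'S_d, {ae power_measure nu d, forall x, f (tuple_perm s x) = f x}.

Section FSigma.
Context (T : pointedType) (R : realType).

Definition tensor (n d : nat) (f : d.-tuple T -> R) (x : (n * d).-tuple T) : R :=
  \prod_(j < n) f [tuple tnth x (dpos j k) | k < d].

(* The variables of f_sigma are indexed by the blocks of sigma; the value point
   is never used when sigma has at most m blocks. *)
Definition spread (m n d : nat) (sigma : {set {set 'I_(n * d)}})
    (y : m.-tuple T) : (n * d).-tuple T :=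
  [tuple nth point y (block_index sigma i) | i < n * d].

Definition fsigma (m n d : nat) (f : d.-tuple T -> R)
    (sigma : {set {set 'I_(n * d)}}) (y : m.-tuple T) : R :=
  tensor f (spread sigma y).

End FSigma.

(* Main.v *)
Require Import Defs.
From HB Require Import structures.
From mathcomp Require Import all_boot all_order all_algebra all_fingroup.
From mathcomp Require Import all_classical all_reals all_analysis.
From mathcomp Require Import measurable_realfun zify ring lra.

Import Order.TTheory GRing.Theory Num.Theory.
Import numFieldNormedType.Exports.

Local Open Scope classical_set_scope.
Local Open Scope ring_scope.

Set Implicit Arguments.
Unset Strict Implicit.
Unset Printing Implicit Defensive.

(* Integrating out the variables shared by two kernels of a diagram gives a
   contraction.  A circular diagram is the squared norm of the contraction of its
   first two rows; hence 2 => 1: a connected diagram on n >= 3 rows has two rows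
   sharing r variables with 0 < r < d, and by the Cauchy-Schwarz inequality for
   products in which every variable occurs twice its square is at most the
   circular diagram of parameter r times ||f||^(2(n-2)).  For 1 => 2 take n = 4:
   the circular diagrams are nonnegative, and so is the sum of the others.
   Indeed, in a noncircular diagram rows 0 and 2 share a variable, and permuting
   the remaining variables of rows 0 and 2 yields noncircular diagrams again,
   whose average is a squared norm.  All this is done for bounded kernels and a
   finite measure, where partial integrals are total and commute, and passes to
   L^2 by truncation. *)

(** * Partial integration of bounded measurable functions *)

(** Partitions are handled through labelings of the [n * d] positions by [m] variables. The
    averaging argument forces this: renaming the variables of rows 0 and 2 while rows 1 and 3 keep
    theirs is an action on labelings, and makes sense on a partition only after its blocks have been
    named. Every partition in [M2 4 d] has exactly [m]! labelings, so sums over partitions and over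
    labelings differ by a constant factor. The two implications are of different nature. A
    noncircular diagram with four rows is a scalar product of two contractions that are
    rearrangements of one another, which has no evident sign; positivity comes from the orbit, so
    item 1 is used through a sum. In the other direction each diagram is bounded separately, and the
    bound on its square is a circular diagram that depends on the partition and not on the kernel,
    times a power of a convergent norm. Kernels are symmetric only almost everywhere, whereas
    identifying variables is a pointwise operation. They are therefore replaced by their
    symmetrizations, which requires that null sets pull back to null sets under the identifications
    inside one row. *)

Section TupleMaps.
Context (disp : measure_display) (T : measurableType disp).

Definition upd m (x : m.-tuple T) (i : 'I_m) (z : T) : m.-tuple T :=
  [tuple if j == i then z else tnth x j | j < m].

Definition pull k m (e : 'I_k -> 'I_m) (x : m.-tuple T) : k.-tuple T :=
  [tuple tnth x (e j) | j < k].

Lemma tnth_upd m (x : m.-tuple T) i z j :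
  tnth (upd x i z) j = if j == i then z else tnth x j.
Proof. by rewrite tnth_mktuple. Qed.

Lemma tnth_pull k m (e : 'I_k -> 'I_m) (x : m.-tuple T) j :
  tnth (pull e x) j = tnth x (e j).
Proof. by rewrite tnth_mktuple. Qed.

Lemma upd_comm m (x : m.-tuple T) i j z w : i != j ->
  upd (upd x i z) j w = upd (upd x j w) i z.
Proof.
move=> ij; apply: eq_from_tnth => k; rewrite !tnth_upd.
by case: (eqVneq k j) => // ->; rewrite eq_sym (negPf ij).
Qed.

Lemma upd_idem m (x : m.-tuple T) i z w : upd (upd x i z) i w = upd x i w.
Proof. by apply: eq_from_tnth => k; rewrite !tnth_upd; case: eqP. Qed.

Lemma pull_comp k m p (e : 'I_k -> 'I_m) (e' : 'I_m -> 'I_p) (x : p.-tuple T) :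
  pull e (pull e' x) = pull (e' \o e) x.
Proof. by apply: eq_from_tnth => j; rewrite !tnth_pull. Qed.

Lemma pull_upd k m (e : 'I_k -> 'I_m) (x : m.-tuple T) i z : injective e ->
  pull e (upd x (e i) z) = upd (pull e x) i z.
Proof.
move=> ie; apply: eq_from_tnth => j.
by rewrite !(tnth_pull, tnth_upd) (inj_eq ie).
Qed.

Lemma measurable_pull k m (e : 'I_k -> 'I_m) :
  measurable_fun setT (pull e : m.-tuple T -> _).
Proof.
apply/measurable_fun_tnthP => j.
rewrite (_ : _ \o _ = (@tnth _ T ^~ (e j))); first exact: measurable_tnth.
by apply/funext => x /=; rewrite tnth_pull.
Qed.

Lemma measurable_fun_upd m (i : 'I_m) :
  measurable_fun setT (fun p : m.-tuple T * T => upd p.1 i p.2).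
Proof.
apply/measurable_fun_tnthP => j; have [ji|ji] := eqVneq j i.
  rewrite (_ : _ \o _ = snd) //.
  by apply/funext => p /=; rewrite tnth_upd ji eqxx.
rewrite (_ : _ \o _ = (@tnth _ T ^~ j) \o fst).
  by apply: measurableT_comp => //; exact: measurable_tnth.
by apply/funext => p /=; rewrite tnth_upd (negPf ji).
Qed.

Lemma measurable_upd m (x : m.-tuple T) i : measurable_fun setT (upd x i).
Proof. exact: (measurableT_comp (measurable_fun_upd i) (measurable_pair1 x)). Qed.

Lemma measurable_upd2 m (x : m.-tuple T) i j :
  measurable_fun setT (fun p : T * T => upd (upd x i p.1) j p.2).
Proof.
have mg : measurable_fun setT (fun p : T * T => (upd x i p.1, p.2)).
  apply: measurable_fun_pair => //=.
  by apply: measurableT_comp => //; exact: measurable_upd.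
exact: (measurableT_comp (measurable_fun_upd j) mg).
Qed.

End TupleMaps.

Definition bmeas (disp : measure_display) (X : measurableType disp)
    (R : realType) (h : X -> R) :=
  measurable_fun setT h /\ exists M, forall x, `|h x| <= M.

Section BoundedMeasurable.
Context (disp : measure_display) (X : measurableType disp) (R : realType).
Implicit Types (h g : X -> R).

Lemma bmeas_cst (c : R) : bmeas (fun _ : X => c).
Proof. by split; [exact: measurable_cst|exists `|c|]. Qed.

Lemma bmeasD h g : bmeas h -> bmeas g -> bmeas (h \+ g).
Proof.
move=> [mh [M hM]] [mg [N gN]]; split; first exact: measurable_funD.
by exists (M + N) => x; apply: (le_trans (ler_normD _ _)); exact: lerD.
Qed.

Lemma bmeasM h g : bmeas h -> bmeas g -> bmeas (h \* g).
Proof.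
move=> [mh [M hM]] [mg [N gN]]; split; first exact: measurable_funM.
by exists (M * N) => x; rewrite normrM ler_pM.
Qed.

Lemma bmeas_sum (I : Type) (r : seq I) (P : pred I) (F : I -> X -> R) :
  (forall i, bmeas (F i)) -> bmeas (fun x => \sum_(i <- r | P i) F i x).
Proof.
move=> bF; elim: r => [|i r IH].
  by under eq_fun do rewrite big_nil; exact: bmeas_cst.
under eq_fun do rewrite big_cons; case: (P i) => //; exact: bmeasD.
Qed.

Lemma bmeas_prod (I : Type) (r : seq I) (P : pred I) (F : I -> X -> R) :
  (forall i, bmeas (F i)) -> bmeas (fun x => \prod_(i <- r | P i) F i x).
Proof.
move=> bF; elim: r => [|i r IH].
  by under eq_fun do rewrite big_nil; exact: bmeas_cst.
under eq_fun do rewrite big_cons; case: (P i) => //; exact: bmeasM.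
Qed.

Lemma bmeas_sqr h : bmeas h -> bmeas (fun x => h x ^+ 2).
Proof. by move=> bh; under eq_fun do rewrite expr2; exact: bmeasM. Qed.

Lemma bmeas_norm h : bmeas h -> bmeas (fun x => `|h x|).
Proof.
move=> [mh [M hM]]; split; first exact: measurableT_comp.
by exists M => x; rewrite normr_id.
Qed.

Lemma bmeas_comp disp' (Y : measurableType disp') (g : Y -> X) h :
  measurable_fun setT g -> bmeas h -> bmeas (h \o g).
Proof.
move=> mg [mh [M hM]]; split; first exact: measurableT_comp.
by exists M => y; exact: hM.
Qed.

Lemma bmeas_integrable (mu : {finite_measure set X -> \bar R}) h :
  bmeas h -> mu.-integrable setT (EFin \o h).
Proof.
move=> [mh [M hM]]; apply: measurable_bounded_integrable => //.
  by rewrite ltey_eq fin_num_measure.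
exists M; split; first exact: num_real.
by move=> N MN x _ /=; exact: le_trans (hM x) (ltW MN).
Qed.

Lemma product_measure1_lty disp' (Y : measurableType disp')
    (mu : {finite_measure set X -> \bar R})
    (nu : {finite_measure set Y -> \bar R}) : ((mu \x nu) setT < +oo)%E.
Proof.
by rewrite -setXTT product_measure1E//= ltey_eq fin_numM ?fin_num_measure.
Qed.

Lemma EFin_Rintegral (mu : {measure set X -> \bar R}) D h : measurable D ->
  mu.-integrable D (EFin \o h) ->
  (\int[mu]_(x in D) h x)%:E = (\int[mu]_(x in D) (h x)%:E)%E.
Proof. by move=> mD ih; rewrite fineK//; exact: integrable_fin_num. Qed.

End BoundedMeasurable.

(* Locked: unfolding it makes failing unifications very slow. *)
HB.lock Definition pint (disp : measure_display) (T : measurableType disp)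
    (R : realType) (rho : {finite_measure set T -> \bar R}) (m : nat)
    (i : 'I_m) (h : m.-tuple T -> R) (x : m.-tuple T) : R :=
  \int[rho]_z h (upd x i z).

Section PartialIntegral.
Context (disp : measure_display) (T : measurableType disp) (R : realType).
Variable rho : {finite_measure set T -> \bar R}.
Variable m : nat.
Implicit Types (h g : m.-tuple T -> R) (i j : 'I_m) (x : m.-tuple T).

Local Notation pint := (pint rho).

Lemma pintE i h x : pint i h x = \int[rho]_z h (upd x i z).
Proof. by rewrite pint.unlock. Qed.

Lemma bmeas_upd h i x : bmeas h -> bmeas (fun z => h (upd x i z)).
Proof. by move=> bh; apply: bmeas_comp bh => //; exact: measurable_upd. Qed.

Lemma integrable_upd h i x : bmeas h ->
  rho.-integrable setT (EFin \o (fun z => h (upd x i z))).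
Proof. by move=> bh; apply: bmeas_integrable; exact: bmeas_upd. Qed.

Lemma pint_bmeas i h : bmeas h -> bmeas (pint i h).
Proof.
move=> bh; have [mh [M hM]] := bh; split.
  have mf : measurable_fun setT (fun p : m.-tuple T * T => h (upd p.1 i p.2)).
    exact: measurableT_comp mh (measurable_fun_upd i).
  (* Only measurability in [x] is wanted here. The zero measure on tuples is a placeholder that
     makes the product finite and the bounded integrand integrable. *)
  have /measurable_fubini_F mF : ((mzero : {finite_measure set (m.-tuple T) -> \bar R}) \x rho)%E.-integrable
      setT (EFin \o (fun p : m.-tuple T * T => h (upd p.1 i p.2))).
    apply: measurable_bounded_integrable => //.
      exact: product_measure1_lty.
    exists M; split; first exact: num_real.
    by move=> N MN x _ /=; exact: le_trans (hM _) (ltW MN).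
  rewrite (_ : pint i h = fun x => \int[rho]_z h (upd x i z)); last first.
    by apply/funext => x; rewrite pintE.
  exact: (measurableT_comp (fine_measurable measurableT) mF).
exists (M * fine (rho setT)) => x; rewrite pintE.
rewrite (le_trans (le_normr_Rintegral _ (integrable_upd i x bh)))//.
rewrite -Rintegral_cst//; apply: le_Rintegral => //.
- exact: (integrable_upd i x (bmeas_norm bh)).
- by apply: bmeas_integrable; exact: bmeas_cst.
Qed.

Lemma EFin_pint i h x : bmeas h ->
  (pint i h x)%:E = (\int[rho]_z (h (upd x i z))%:E)%E.
Proof. by move=> bh; rewrite pintE; apply: EFin_Rintegral => //; exact: integrable_upd. Qed.

Lemma pintD i h g : bmeas h -> bmeas g ->
  pint i (h \+ g) =1 pint i h \+ pint i g.
Proof. by move=> bh bg x; rewrite /= !pintE /= RintegralD//; exact: integrable_upd. Qed.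

Lemma pint_ge0 i h x : (forall y, 0 <= h y) -> 0 <= pint i h x.
Proof. by move=> h0; rewrite pintE; apply: Rintegral_ge0 => z _. Qed.

Lemma le_pint i h g x : bmeas h -> bmeas g -> (forall y, h y <= g y) ->
  pint i h x <= pint i g x.
Proof. by move=> bh bg hg; rewrite !pintE; apply: le_Rintegral => //; exact: integrable_upd. Qed.

Lemma pint_comm i j h : bmeas h -> pint i (pint j h) =1 pint j (pint i h).
Proof.
move=> bh x; have [->//|ij] := eqVneq i j.
have [mh [M hM]] := bh.
have mf : measurable_fun setT (fun p : T * T => h (upd (upd x i p.1) j p.2)).
  exact: measurableT_comp mh (measurable_upd2 x i j).
have fub : ((rho \x rho)%E).-integrable setT
    (EFin \o (fun p : T * T => h (upd (upd x i p.1) j p.2))).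
  apply: measurable_bounded_integrable => //.
    exact: product_measure1_lty.
  exists M; split; first exact: num_real.
  by move=> N MN p _ /=; exact: le_trans (hM _) (ltW MN).
apply: EFin_inj.
rewrite (EFin_pint i x (pint_bmeas j bh)) (EFin_pint j x (pint_bmeas i bh)).
under eq_integral do rewrite (EFin_pint _ _ bh).
under [RHS]eq_integral do rewrite (EFin_pint _ _ bh).
rewrite (Fubini fub)/=; apply: eq_integral => z _; apply: eq_integral => w _.
by rewrite upd_comm.
Qed.

(** Integration does not lower the arity: a variable that has been integrated stays as a dummy, and
    [indep] records that the function ignores it. *)
Definition indep i h := forall x z, h (upd x i z) = h x.

Lemma pint_indepl i h g : indep i g -> bmeas h ->
  pint i (g \* h) =1 g \* pint i h.
Proof.
move=> ig bh x; rewrite /= !pintE /=; under eq_Rintegral do rewrite ig.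
by rewrite RintegralZl//; exact: integrable_upd.
Qed.

Lemma pintZ i c h : bmeas h -> pint i (fun x => c * h x) =1 (fun x => c * pint i h x).
Proof. by move=> bh; apply: (@pint_indepl i h (cst c)) bh. Qed.

Lemma indep_pint i h : indep i (pint i h).
Proof. by move=> x z; rewrite !pintE; under eq_Rintegral do rewrite upd_idem. Qed.

Lemma indep_pint_other i j h : indep i h -> indep i (pint j h).
Proof.
move=> ih; have [->|ij] := eqVneq i j; first exact: indep_pint.
move=> x z; rewrite !pintE; apply: eq_Rintegral => w _.
by rewrite upd_comm// ih.
Qed.

Lemma indepM i h g : indep i h -> indep i g -> indep i (h \* g).
Proof. by move=> ih ig x z /=; rewrite ih ig. Qed.

(* AM-GM, [2 |H| <= t N + P / t], survives integration; then optimise over t. *)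
Lemma pint_CS i (H N P : m.-tuple T -> R) x : bmeas H -> bmeas N -> bmeas P ->
  (forall y, 0 <= N y) -> (forall y, 0 <= P y) ->
  (forall y, H y ^+ 2 <= N y * P y) ->
  pint i H x ^+ 2 <= pint i N x * pint i P x.
Proof.
move=> bH bN bP N0 P0 HNP.
set a := pint i N x; set b := pint i P x; set c := pint i H x.
have a0 : 0 <= a by exact: pint_ge0.
have b0 : 0 <= b by exact: pint_ge0.
have key t : 0 < t -> 2 * `|c| <= t * a + t^-1 * b.
  move=> t0.
  have -> : t * a + t^-1 * b = pint i (fun y => t * N y + t^-1 * P y) x.
    rewrite (@pintD i (fun y => t * N y) (fun y => t^-1 * P y)) /=.
    - by rewrite !pintZ.
    - exact: (bmeasM (bmeas_cst _ t) bN).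
    - exact: (bmeasM (bmeas_cst _ t^-1) bP).
  apply: (@le_trans _ _ (pint i (fun y => 2 * `|H y|) x)).
    rewrite pintZ; last exact: bmeas_norm.
    by rewrite ler_pM2l// /c !pintE; exact: (le_normr_Rintegral _ (integrable_upd i x bH)).
  apply: le_pint.
  - exact: (bmeasM (bmeas_cst _ 2) (bmeas_norm bH)).
  - by apply: (@bmeasD _ _ _ (fun y => t * N y) (fun y => t^-1 * P y));
      [exact: (bmeasM (bmeas_cst _ t) bN)|exact: (bmeasM (bmeas_cst _ t^-1) bP)].
  move=> y; rewrite -(@ler_pXn2r _ 2)// ?nnegrE ?mulr_ge0 ?addr_ge0 ?mulr_ge0 ?invr_ge0 ?(ltW t0)//.
  apply: (@le_trans _ _ (4 * (N y * P y))).
    rewrite exprMn real_normK ?num_real//.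
    by rewrite (_ : 2 ^+ 2 = 4 :> R) ?ler_pM2l// -natrX.
  rewrite -subr_ge0.
  have -> : (t * N y + t^-1 * P y) ^+ 2 - 4 * (N y * P y)
     = (t * N y - t^-1 * P y) ^+ 2.
    by field; rewrite gt_eqF.
  exact: sqr_ge0.
rewrite -[c ^+ 2]real_normK ?num_real//.
have [->|c0] := eqVneq `|c| 0; first by rewrite expr0n mulr_ge0.
have {}c0 : 0 < `|c| by rewrite lt0r c0 normr_ge0.
(* If [a = 0] the bound [key] improves as [t] grows; at [t = (b + 1) / |c|] it reads
   [2 |c| <= |c| b / (b + 1)], which contradicts [c <> 0]. *)
have [a00|a00] := eqVneq a 0.
  have t0 : 0 < (b + 1) / `|c| by rewrite divr_gt0// ltr_wpDl.
  have := key _ t0; rewrite a00 mulr0 add0r invf_div => h.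
  have b1 : 0 < b + 1 by rewrite ltr_wpDl.
  suff : `|c| * (b + 2) <= 0 by nra.
  move: h; rewrite mulrAC ler_pdivlMr//; nra.
have {}a00 : 0 < a by rewrite lt0r a00.
(* This [t] makes [t * a] equal to [|c|], so that [key] becomes [|c| <= a / |c| * b] without any
   square root. *)
have := key (`|c| / a) (divr_gt0 c0 a00).
rewrite invf_div divfK ?gt_eqF// => h.
have : `|c| <= a / `|c| * b by lra.
by rewrite mulrAC ler_pdivlMr// -expr2.
Qed.

End PartialIntegral.

(** * Iterated integrals over sets of variables *)

Section IteratedIntegral.
Context (disp : measure_display) (T : measurableType disp) (R : realType).
Variable rho : {finite_measure set T -> \bar R}.
Local Notation pint := (@pint _ _ _ rho _).

Definition pints m (s : seq 'I_m) (h : m.-tuple T -> R) := foldr pint h s.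

(** By Fubini ([pints_perm]) the order of [enum A] is immaterial for bounded measurable functions.
    Dependence on [x] remains only through the variables outside [A]. *)
Definition spint m (A : {set 'I_m}) (h : m.-tuple T -> R) := pints (enum A) h.

Section OneArity.
Variable m : nat.
Implicit Types (h g : m.-tuple T -> R) (i j : 'I_m) (s : seq 'I_m).
Implicit Types (x y : m.-tuple T) (A B : {set 'I_m}).

Lemma pints_bmeas s h : bmeas h -> bmeas (pints s h).
Proof. by move=> bh; elim: s => //= i s; exact: pint_bmeas. Qed.

Lemma pints_cat s s' h : pints (s ++ s') h = pints s (pints s' h).
Proof. exact: foldr_cat. Qed.

Lemma pintC i j h : bmeas h -> pint i (pint j h) = pint j (pint i h).
Proof. by move=> bh; apply/funext; exact: pint_comm. Qed.

Lemma pints_rem i s h : bmeas h -> i \in s ->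
  pints s h = pint i (pints (rem i s) h).
Proof.
move=> bh; elim: s => //= j s IH; rewrite inE eq_sym.
have [->//|ji /= /IH ->] := eqVneq j i.
by rewrite pintC//; exact: pints_bmeas.
Qed.

Lemma pints_perm s s' h : bmeas h -> perm_eq s s' -> pints s h = pints s' h.
Proof.
move=> bh; elim: s s' => [|i s IH] s' ss'.
  by move: ss' => /perm_size /esym/size0nil ->.
have is' : i \in s' by rewrite -(perm_mem ss') inE eqxx.
rewrite (pints_rem bh is') /=; congr (pint i _); apply: IH.
by move: (perm_to_rem is') => /(perm_trans ss'); rewrite perm_cons.
Qed.

Lemma pints_indepl s h g : (forall i, i \in s -> indep i g) -> bmeas h ->
  pints s (g \* h) = g \* pints s h.
Proof.
move=> + bh; elim: s => //= i s IH ig.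
rewrite IH => [|j js]; last by apply: ig; rewrite inE js orbT.
apply/funext => x; rewrite pint_indepl//; last exact: pints_bmeas.
by apply: ig; rewrite inE eqxx.
Qed.

Lemma pints_ge0 s h x : (forall y, 0 <= h y) -> 0 <= pints s h x.
Proof. by move=> h0; elim: s x => //= i s IH x; exact: pint_ge0. Qed.

Lemma pintsD s h g : bmeas h -> bmeas g ->
  pints s (h \+ g) = pints s h \+ pints s g.
Proof.
move=> bh bg; elim: s => //= i s ->; apply/funext => x.
by rewrite pintD//; exact: pints_bmeas.
Qed.

Lemma indep_pints i s h : indep i h -> indep i (pints s h).
Proof. by move=> ih; elim: s => //= j s; exact: indep_pint_other. Qed.

Lemma indep_pints_mem i s h : i \in s -> indep i (pints s h).
Proof.
elim: s => //= j s IH; rewrite inE => /predU1P[->|/IH].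
  exact: indep_pint.
exact: indep_pint_other.
Qed.

(** The coordinates in [A] are changed one at a time. This is how functions that keep dummy
    variables are compared at different points. *)
Lemma indep_eq A h x y : (forall i, i \in A -> indep i h) ->
  (forall i, i \notin A -> tnth x i = tnth y i) -> h x = h y.
Proof.
move=> hA; have [k] := ubnP #|A|; elim: k => // k IH in A x hA *.
have [->|[i iA]] := set_0Vmem A => [_ xy|Ak xy].
  by congr h; apply: eq_from_tnth => i; rewrite xy ?inE.
rewrite -(hA i iA x (tnth y i)); apply: (IH (A :\ i)).
- by move=> j /setD1P[_]; exact: hA.
- by move: Ak; rewrite (cardsD1 i) iA.
move=> j; rewrite in_setD1 negb_and negbK tnth_upd.
by case: eqVneq => [->//|_ /= /xy].
Qed.

Lemma spint_bmeas A h : bmeas h -> bmeas (spint A h).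
Proof. exact: pints_bmeas. Qed.

Lemma spint_ge0 A h x : (forall y, 0 <= h y) -> 0 <= spint A h x.
Proof. exact: pints_ge0. Qed.

Lemma spintD A h g : bmeas h -> bmeas g ->
  spint A (h \+ g) = spint A h \+ spint A g.
Proof. exact: pintsD. Qed.

Lemma spint_indepl A h g : (forall i, i \in A -> indep i g) -> bmeas h ->
  spint A (g \* h) = g \* spint A h.
Proof.
by move=> ig bh; apply: pints_indepl => // i; rewrite mem_enum; exact: ig.
Qed.

Lemma spint_indepr A h g : (forall i, i \in A -> indep i g) -> bmeas h ->
  spint A (h \* g) = spint A h \* g.
Proof.
move=> ig bh; rewrite (_ : h \* g = g \* h).
  by rewrite spint_indepl//; apply/funext => x /=; rewrite mulrC.
by apply/funext => x /=; rewrite mulrC.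
Qed.

Lemma spint0 A : spint A (fun=> 0) = fun=> 0.
Proof.
rewrite /spint; elim: (enum A) => //= i s ->; apply/funext => x.
by rewrite pintE Rintegral_cst// mul0r.
Qed.

Lemma le_spint A h g x : bmeas h -> bmeas g -> (forall y, h y <= g y) ->
  spint A h x <= spint A g x.
Proof.
move=> bh bg hg; rewrite /spint; elim: (enum A) x => //= i s IH x.
by apply: le_pint => //; exact: pints_bmeas.
Qed.

Lemma spint_sum (I : Type) (r : seq I) (P : pred I) (F : I -> m.-tuple T -> R) A :
  (forall k, bmeas (F k)) ->
  spint A (fun x => \sum_(k <- r | P k) F k x) =
  (fun x => \sum_(k <- r | P k) spint A (F k) x).
Proof.
move=> bF; elim: r => [|k r IH].
  under eq_fun do rewrite big_nil; under [RHS]eq_fun do rewrite big_nil.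
  exact: spint0.
under eq_fun do rewrite big_cons; under [RHS]eq_fun do rewrite big_cons.
case: (P k) => //.
have -> := @spintD A (F k) (fun x => \sum_(j <- r | P j) F j x) (bF k) (bmeas_sum _ _ bF).
by rewrite IH.
Qed.

Lemma spintU A B h : bmeas h -> [disjoint A & B]%B ->
  spint (A :|: B) h = spint A (spint B h).
Proof.
move=> bh dAB; rewrite /spint -pints_cat; apply: pints_perm => //.
apply: uniq_perm; first exact: enum_uniq.
  rewrite cat_uniq !enum_uniq andbT /=; apply/hasPn => i; rewrite !mem_enum.
  by move: dAB; rewrite disjoint_sym => /disjointFr; move=> /[apply] ->.
by move=> i; rewrite mem_cat !mem_enum inE.
Qed.

Lemma indep_spint i A h : indep i h -> indep i (spint A h).
Proof. exact: indep_pints. Qed.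

Lemma indep_spint_mem i A h : i \in A -> indep i (spint A h).
Proof. by move=> iA; apply: indep_pints_mem; rewrite mem_enum. Qed.

Lemma spintT_cst h x y : spint [set: 'I_m]%SET h x = spint [set: 'I_m]%SET h y.
Proof.
apply: (@indep_eq [set: 'I_m]%SET) => [i|i]; last by rewrite inE.
exact: indep_spint_mem.
Qed.

(* The Cauchy-Schwarz inequality for a product in which every variable is shared
   by two factors; the variables are integrated one at a time, each integration
   being an ordinary Cauchy-Schwarz inequality for the two factors it joins. *)
Lemma pints_prod_CS (V : finType) (B : V -> {set 'I_m})
    (g : V -> m.-tuple T -> R) s x :
  (forall v, bmeas (g v)) ->
  (forall i v, i \in s -> i \notin B v -> indep i (g v)) ->
  (forall i, i \in s -> exists v w, v != w /\
     forall u, (i \in B u) = (u == v) || (u == w)) ->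
  (pints s (fun y => \prod_v g v y) x) ^+ 2 <=
  \prod_v pints [seq i <- s | i \in B v] (fun y => g v y ^+ 2) x.
Proof.
move=> bg; elim: s x => [|i s IH] x ig two /=.
  by under eq_bigr do rewrite /=; rewrite -prodrXl.
set H := pints s _; pose N v := pints [seq j <- s | j \in B v] (fun y => g v y ^+ 2).
have bN v : bmeas (N v) by exact/pints_bmeas/bmeas_sqr.
have N0 v y : 0 <= N v y by apply: pints_ge0 => z; exact: sqr_ge0.
have HN y : H y ^+ 2 <= \prod_v N v y.
  apply: IH => [j v js|j js]; first by apply: ig; rewrite inE js orbT.
  by apply: two; rewrite inE js orbT.
(* Among the factors [N], those of [v] and [w] alone involve [i]; the product [K] of the others
   leaves the integral. *)
have [v [w [vw Bi]]] := two i (mem_head _ _).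
pose K y := \prod_(u | (u != v) && (u != w)) N u y.
have K0 y : 0 <= K y by apply: prodr_ge0.
have iK : indep i K.
  move=> y z; apply: eq_bigr => u /andP[uv uw]; apply: indep_pints => {}y {}z.
  by rewrite ig ?inE ?eqxx// Bi (negPf uv) (negPf uw).
have NK y : \prod_u N u y = K y * N v y * N w y.
  rewrite (bigD1 v)//= (bigD1 w) 1?eq_sym//= /K mulrA.
  by rewrite [RHS]mulrC [RHS]mulrA [N w y * _]mulrC mulrAC mulrC mulrA mulrC.
have bK : bmeas K by exact: bmeas_prod.
apply: (le_trans (@pint_CS _ _ _ rho m i H (K \* N v) (N w) x _ _ _ _ _ _)) => //.
- by apply/pints_bmeas/bmeas_prod.
- exact: bmeasM.
- by move=> y; apply: mulr_ge0.
- by move=> y; rewrite -NK.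
rewrite pint_indepl// /= [leRHS](bigD1 v)//= (bigD1 w) 1?eq_sym//=.
rewrite !Bi !eqxx orbT /= -/(N v) -/(N w).
rewrite (eq_bigr (N^~ x)) => [|u /andP[uv uw]]; last first.
  by rewrite Bi (negPf uv) (negPf uw).
by rewrite -/(K x) mulrA [X in _ <= X]mulrC mulrA.
Qed.

End OneArity.

Section Pull.
Variables k m : nat.
Implicit Types (h : k.-tuple T -> R) (e : 'I_k -> 'I_m).

Lemma pints_map e s h : injective e ->
  pints (map e s) (h \o pull e) = pints s h \o pull e.
Proof.
move=> ie; elim: s => //= i s ->; apply/funext => x /=.
by rewrite !pintE; apply: eq_Rintegral => z _ /=; rewrite pull_upd.
Qed.

Lemma spint_imset e (A : {set 'I_k}) h : injective e -> bmeas h ->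
  spint (e @: A) (h \o pull e) = spint A h \o pull e.
Proof.
move=> ie bh; rewrite /spint -pints_map//; apply: pints_perm.
  by apply: bmeas_comp bh => //; exact: measurable_pull.
apply: uniq_perm; rewrite ?map_inj_uniq ?enum_uniq// => i.
rewrite mem_enum; apply/imsetP/mapP => -[j jA ->]; exists j => //;
  by move: jA; rewrite mem_enum.
Qed.

End Pull.

Lemma spint_gCS m (V : finType) (B : V -> {set 'I_m})
    (g : V -> m.-tuple T -> R) (A : {set 'I_m}) x :
  (forall v, bmeas (g v)) ->
  (forall i v, i \in A -> i \notin B v -> indep i (g v)) ->
  (forall v, B v \subset A) ->
  (forall i, i \in A -> exists v w, v != w /\
     forall u, (i \in B u) = (u == v) || (u == w)) ->
  (spint A (fun y => \prod_v g v y) x) ^+ 2 <=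
  \prod_v spint (B v) (fun y => g v y ^+ 2) x.
Proof.
move=> bg ig BA two.
apply: (le_trans (@pints_prod_CS _ _ B _ (enum A) x bg _ _)) => [i v|i|].
- by rewrite mem_enum; exact: ig.
- by rewrite mem_enum; exact: two.
apply: ler_prod => v _; rewrite pints_ge0/=; last by move=> y; exact: sqr_ge0.
rewrite le_eqVlt; apply/orP; left; apply/eqP.
congr (_ _); apply: pints_perm; first exact: bmeas_sqr.
apply: uniq_perm => [||i]; [exact/filter_uniq/enum_uniq|exact: enum_uniq|].
rewrite mem_filter !mem_enum; case: (boolP (i \in B v)) => //= iB.
by rewrite (fintype.subsetP (BA v)).
Qed.

End IteratedIntegral.

(** * Permutations and injections carrying given finite sets to given sets *)

Lemma perm_of_seqs (I : finType) (s s' : seq I) : uniq s -> perm_eq s s' ->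
  exists p : {perm I}, (forall i, i \notin s -> p i = i) /\ map p s = s'.
Proof.
case: s => [_|i0 s1].
  move=> /perm_size/esym/size0nil ->.
  by exists 1%g; split=> // i _; rewrite perm1.
set s := i0 :: s1; move=> us ss'; have us' : uniq s' by rewrite -(perm_uniq ss').
(* The default value [i] of [nth] makes [g] the identity outside [s]. *)
pose g i := nth i s' (index i s).
have gin i : i \in s -> g i \in s'.
  by move=> is_; rewrite mem_nth// -(perm_size ss') index_mem.
have gout i : i \notin s -> g i = i.
  by move=> /memNindex is_; rewrite /g is_ (perm_size ss') nth_default.
have ig : injective g.
  move=> i j; have [is_|is_] := boolP (i \in s); have [js|js] := boolP (j \in s).
  - rewrite /g => /eqP; rewrite (set_nth_default i j) ?nth_uniq//;
      rewrite -?(perm_size ss') ?index_mem//.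
    by move=> /eqP ij; rewrite -(nth_index i is_) ij nth_index.
  - move=> gij; move: (gin i is_); rewrite gij (gout j js).
    by rewrite -(perm_mem ss') (negPf js).
  - move=> gij; move: (gin j js); rewrite -gij (gout i is_).
    by rewrite -(perm_mem ss') (negPf is_).
  - by rewrite !gout.
exists (perm ig); split=> [i is_|]; first by rewrite permE gout.
apply: (@eq_from_nth _ i0) => [|k]; first by rewrite size_map (perm_size ss').
rewrite size_map => ks; rewrite (nth_map i0)// permE /g index_uniq//.
by rewrite (set_nth_default i0)// -(perm_size ss').
Qed.

Lemma imsetD_inj (aT rT : finType) (g : aT -> rT) (A B : {set aT}) :
  injective g -> (g @: (A :\: B) = (g @: A) :\: (g @: B))%SET.
Proof.
move=> ig; apply/setP => y.
apply/imsetP/finset.setDP => [[x /finset.setDP[xA xB] ->]|[/imsetP[x xA ->]]].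
  by rewrite imset_f// mem_imset.
by rewrite mem_imset// => xB; exists x; rewrite ?inE ?xA ?xB.
Qed.

Lemma card_ex_inj k m (A : {set 'I_m}) : #|A| = k ->
  exists2 e : 'I_k -> 'I_m, injective e & (e @: [set: 'I_k] = A)%SET.
Proof.
move=> <-; exists enum_val; first exact: enum_val_inj.
apply/setP => i; apply/imsetP/idP => [[j _ ->]|iA]; first exact: enum_valP.
by exists (enum_rank_in iA i); rewrite // enum_rankK_in.
Qed.

(** Normal form of two sets of size [d] with [r] common points: the first [d] and the last [d] of
    [2d - r] indices. It is obtained by listing [A :\: B], [A :&: B], [B :\: A] in this order. *)
Lemma standard_pair m (i0 : 'I_m) (A B : {set 'I_m}) d r :
  #|A| = d -> #|B| = d -> #|A :&: B| = r ->
  exists2 e : 'I_(d - r + d) -> 'I_m, injective e &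
    (e @: [set k : 'I_(d - r + d) | (k < d)%N] = A)%SET /\
    (e @: [set k : 'I_(d - r + d) | (d - r <= k)%N] = B)%SET.
Proof.
move=> cA cB cAB.
have rd : (r <= d)%N by rewrite -cAB -cA subset_leq_card// subsetIl.
have cAD : #|A :\: B| = (d - r)%N by rewrite cardsD cA cAB.
have cBD : #|B :\: A| = (d - r)%N by rewrite cardsD cB finset.setIC cAB.
pose l := enum (A :\: B) ++ enum (A :&: B) ++ enum (B :\: A).
have sl : size l = (d - r + d)%N by rewrite !size_cat -!cardE cAD cAB cBD; lia.
have ul : uniq l.
  rewrite !cat_uniq !enum_uniq /= andbT; apply/andP; split.
    apply/hasPn => i; rewrite mem_cat !mem_enum !inE.
    by case: (i \in A) => //=; case: (i \in B).
  by apply/hasPn => i; rewrite !mem_enum !inE; case: (i \in A).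
pose e (k : 'I_(d - r + d)) := nth i0 l k.
have ie : injective e.
  move=> j k /eqP; rewrite nth_uniq ?sl// => /eqP.
  exact: val_inj.
have nthl k : nth i0 l k =
    if (k < d - r)%N then nth i0 (enum (A :\: B)) k
    else if (k < d)%N then nth i0 (enum (A :&: B)) (k - (d - r))
    else nth i0 (enum (B :\: A)) (k - d).
  rewrite nth_cat -cardE cAD; case: ltnP => // k1.
  rewrite nth_cat -cardE cAB.
  have -> : (k - (d - r) < r)%N = (k < d)%N by lia.
  by case: ltnP => // k2; congr nth; lia.
have memn (C : {set 'I_m}) k : (k < #|C|)%N -> nth i0 (enum C) k \in C.
  by move=> kC; rewrite -mem_enum mem_nth// -cardE.
have cardP (P : pred nat) : #|[set k : 'I_(d - r + d) | P k]%SET| = count P (iota 0 (d - r + d)).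
  rewrite -sum1_card -sum1_count; under eq_bigl do rewrite inE.
  by rewrite -(big_mkord P (fun=> 1%N)) /index_iota subn0.
exists e => //; split; apply/eqP; rewrite eqEcard card_imset//.
  apply/andP; split.
    apply/fintype.subsetP => _ /imsetP[k + ->]; rewrite inE /e nthl => kd.
    rewrite kd; case: ltnP => k1.
      by have /setDP[] : nth i0 (enum (A :\: B)) k \in A :\: B by rewrite memn ?cAD.
    have /setIP[] : nth i0 (enum (A :&: B)) (k - (d - r)) \in A :&: B.
      by rewrite memn// cAB; lia.
    by [].
  rewrite cA (cardP (fun k => k < d)%N) -size_filter.
  apply: (@leq_trans (size (iota 0 d))); first by rewrite size_iota.
  by apply: uniq_leq_size (iota_uniq _ _) _ => k; rewrite mem_filter !mem_iota; lia.
apply/andP; split.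
  apply/fintype.subsetP => _ /imsetP[k + ->]; rewrite inE /e nthl => kd.
  rewrite ltnNge kd /=; case: ltnP => k1.
    have /setIP[] : nth i0 (enum (A :&: B)) (k - (d - r)) \in A :&: B.
      by rewrite memn// cAB; lia.
    by [].
  have /setDP[] : nth i0 (enum (B :\: A)) (k - d) \in B :\: A.
    by rewrite memn ?cBD//; have := ltn_ord k; lia.
  by [].
rewrite cB (cardP (fun k => d - r <= k)%N) -size_filter.
apply: (@leq_trans (size (iota (d - r) d))); first by rewrite size_iota.
by apply: uniq_leq_size (iota_uniq _ _) _ => k; rewrite mem_filter !mem_iota; lia.
Qed.

(** The two pairs have the same symmetric difference, so counting gives intersections of equal size
    and differences of equal size. The pieces can then be matched one by one. *)
Lemma perm_pair (I : finType) (A B C D : {set I}) d :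
  #|A| = d -> #|B| = d -> #|C| = d -> #|D| = d ->
  (forall i, ((i \in A) != (i \in B)) = ((i \in C) != (i \in D))) ->
  (forall i, ~~ [&& i \in A, i \in B, i \in C & i \in D]) ->
  exists2 p : {perm I}, (p @: A = C)%SET & (p @: B = D)%SET.
Proof.
move=> cA cB cC cD ABCD dis.
have cX : #|((A :\: B) :|: (B :\: A))%SET| = #|((C :\: D) :|: (D :\: C))%SET|.
  apply: eq_card => i; have := ABCD i; rewrite !inE.
  by case: (i \in A); case: (i \in B); case: (i \in C); case: (i \in D).
have dU (E F : {set I}) : #|((E :\: F) :|: (F :\: E))%SET| = (#|E :\: F| + #|F :\: E|)%N.
  rewrite cardsU (_ : (_ :&: _)%SET = finset.set0) ?cards0 ?subn0//.
  by apply/setP => i; rewrite !inE; case: (i \in E); rewrite ?andbF.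
have cI : #|A :&: B| = #|C :&: D|.
  move: cX; rewrite !dU !cardsD cA cB cC cD [(B :&: A)%SET]finset.setIC [(D :&: C)%SET]finset.setIC.
  have : (#|A :&: B| <= d)%N by rewrite -cA subset_leq_card// subsetIl.
  have : (#|C :&: D| <= d)%N by rewrite -cC subset_leq_card// subsetIl.
  lia.
have cAD : #|A :\: B| = #|C :\: D| by rewrite !cardsD cA cC cI.
have cBD : #|B :\: A| = #|D :\: C| by rewrite !cardsD cB cD [(B :&: A)%SET]finset.setIC [(D :&: C)%SET]finset.setIC cI.
have uE (E F G H : {set I}) : (forall i, (i \in E) + (i \in F) + (i \in G) + (i \in H) <= 1)%N ->
    uniq (enum E ++ enum F ++ enum G ++ enum H).
  move=> h; rewrite !cat_uniq !enum_uniq /= !andbT; apply/and3P; split;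
    apply/hasPn => i; rewrite ?mem_cat !mem_enum => hi; have := h i; move: hi;
    by case: (i \in E); case: (i \in F); case: (i \in G); case: (i \in H).
(* Sending [C :&: D] back to [A :&: B] makes the source and the target lists of the matching
   enumerate the same set. *)
have [||p [_]] := @perm_of_seqs I
    (enum (A :\: B) ++ enum (B :\: A) ++ enum (A :&: B) ++ enum (C :&: D))
    (enum (C :\: D) ++ enum (D :\: C) ++ enum (C :&: D) ++ enum (A :&: B)).
- apply: uE => i; have := ABCD i; have := dis i; rewrite !inE.
  by case: (i \in A); case: (i \in B); case: (i \in C); case: (i \in D).
- apply: uniq_perm.
  + apply: uE => i; have := ABCD i; have := dis i; rewrite !inE.
    by case: (i \in A); case: (i \in B); case: (i \in C); case: (i \in D).
  + apply: uE => i; have := ABCD i; have := dis i; rewrite !inE.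
    by case: (i \in A); case: (i \in B); case: (i \in C); case: (i \in D).
  + move=> i; rewrite !mem_cat !mem_enum; have := ABCD i; have := dis i; rewrite !inE.
    by case: (i \in A); case: (i \in B); case: (i \in C); case: (i \in D).
rewrite !map_cat => /eqP; rewrite eqseq_cat ?size_map -?cardE//.
rewrite eqseq_cat ?size_map -?cardE// eqseq_cat ?size_map -?cardE//.
move=> /and4P[/eqP h1 /eqP h2 /eqP h3 _].
have img (E F : {set I}) i : map p (enum E) = enum F -> i \in E -> p i \in F.
  by move=> h iE; rewrite -mem_enum -h; apply: map_f; rewrite mem_enum.
exists p; apply/eqP; rewrite eqEcard card_imset ?cA ?cB ?cC ?cD ?leqnn ?andbT;
  try exact: perm_inj; apply/fintype.subsetP => _ /imsetP[i iE ->].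
  have [iB|iB] := boolP (i \in B).
    by have /finset.setIP[] : p i \in C :&: D by apply: img h3 _; rewrite inE iE.
  by have /finset.setDP[] : p i \in C :\: D by apply: img h1 _; rewrite inE iE iB.
have [iA|iA] := boolP (i \in A).
  by have /finset.setIP[] : p i \in C :&: D by apply: img h3 _; rewrite inE iE iA.
by have /finset.setDP[] : p i \in D :\: C by apply: img h2 _; rewrite inE iE iA.
Qed.

(** * Contractions of a symmetric kernel *)

Section Contraction.
Context (disp : measure_display) (T : measurableType disp) (R : realType).
Variable rho : {finite_measure set T -> \bar R}.
Variables (d : nat) (f : d.-tuple T -> R).
Hypothesis bf : bmeas f.
Hypothesis symf : forall (s : 'S_d) x, f (tuple_perm s x) = f x.
Local Notation spint := (spint rho).

(* [f] at the variables in [A]; their order is immaterial by symmetry. *)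
Definition onset m (A : {set 'I_m}) (x : m.-tuple T) : R :=
  f [tuple nth point [seq tnth x i | i <- enum A] k | k < d].

Lemma onset_indep m (A : {set 'I_m}) i : i \notin A -> indep i (onset A).
Proof.
move=> iA x z; congr f; apply: eq_from_tnth => k; rewrite !tnth_mktuple.
congr nth; apply/eq_in_map => j; rewrite mem_enum tnth_upd => jA.
by case: eqVneq => // ji; rewrite -ji jA in iA.
Qed.

(** [e] and the increasing enumeration of its image differ by a permutation of the arguments, which
    [symf] absorbs. *)
Lemma onset_inj m (e : 'I_d -> 'I_m) x : injective e ->
  onset (e @: [set: 'I_d])%SET x = f (pull e x).
Proof.
move=> ie; set A := (e @: _)%SET.
have cA : #|A| = d by rewrite card_imset// cardsT card_ord.
pose q (k : 'I_d) := enum_val (cast_ord (esym cA) k).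
have iq : injective q by move=> j k /enum_val_inj/cast_ord_inj.
have qA k : q k \in codom e.
  have /imsetP[j _ ->] : q k \in A by exact: enum_valP.
  exact: codom_f.
pose s k := iinv (qA k).
have es k : e (s k) = q k by exact: f_iinv.
have is_ : injective s by move=> j k sjk; apply: iq; rewrite -!es sjk.
rewrite -(symf (perm is_)); congr f; apply: eq_from_tnth => k.
rewrite !tnth_mktuple permE es /q (enum_val_nth (q k)).
by rewrite (nth_map (q k))// -cardE cA.
Qed.

Lemma onset_pull k m (e : 'I_k -> 'I_m) (A : {set 'I_k}) :
  injective e -> #|A| = d -> onset (e @: A) = onset A \o pull e.
Proof.
move=> ie /card_ex_inj[q iq <-]; apply/funext => x /=.
rewrite -imset_comp onset_inj; last exact: inj_comp.
by rewrite onset_inj// pull_comp.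
Qed.

Lemma onset_bmeas m (A : {set 'I_m}) : #|A| = d -> bmeas (onset A).
Proof.
move=> /card_ex_inj[q iq <-].
rewrite (_ : onset _ = f \o pull q); last by apply/funext => x; rewrite onset_inj.
by apply: bmeas_comp bf => //; exact: measurable_pull.
Qed.

Lemma spint_onset_sqr m (A : {set 'I_m}) x y : #|A| = d ->
  spint A (fun z => onset A z ^+ 2) x = spint [set: 'I_d]%SET (fun z => f z ^+ 2) y.
Proof.
move=> /card_ex_inj[q iq <-].
rewrite (_ : (fun _ => _) = (fun z => f z ^+ 2) \o pull q).
  by rewrite spint_imset//; [exact: spintT_cst|exact: bmeas_sqr].
by apply/funext => z /=; rewrite onset_inj.
Qed.

(** For sets of size [d] meeting in [r] points this is the contraction of [f] with itself in [r]
    arguments, usually denoted by [f] tensor-[r] [f], with the contracted variables kept as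
    dummies. *)
Definition contraction m (A B : {set 'I_m}) :=
  spint (A :&: B) (onset A \* onset B).

(** The squared L2 norm of that contraction: the symmetric difference consists of its free
    variables. *)
Definition contraction_norm2 m (A B : {set 'I_m}) :=
  spint ((A :\: B) :|: (B :\: A)) (fun x => contraction A B x ^+ 2).

Lemma contraction_bmeas m (A B : {set 'I_m}) : #|A| = d -> #|B| = d ->
  bmeas (contraction A B).
Proof. by move=> cA cB; apply/spint_bmeas/bmeasM; exact: onset_bmeas. Qed.

Lemma contraction_indep m (A B : {set 'I_m}) i :
  (i \in A) = (i \in B) -> indep i (contraction A B).
Proof.
move=> AB; have [iA|iA] := boolP (i \in A).
  by apply: indep_spint_mem; rewrite inE -AB iA.
by apply/indep_spint/indepM; apply: onset_indep; rewrite // -AB.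
Qed.

Lemma contraction_pull k m (e : 'I_k -> 'I_m) (A B : {set 'I_k}) :
  injective e -> #|A| = d -> #|B| = d ->
  contraction (e @: A) (e @: B) = contraction A B \o pull e.
Proof.
move=> ie cA cB; rewrite /contraction -imsetI; last by move=> ? ? _ _; exact: ie.
rewrite !onset_pull// -spint_imset//.
by apply: bmeasM; exact: onset_bmeas.
Qed.

Lemma contraction_norm2_cst m (A B : {set 'I_m}) x y :
  contraction_norm2 A B x = contraction_norm2 A B y.
Proof.
apply: (@indep_eq _ _ _ _ [set: 'I_m]%SET) => [i _|i]; last by rewrite inE.
have [AB|AB] := eqVneq (i \in A) (i \in B).
  by apply: indep_spint => u z; rewrite contraction_indep.
by apply: indep_spint_mem; rewrite !inE; move: AB; case: (i \in A); case: (i \in B).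
Qed.

Lemma contraction_norm2_ge0 m (A B : {set 'I_m}) x : 0 <= contraction_norm2 A B x.
Proof. by apply: spint_ge0 => y; exact: sqr_ge0. Qed.

Lemma contraction_norm2_pull k m (e : 'I_k -> 'I_m) (A B : {set 'I_k}) x :
  injective e -> #|A| = d -> #|B| = d ->
  contraction_norm2 (e @: A) (e @: B) x = contraction_norm2 A B (pull e x).
Proof.
move=> ie cA cB; rewrite /contraction_norm2 contraction_pull//.
rewrite (_ : (fun _ => _) = (fun x => contraction A B x ^+ 2) \o pull e)//.
rewrite (_ : (_ :|: _) = (e @: ((A :\: B) :|: (B :\: A)))%SET).
  by rewrite spint_imset//; exact/bmeas_sqr/contraction_bmeas.
by rewrite imsetU !imsetD_inj.
Qed.

(** Both pairs are injective images of the same standard pair. Thus the norm is a function of the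
    number of shared variables, and any two rows of a diagram can be compared with two rows of a
    circular one. *)
Lemma contraction_norm2_card k m (A B : {set 'I_k}) (A' B' : {set 'I_m}) x y :
  (0 < d)%N -> #|A| = d -> #|B| = d -> #|A'| = d -> #|B'| = d ->
  #|A :&: B| = #|A' :&: B'| -> contraction_norm2 A B x = contraction_norm2 A' B' y.
Proof.
move=> d0 cA cB cA' cB' cI.
have [i0 _] : exists i0, i0 \in A by apply/card_gt0P; rewrite cA.
have [j0 _] : exists j0, j0 \in A' by apply/card_gt0P; rewrite cA'.
have [r rE] : exists r, #|A :&: B| = r by exists #|A :&: B|.
have [e ie []] := standard_pair i0 cA cB rE.
have [e' ie' []] := standard_pair j0 cA' cB' (etrans (esym cI) rE).
set P := [set k : 'I_(d - r + d) | (k < d)%N]%SET.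
set Q := [set k : 'I_(d - r + d) | (d - r <= k)%N]%SET.
move=> eP' eQ' eP eQ.
have cP : #|P| = d by rewrite -(card_imset _ ie) eP.
have cQ : #|Q| = d by rewrite -(card_imset _ ie) eQ.
rewrite -eP -eQ -eP' -eQ' !contraction_norm2_pull//.
exact: contraction_norm2_cst.
Qed.

Lemma contractionC m (A B : {set 'I_m}) : contraction A B = contraction B A.
Proof.
rewrite /contraction finset.setIC; congr (spint _ _).
by apply/funext => x /=; rewrite mulrC.
Qed.

(** A variable outside [X] is shared by [A] and [B] alone or by [C] and [D] alone. Integrating these
    first turns each pair of kernels into a contraction, and what remains is a scalar product over
    [X]. *)
Lemma spintT4 m (A B C D : {set 'I_m}) :
  #|A| = d -> #|B| = d -> #|C| = d -> #|D| = d ->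
  let X := ((A :\: B) :|: (B :\: A))%SET in
  ((C :\: D) :|: (D :\: C))%SET = X ->
  [disjoint A :&: B & C :|: D]%B -> [disjoint C :&: D & A :|: B]%B ->
  (A :|: B :|: C :|: D)%SET = [set: 'I_m]%SET ->
  spint [set: 'I_m]%SET
    (fun x => onset A x * onset B x * (onset C x * onset D x)) =
  spint X (fun x => contraction A B x * contraction C D x).
Proof.
move=> cA cB cC cD X eX dAB dCD eT.
have bO (E : {set 'I_m}) : #|E| = d -> bmeas (onset E) by exact: onset_bmeas.
have inX i : (i \in X) = ((i \in A) != (i \in B)).
  by rewrite !inE; case: (i \in A); case: (i \in B).
have inX' i : (i \in X) = ((i \in C) != (i \in D)).
  by rewrite -eX !inE; case: (i \in C); case: (i \in D).
have AB0 i : i \in A :&: B -> (i \notin C) && (i \notin D).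
  by move=> /(disjointFr dAB); rewrite inE => /negbT; rewrite negb_or.
have CD0 i : i \in C :&: D -> (i \notin A) && (i \notin B).
  by move=> /(disjointFr dCD); rewrite inE => /negbT; rewrite negb_or.
have -> : [set: 'I_m]%SET = (X :|: ((C :&: D) :|: (A :&: B)))%SET.
  apply/setP => i; rewrite -eT !inE.
  have := inX i; rewrite inX' => {inX inX'}.
  by case: (i \in A); case: (i \in B); case: (i \in C); case: (i \in D).
rewrite spintU; first last.
- rewrite disjoint_sym disjoint_subset; apply/fintype.subsetP => i.
  rewrite inE => /orP[]; rewrite inE [i \in predC _]inE /=.
    by rewrite inX' => /andP[-> ->].
  by rewrite inX => /andP[-> ->].
- by apply: (bmeasM (bmeasM _ _) (bmeasM _ _)); exact: bO.
rewrite spintU; first last.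
- rewrite disjoint_subset; apply/fintype.subsetP => i iCD.
  by have /andP[iA _] := CD0 i iCD; rewrite !inE (negPf iA).
- by apply: (bmeasM (bmeasM _ _) (bmeasM _ _)); exact: bO.
congr (spint _ _).
rewrite (@spint_indepr _ _ _ _ _ _ (onset A \* onset B) (onset C \* onset D)); first last.
- by apply: bmeasM; exact: bO.
- by move=> i /AB0/andP[iC iD]; apply: indepM; exact: onset_indep.
rewrite -/(contraction A B) spint_indepl//; last by apply: bmeasM; exact: bO.
move=> i /CD0/andP[iA iB]; apply: contraction_indep.
by rewrite (negPf iA) (negPf iB).
Qed.

(* In a circular diagram the contractions of the first two and of the last two
   kernels are the same function of the remaining variables. *)
Lemma spintT_circular m (A B C D : {set 'I_m}) x :
  #|A| = d -> #|B| = d -> #|C| = d -> #|D| = d ->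
  (forall i, [|| [&& i \in A, i \in B, i \notin C & i \notin D],
                 [&& i \notin A, i \in B, i \in C & i \notin D],
                 [&& i \notin A, i \notin B, i \in C & i \in D] |
                 [&& i \in A, i \notin B, i \notin C & i \in D]]) ->
  spint [set: 'I_m]%SET
    (fun x => onset A x * onset B x * (onset C x * onset D x)) x =
  contraction_norm2 A B x.
Proof.
move=> cA cB cC cD circ.
have AB i : [/\ (i \in C) = ~~ (i \in A), (i \in D) = ~~ (i \in B) &
   true] by have := circ i; case: (i \in A); case: (i \in B); case: (i \in C); case: (i \in D).
have cS : #|A :&: B| = #|C :&: D|.
  have h : (C :&: D)%SET = (~: (A :|: B))%SET.
    by apply/setP => i; have [hC hD _] := AB i; rewrite !inE hC hD negb_or.
  have hm : (#|A| + #|C| = m)%N.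
    rewrite (_ : C = ~: A)%SET; first by rewrite (cardsC A) card_ord.
    by apply/setP => i; have [hC hD _] := AB i; rewrite !inE hC.
  have := cardsUI A B; have := cardsC (A :|: B); rewrite -h card_ord; lia.
have dS i : ~~ ((i \in A :&: B) && (i \in C :&: D)).
  by have [hC hD _] := AB i; rewrite !inE hC hD; case: (i \in A); rewrite ?andbF.
(* In the circular pattern [C] and [D] are the complements of [A] and [B]. Exchanging [A :&: B] with
   [C :&: D] and fixing all other variables therefore carries [A] to [D] and [B] to [C], without
   moving the free variables. *)
have [|] := @perm_of_seqs _ (enum (A :&: B) ++ enum (C :&: D))
  (enum (C :&: D) ++ enum (A :&: B)) _ (permEl (perm_catC _ _)).
  rewrite cat_uniq !enum_uniq andbT /=; apply/hasPn => i; rewrite !mem_enum.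
  by have := dS i; case: (i \in A :&: B); case: (i \in C :&: D).
move=> p [pfix]; rewrite map_cat => /eqP.
rewrite eqseq_cat ?size_map -?cardE// => /andP[/eqP pS /eqP pS'].
have pSin i : i \in A :&: B -> p i \in C :&: D.
  by move=> iS; rewrite -mem_enum -pS; apply: map_f; rewrite mem_enum.
have pS'in i : i \in C :&: D -> p i \in A :&: B.
  by move=> iS; rewrite -mem_enum -pS'; apply: map_f; rewrite mem_enum.
have pid i : i \notin A :&: B -> i \notin C :&: D -> p i = i.
  by move=> h1 h2; apply: pfix; rewrite mem_cat !mem_enum negb_or h1.
have img (E F : {set 'I_m}) : #|E| = d -> #|F| = d ->
    (forall i, i \in E -> p i \in F) -> (p @: E = F)%SET.
  move=> cE cF EF; apply/eqP; rewrite eqEcard card_imset ?cE ?cF ?leqnn; last exact: perm_inj.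
  by rewrite andbT; apply/fintype.subsetP => _ /imsetP[i iE ->]; exact: EF.
have pA : (p @: A = D)%SET.
  apply: img => // i iA; have [hC hD _] := AB i.
  have [iS|iS] := boolP (i \in A :&: B); first by have /finset.setIP[] := pSin i iS.
  rewrite pid//; last by rewrite inE hC iA.
  by move: iS; rewrite hD inE iA.
have pB : (p @: B = C)%SET.
  apply: img => // i iB; have [hC hD _] := AB i.
  have [iS|iS] := boolP (i \in A :&: B); first by have /finset.setIP[] := pSin i iS.
  rewrite pid//; last by rewrite inE hD iB andbF.
  by move: iS; rewrite hC inE iB andbT.
have CDE y : contraction C D y = contraction A B y.
  rewrite contractionC -pA -pB contraction_pull//=; last exact: perm_inj.
  apply: (@indep_eq _ _ _ _ ((A :&: B) :|: (C :&: D))%SET) => i.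
    have [hC hD _] := AB i.
    rewrite !inE hC hD => /orP[/andP[iA iB]|/andP[iA iB]]; apply: contraction_indep.
      by rewrite iA iB.
    by rewrite (negPf iA) (negPf iB).
  by rewrite inE negb_or => /andP[h1 h2]; rewrite tnth_pull pid.
rewrite spintT4//.
- rewrite /contraction_norm2; congr (spint _ _ _).
  by apply/funext => y; rewrite CDE expr2.
- apply/setP => i; have [hC hD _] := AB i; rewrite !inE hC hD.
  by case: (i \in A); case: (i \in B).
- rewrite disjoint_subset; apply/fintype.subsetP => i; have [hC hD _] := AB i.
  by rewrite !inE hC hD => /andP[-> ->].
- rewrite disjoint_subset; apply/fintype.subsetP => i; have [hC hD _] := AB i.
  by rewrite !inE hC hD => /andP[/negPf -> /negPf ->].
- apply/setP => i; have [hC hD _] := AB i; rewrite !inE hC hD.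
  by case: (i \in A); case: (i \in B).
Qed.

(** The variables shared by rows [p] and [q] are integrated exactly, which merges these rows into
    their contraction. Every remaining variable still joins two distinct factors, so the generalized
    Cauchy-Schwarz inequality applies to the merged diagram. *)
Lemma diagram_bound m n (A : 'I_n -> {set 'I_m}) (p q : 'I_n) x y :
  p != q -> (forall j, #|A j| = d) ->
  (forall i, exists v w, v != w /\ forall u, (i \in A u) = (u == v) || (u == w)) ->
  (spint [set: 'I_m]%SET (fun z => \prod_j onset (A j) z) x) ^+ 2 <=
  contraction_norm2 (A p) (A q) x *
    (spint [set: 'I_d]%SET (fun z => f z ^+ 2) y) ^+ (n - 2).
Proof.
move=> pq cA two; set S := (A p :&: A q)%SET.
set X := ((A p :\: A q) :|: (A q :\: A p))%SET.
(* The merged kernel sits at index [p]; index [q] receives the constant 1 and no variable, so that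
   the factors remain indexed by ['I_n]. *)
pose B (v : 'I_n) := if v == p then X else if v == q then finset.set0 else A v.
pose g (v : 'I_n) : m.-tuple T -> R := if v == p then contraction (A p) (A q)
  else if v == q then (fun=> 1) else onset (A v).
have qp : (q == p) = false by rewrite eq_sym (negPf pq).
have inX i : (i \in X) = ((i \in A p) != (i \in A q)).
  by rewrite !inE; case: (i \in A p); case: (i \in A q).
have eqv (F : 'I_n -> R) : \prod_v F v = F p * F q * \prod_(v | (v != p) && (v != q)) F v.
  by rewrite (bigD1 p)//= (bigD1 q) 1?eq_sym//= mulrA.
have -> : spint [set: 'I_m]%SET (fun z => \prod_j onset (A j) z) =
    spint (~: S)%SET (fun z => \prod_v g v z).
  rewrite (_ : [set: 'I_m] = ~: S :|: S)%SET; last by rewrite finset.setUC finset.setUCr.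
  rewrite spintU; first last.
  - by rewrite disjoint_sym disjoint_subset; apply/fintype.subsetP => i; rewrite !inE negbK.
  - by apply: bmeas_prod => j; exact: onset_bmeas.
  congr (spint _ _).
  pose K z := \prod_(v | (v != p) && (v != q)) onset (A v) z.
  rewrite (_ : (fun z => _) = (onset (A p) \* onset (A q)) \* K); last first.
    by apply/funext => z /=; rewrite eqv.
  rewrite spint_indepr; first last.
  - by apply: bmeasM; exact: onset_bmeas.
  - move=> i /finset.setIP[ip iq] z t; apply: eq_bigr => v /andP[vp vq].
    apply: onset_indep; have [v' [w' [_ iA]]] := two i.
    move: ip iq; rewrite !iA => /orP[]/eqP pv /orP[]/eqP qw.
    + by rewrite pv qw eqxx in pq.
    + by rewrite -pv -qw negb_or vp vq.
    + by rewrite -pv -qw negb_or vp vq.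
    + by rewrite pv qw eqxx in pq.
  apply/funext => z /=; rewrite eqv /g !eqxx qp mulr1; congr (_ * _).
  by apply: eq_bigr => v /andP[/negPf -> /negPf ->].
apply: (le_trans (@spint_gCS _ _ _ rho _ _ B g (~: S)%SET x _ _ _ _)).
- move=> v; rewrite /g; case: eqP => _; first exact: contraction_bmeas.
  by case: eqP => _; [exact: bmeas_cst|exact: onset_bmeas].
- move=> i v iS; rewrite /B /g; case: eqP => _.
    by rewrite inX negbK => /eqP; exact: contraction_indep.
  by case: eqP => // _; exact: onset_indep.
- move=> v; apply/fintype.subsetP => i; rewrite /B; case: eqP => [_|/eqP vp].
    by rewrite inX !inE; case: (i \in A p); case: (i \in A q).
  case: eqP => [_|/eqP vq]; first by rewrite inE.
  have [v' [w' [_ iA]]] := two i; rewrite !inE !iA => /orP[]/eqP vE;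
    rewrite -vE ![_ == v]eq_sym (negPf vp) (negPf vq) ?orbF /=;
    by apply/negP => /andP[/eqP pE /eqP qE]; rewrite pE qE eqxx in pq.
- move=> i iS; have [v [w [vw iA]]] := two i.
  have Bi u : (i \in B u) = if u == p then (i \in A p) != (i \in A q)
      else if u == q then false else i \in A u.
    by rewrite /B; case: eqP => [_|_]; [rewrite inX|case: eqP => _; rewrite ?inE].
  have iS' : ~~ ((i \in A p) && (i \in A q)) by move: iS; rewrite !inE.
  (* A variable that row [q] shared with another row is now carried by the merged factor at [p]. *)
  have [vq|vq] := eqVneq v q.
    exists p, w; split; first by apply: contraNneq iS' => pw; rewrite !iA vq pw !eqxx !orbT.
    move=> u; rewrite Bi; have [->|up] := eqVneq u p.
      rewrite !iA vq eqxx /= (negPf pq) /=.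
      by case: (eqVneq p w) iS' => // pw; rewrite !iA vq -pw !eqxx !orbT.
    have [->|uq] := eqVneq u q; first by rewrite -vq (negPf vw).
    by rewrite iA vq (negPf uq).
  have [wq|wq] := eqVneq w q.
    exists v, p; split; first by apply: contraNneq iS' => vp; rewrite !iA wq -vp !eqxx !orbT.
    move=> u; rewrite Bi; have [->|up] := eqVneq u p.
      rewrite !iA wq eqxx orbT (negPf pq) orbF.
      by case: (eqVneq p v) iS' => // pv; rewrite !iA wq -pv !eqxx !orbT.
    have [->|uq] := eqVneq u q; first by rewrite eq_sym (negPf vq).
    by rewrite iA wq (negPf uq).
  exists v, w; split=> // u; rewrite Bi; have [->|up] := eqVneq u p.
    by rewrite !iA ![q == _]eq_sym (negPf vq) (negPf wq); case: (_ || _).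
  have [->|//] := eqVneq u q.
  by rewrite ![q == _]eq_sym (negPf vq) (negPf wq).
rewrite eqv /B /g !eqxx qp.
rewrite (_ : spint finset.set0 _ x = 1); last by rewrite /spint /pints enum_set0 /= expr1n.
rewrite mulr1 le_eqVlt; apply/orP; left; apply/eqP; congr (_ * _).
rewrite (eq_bigr (fun=> spint [set: 'I_d]%SET (fun z => f z ^+ 2) y)); last first.
  by move=> v /andP[/negPf -> /negPf ->]; rewrite (spint_onset_sqr _ y (cA v)).
rewrite prodr_const; congr (_ ^+ _).
rewrite (eq_card (B := [predC pred2 p q])) => [|v]; last by rewrite !inE negb_or.
by have /(congr1 (subn^~ 2)) := cardC (pred2 p q); rewrite card2 pq card_ord (addKn 2).
Qed.

(* Averaging over the permutations of the free variables [X] makes the two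
   contractions equal, so that the sum is the square norm of their average. *)
Lemma diagram_orbit_ge0 m (A B C D : {set 'I_m}) x :
  #|A| = d -> #|B| = d -> #|C| = d -> #|D| = d ->
  let X := ((A :\: B) :|: (B :\: A))%SET in
  ((C :\: D) :|: (D :\: C))%SET = X ->
  [disjoint A :&: B & C :|: D]%B -> [disjoint C :&: D & A :|: B]%B ->
  (A :|: B :|: C :|: D)%SET = [set: 'I_m]%SET ->
  0 <= \sum_(p : {perm 'I_m} | perm_on X p)
    spint [set: 'I_m]%SET (fun y => onset (p @: A)%SET y * onset (p @: B)%SET y *
       (onset C y * onset D y)) x.
Proof.
move=> cA cB cC cD X eX dAB dCD eT.
have inX i : (i \in X) = ((i \in A) != (i \in B)).
  by rewrite !inE; case: (i \in A); case: (i \in B).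
have inX' i : (i \in X) = ((i \in C) != (i \in D)).
  by rewrite -eX !inE; case: (i \in C); case: (i \in D).
have AB0 i : i \in A :&: B -> (i \notin C) && (i \notin D).
  by move=> /(disjointFr dAB); rewrite inE => /negbT; rewrite negb_or.
have CD0 i : i \in C :&: D -> (i \notin A) && (i \notin B).
  by move=> /(disjointFr dCD); rewrite inE => /negbT; rewrite negb_or.
pose c := contraction A B; pose c' := contraction C D.
have bc : bmeas c by exact: contraction_bmeas.
have bc' : bmeas c' by exact: contraction_bmeas.
have ic i : i \notin X -> indep i c.
  by rewrite inX negbK => /eqP; exact: contraction_indep.
have ic' i : i \notin X -> indep i c'.
  by rewrite inX' negbK => /eqP; exact: contraction_indep.
have bpull (h : m.-tuple T -> R) (p : {perm 'I_m}) : bmeas h -> bmeas (h \o pull p).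
  by move=> bh; apply: bmeas_comp bh => //; exact: measurable_pull.
have Xeq (h : m.-tuple T -> R) (p q : 'I_m -> 'I_m) y :
    (forall i, i \notin X -> indep i h) -> {in X, p =1 q} ->
    h (pull p y) = h (pull q y).
  move=> ih pq; apply: (@indep_eq _ _ _ _ (~: X)%SET) => i; rewrite inE.
    exact: ih.
  by rewrite negbK => iX; rewrite !tnth_pull pq.
have term p : perm_on X p ->
    spint [set: 'I_m]%SET (fun y => onset (p @: A)%SET y * onset (p @: B)%SET y *
       (onset C y * onset D y)) =
    spint X (fun y => c (pull p y) * c' y).
  move=> pX; have pin i : i \in X -> p i \in X by rewrite (perm_closed _ pX).
  have ip : injective p by exact: perm_inj.
  have inp (E : {set 'I_m}) i : (p i \in (p @: E)%SET) = (i \in E) by rewrite mem_imset.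
  have inpX (E : {set 'I_m}) i : i \notin X -> (i \in (p @: E)%SET) = (i \in E).
    by move=> iX; rewrite -{1}(out_perm pX iX) inp.
  have pSX : (p @: X = X)%SET by exact: im_perm_on.
  have pXE : ((p @: A :\: p @: B) :|: (p @: B :\: p @: A))%SET = X.
    by rewrite -!imsetD_inj// -imsetU.
  rewrite spintT4 ?card_imset// ?pXE//.
  - by rewrite contraction_pull.
  - rewrite -imsetI; last by move=> ? ? _ _; exact: ip.
    rewrite (_ : (p @: (A :&: B))%SET = (A :&: B)%SET)//.
    apply/setP => i; have [iX|iX] := boolP (i \in X); last by rewrite inpX.
    have /imsetP[j jX ->] : i \in (p @: X)%SET by rewrite pSX.
    rewrite inp; have := jX; rewrite inX !inE => jAB.
    have := pin j jX; rewrite inX => pAB.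
    by move: jAB pAB; case: (j \in A); case: (j \in B); case: (p j \in A); case: (p j \in B).
  - rewrite disjoint_subset; apply/fintype.subsetP => i iCD.
    have iX : i \notin X by move: iCD; rewrite inX' inE => /andP[-> ->].
    by have /andP[/negPf iA /negPf iB] := CD0 i iCD; rewrite !inE !inpX// iA iB.
  - apply/setP => i; have [iX|iX] := boolP (i \in X).
      rewrite !finset.in_setU finset.in_setT; move: iX; rewrite inX'.
      by case: (i \in C); case: (i \in D) => //= _; rewrite ?orbT.
    by have /setP/(_ i) := eT; rewrite !finset.in_setU !inpX.
rewrite (eq_bigr (fun p : {perm 'I_m} => spint X (fun y => c (pull p y) * c' y) x)); last first.
  by move=> p pX; rewrite term.
pose H y := \sum_(p : {perm 'I_m} | perm_on X p) c (pull p y).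
have bH : bmeas H by apply: bmeas_sum => p; exact: bpull.
have iH i : i \notin X -> indep i H.
  move=> iX y z; apply: eq_bigr => p pX.
  rewrite -{1}(out_perm pX iX) pull_upd; last exact: perm_inj.
  by rewrite ic.
have Hinv (q : {perm 'I_m}) y : perm_on X q -> H (pull q y) = H y.
  move=> qX; rewrite /H [RHS](reindex_inj (mulIg q)) /=.
  apply: eq_big => [p|p pX].
    apply/idP/idP => [pX|pqX]; first exact: perm_onM.
    by rewrite -(mulgK q p) perm_onM// perm_onV.
  by rewrite pull_comp; congr (c _); apply: eq_from_tnth => i; rewrite !tnth_pull permM.
have -> : \sum_(p : {perm 'I_m} | perm_on X p) spint X (fun y => c (pull p y) * c' y) x =
    spint X (H \* c') x.
  rewrite (_ : H \* c' = fun y => \sum_(p : {perm 'I_m} | perm_on X p) c (pull p y) * c' y).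
    by rewrite spint_sum// => p; apply: bmeasM => //; exact: bpull.
  by apply/funext => y; rewrite /= /H mulr_suml.
have [p0 p0A p0B] : exists2 p : {perm 'I_m}, (p @: A = C)%SET & (p @: B = D)%SET.
  apply: (@perm_pair _ _ _ _ _ d) => // i; first by rewrite -inX -inX'.
  by apply/negP => /and4P[iA iB iC iD]; have := AB0 i; rewrite inE iA iB iC => /(_ isT).
have p0X : (p0 @: X = X)%SET by rewrite imsetU !imsetD_inj ?p0A ?p0B //; exact: perm_inj.
have c'E y : c' y = c (pull p0 y).
  by rewrite /c' -p0A -p0B contraction_pull//; exact: perm_inj.
have p0in i : (p0 i \in X) = (i \in X) by rewrite -{1}p0X mem_imset//; exact: perm_inj.
(* [p0] may move variables outside [X], on which the contractions do not depend. Replacing it there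
   by the identity gives [r], which belongs to the group summed over; translating the sum by [r]
   then identifies the orbit sum of [c'] with that of [c]. *)
have ir : injective (fun i => if i \in X then p0 i else i).
  move=> i j /=; case: ifP => iX; case: ifP => jX; first exact: perm_inj.
  - by move=> ij; rewrite -ij p0in iX in jX.
  - by move=> ij; rewrite ij p0in jX in iX.
  - by [].
pose r := perm ir.
have rX : perm_on X r.
  by apply/fintype.subsetP => i; rewrite inE permE; case: ifP => //; rewrite eqxx.
have rE : {in X, r =1 p0} by move=> i iX; rewrite permE iX.
have sumc' y : \sum_(q : {perm 'I_m} | perm_on X q) c' (pull q y) = H y.
  rewrite /H [RHS](reindex_inj (mulgI r)) /=; apply: eq_big => [q|q qX].
    apply/idP/idP => [qX|rqX]; first exact: perm_onM.
    by rewrite -(mulKg r q) perm_onM// perm_onV.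
  rewrite c'E pull_comp; apply: Xeq => // i iX.
  by rewrite permM rE.
(* Since [H] is invariant under the group, a change of variables moves [q] onto [c'] alone. Summing
   over [q] replaces [c'] by [H], and the integrand becomes a square. *)
have key (q : {perm 'I_m}) : perm_on X q ->
    spint X (H \* c') x = spint X (H \* (c' \o pull q)) x.
  move=> qX; rewrite (_ : H \* (c' \o pull q) = (H \* c') \o pull q); last first.
    by apply/funext => y /=; rewrite Hinv.
  have bHc : bmeas (H \* c') by exact: bmeasM.
  rewrite -[in RHS](im_perm_on qX) spint_imset//=; last exact: perm_inj.
  apply: (@indep_eq _ _ _ _ X) => i; first exact: indep_spint_mem.
  by move=> iX; rewrite tnth_pull (out_perm qX).
have n0 : 0 < (#|[pred q : {perm 'I_m} | perm_on X q]|)%:R :> R.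
  by rewrite ltr0n; apply/card_gt0P; exists 1%g; rewrite inE perm_on1.
rewrite -(pmulr_rge0 _ n0) mulr_natl -sumr_const.
rewrite (eq_bigr (fun q : {perm 'I_m} => spint X (H \* (c' \o pull q)) x)); last first.
  by move=> q qX; exact: key.
have := @spint_sum _ _ _ rho _ _ (index_enum _) (fun q : {perm 'I_m} => perm_on X q)
  (fun q => H \* (c' \o pull q)) X.
move=> /(_ (fun q => bmeasM bH (bpull _ q bc')))/(congr1 (@^~ x)) /= <-.
apply: spint_ge0 => y; rewrite -mulr_sumr sumc' -expr2; exact: sqr_ge0.
Qed.

End Contraction.

(** * Comparison with the power measures *)

Lemma bmeas_support_integrable (disp : measure_display)
    (X : measurableType disp) (R : realType) (mu : {measure set X -> \bar R})
    (B : set X) (h : X -> R) :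
  measurable B -> (mu B < +oo)%E -> bmeas h -> (forall x, ~ B x -> h x = 0) ->
  mu.-integrable setT (EFin \o h).
Proof.
move=> mB Boo [mh [M hM]] h0.
rewrite (_ : EFin \o h = (EFin \o h) \_ B).
  apply/(integrable_mkcond (EFin \o h) mB); apply: measurable_bounded_integrable => //.
    exact: measurable_funTS.
  exists M; split; first exact: num_real.
  by move=> N MN x _ /=; exact: le_trans (hM x) (ltW MN).
apply/funext => x; rewrite patchE; case: ifPn => // /negP.
by rewrite inE => /h0 /= ->.
Qed.

Lemma product_measure1X_lty (disp disp' : measure_display)
    (X : measurableType disp) (Y : measurableType disp') (R : realType)
    (mu : {sigma_finite_measure set X -> \bar R})
    (nu : {sigma_finite_measure set Y -> \bar R}) A B :
  measurable A -> measurable B -> (mu A < +oo)%E -> (nu B < +oo)%E ->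
  ((mu \x nu) (A `*` B) < +oo)%E.
Proof.
move=> mA mB Aoo Boo.
by rewrite product_measure1E// lte_mul_pinfty ?ge0_fin_numE.
Qed.

Lemma pints_lift (disp : measure_display) (T : measurableType disp)
    (R : realType) (rho : {finite_measure set T -> \bar R}) m
    (F : m.+1.-tuple T -> R) (s : seq 'I_m) (z : T) (u : m.-tuple T) :
  pints rho (map (lift ord0) s) F [tuple of z :: u] =
  pints rho s (fun u => F [tuple of z :: u]) u.
Proof.
elim: s u => //= i s IH u; rewrite !pintE; apply: eq_Rintegral => w _.
rewrite -IH; congr pints; apply: eq_from_tnth => j; rewrite tnth_upd.
case: (unliftP ord0 j) => [k ->|->]; last by rewrite !tnth0.
by rewrite !tnthS tnth_upd (inj_eq (@lift_inj _ ord0)).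
Qed.

Definition box (T : Type) (D : set T) (m : nat) : set (m.-tuple T) :=
  [set t | forall i, D (tnth t i)].
Arguments box {T} D m.

Section PowerMeasure.
Context (disp : measure_display) (T : measurableType disp) (R : realType).
Variable nu : {sigma_finite_measure set T -> \bar R}.
Variables (D : set T) (mD : measurable D) (Doo : (nu D < +oo)%E).

Local Notation box := (box D).

Lemma measurable_box m : measurable (box m).
Proof.
rewrite (_ : box m = \bigcap_(i in [set: 'I_m])
    ((fun t : m.-tuple T => tnth t i) @^-1` D)); last first.
  by apply/seteqP; split => t /= tA i; [move=> _; exact: tA|exact: (tA i I)].
apply: fin_bigcap_measurable => // i _.
by rewrite -[X in measurable X]setTI; exact: measurable_tnth.
Qed.

Lemma power_measure_box_lty m : (power_measure nu m (box m) < +oo)%E.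
Proof.
rewrite (@power_measure_box _ _ _ nu m (fun=> D)) => [|_]; last exact: mD.
rewrite -[nu D]fineK ?ge0_fin_numE// prodEFin; exact: ltry.
Qed.

Definition restricted : {finite_measure set T -> \bar R} := mfrestr mD Doo.

Lemma Rintegral_restricted (g : T -> R) : (forall z, ~ D z -> g z = 0) ->
  \int[nu]_z g z = \int[restricted]_z g z.
Proof.
move=> g0; rewrite /Rintegral; congr fine.
rewrite (_ : (fun z => (g z)%:E) = (EFin \o g) \_ D); last first.
  apply/funext => z; rewrite patchE; case: ifPn => // /negP.
  by rewrite inE => /g0 /= ->.
rewrite -!integral_mkcond; apply: eq_measure_integral => A mA AD /=.
by rewrite /mfrestr /mrestr setIidl.
Qed.

Lemma box_integrable m (F : m.-tuple T -> R) : bmeas F ->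
  (forall t, ~ box m t -> F t = 0) ->
  (power_measure nu m).-integrable setT (EFin \o F).
Proof.
move=> bF F0; apply: bmeas_support_integrable F0 => //; first exact: measurable_box.
exact: power_measure_box_lty.
Qed.

(** Fubini on the head coordinate, by induction on [m]. The support in a box allows [nu] to be
    exchanged for its finite restriction at each stage; the point [t] is arbitrary because all
    variables are integrated. *)
Lemma Rintegral_power_measure m (F : m.-tuple T -> R) (t : m.-tuple T) :
  bmeas F -> (forall t, ~ box m t -> F t = 0) ->
  \int[power_measure nu m]_y F y = spint restricted [set: 'I_m]%SET F t.
Proof.
elim: m => [|m IH] in F t * => bF F0.
  have -> : spint restricted [set: 'I_0]%SET F t = F t.
    by rewrite /spint /pints enum_setT -enumT enum_ord0.
  rewrite /Rintegral /= integral_dirac//= ?diracT ?mul1e /=.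
    by rewrite indicE in_setT mul1r (tuple0 t).
  by apply/measurable_EFinP; case: bF.
pose Fc (p : T * m.-tuple T) := F (tuple_consp p).
have mc := @measurable_tuple_consp _ T m.
have bFc : bmeas Fc by exact: bmeas_comp bF.
have bFx x : bmeas (fun t => Fc (x, t)).
  by apply: (bmeas_comp _ bFc); exact: measurable_pair1.
have Fc0 p : ~ (D `*` box m) p -> Fc p = 0.
  move=> Dp; apply: F0 => bp; apply: Dp; split.
    by have := bp ord0; rewrite /tuple_consp tnth0.
  by move=> i; have := bp (lift ord0 i); rewrite tnthS.
have iFc : (nu \x power_measure nu m)%E.-integrable setT (EFin \o Fc).
  apply: (@bmeas_support_integrable _ _ _ _ (D `*` box m)) => //.
    by apply: measurableX => //; exact: measurable_box.
  apply: product_measure1X_lty => //; first exact: measurable_box.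
  exact: power_measure_box_lty.
have -> : \int[power_measure nu m.+1]_y F y =
    fine (\int[nu]_x \int[power_measure nu m]_y (Fc (x, y))%:E)%E.
  rewrite (integral12_prod_meas1 iFc) /Rintegral /=; congr fine.
  rewrite (integral_pushforward mc)//=.
  by apply/measurable_EFinP; case: bF.
have inner x : (\int[power_measure nu m]_y (Fc (x, y))%:E)%E =
    (spint restricted [set: 'I_m]%SET (fun y => Fc (x, y)) [tuple of behead t])%:E.
  have Fx0 y : ~ box m y -> Fc (x, y) = 0 by move=> yb; apply: Fc0 => -[].
  rewrite -IH// EFin_Rintegral//.
  exact: box_integrable.
under eq_integral do rewrite inner.
rewrite -[LHS]/(\int[nu]_x _) Rintegral_restricted; last first.
  move=> z Dz; rewrite (_ : (fun y => Fc (z, y)) = fun=> 0); last first.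
    by apply/funext => y; apply: Fc0 => -[].
  by rewrite spint0.
rewrite /spint !enum_setT -!enumT enum_ordSl /= pintE.
apply: eq_Rintegral => z _.
have -> : upd t ord0 z = [tuple of z :: behead t].
  apply: eq_from_tnth => i; rewrite tnth_upd.
  have [->|] := eqVneq i ord0; first by rewrite tnth0.
  case: (unliftP ord0 i) => [j -> _|->]; last by rewrite eqxx.
  by rewrite tnthS tnth_behead; congr tnth; apply: val_inj; rewrite /= inordK ?ltnS.
by rewrite (pints_lift restricted F (enum 'I_m) z [tuple of behead t]).
Qed.

End PowerMeasure.

(** * Diagrams and labelings *)

Local Notation pblock := finset.pblock.

Section Labelings.
Variables n d : nat.
Implicit Types (i j : 'I_(n * d)) (sigma : {set {set 'I_(n * d)}}).

Lemma ord_mul_gt0 i : (0 < d)%N.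
Proof.
by have := leq_ltn_trans (leq0n i) (ltn_ord i); rewrite muln_gt0 => /andP[].
Qed.

Lemma rowof_subproof i : (i %/ d < n)%N.
Proof. by rewrite ltn_divLR//; exact: ord_mul_gt0 i. Qed.

Definition rowof i : 'I_n := Ordinal (rowof_subproof i).

Lemma rowof_dpos (p : 'I_n) (k : 'I_d) : rowof (dpos p k) = p.
Proof.
have d0 : (0 < d)%N by exact: leq_ltn_trans (ltn_ord k).
by apply: val_inj; rewrite /= divnMDl// divn_small// addn0.
Qed.

Lemma dpos_rowof i : exists k, i = dpos (rowof i) k.
Proof.
have d0 := ord_mul_gt0 i.
have kd : (i %% d < d)%N by rewrite ltn_mod.
by exists (Ordinal kd); apply: val_inj; rewrite /= -divn_eq.
Qed.

Lemma mem_drow i (p : 'I_n) : (i \in drow d p) = (rowof i == p).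
Proof.
apply/imsetP/eqP => [[k _ ->]|<-]; first exact: rowof_dpos.
by have [k ik] := dpos_rowof i; exists k.
Qed.

Lemma dpos_inj (p : 'I_n) : injective (@dpos n d p).
Proof. by move=> k l /(congr1 val)/= /addnI /val_inj. Qed.

Lemma card_drow (p : 'I_n) : #|drow d p| = d.
Proof. by rewrite card_imset ?card_ord//; exact: dpos_inj. Qed.

Lemma pblock_pi_star i j : (j \in pblock (pi_star n d) i) = (rowof i == rowof j).
Proof.
have d0 := ord_mul_gt0 i.
have [_ tp _] := and3P (pi_star_part n d0).
rewrite (@def_pblock _ _ (drow d (rowof i)))//.
- by rewrite mem_drow eq_sym.
- by apply/imsetP; exists (rowof i).
- by rewrite mem_drow.
Qed.

Section Labeling.
Variables (m : nat) (l : 'I_(n * d) -> 'I_m).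

Definition labels (p : 'I_n) : {set 'I_m} := (l @: drow d p)%SET.

(** These are the conditions that blocks have two elements and that the meet with the rows is
    trivial. The first clause also makes the labeling surjective. *)
Definition pairing :=
  (forall v, #|[set i | l i == v]%SET| = 2%N) /\
  (forall i j, rowof i = rowof j -> l i = l j -> i = j).

(** Connectedness of the multigraph with rows as vertices and labels as edges. It is the condition
    on the join, whose blocks are unions of rows. *)
Definition connected_rows := forall J : {set 'I_n}, J != finset.set0 ->
  (forall p q v, p \in J -> v \in labels p -> v \in labels q -> q \in J) ->
  J = [set: 'I_n]%SET.

(** A labeling names the blocks of [sigma] by variables. When [l] is a pairing, the naming is unique
    up to a permutation of the variables; see [relabel]. *)
Definition labels_of sigma := forall i j, (j \in pblock sigma i) = (l i == l j).

Lemma mem_labels i p : rowof i = p -> l i \in labels p.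
Proof. by move=> ip; apply: imset_f; rewrite mem_drow ip. Qed.

Lemma labelsP v p : reflect (exists2 i, rowof i = p & v = l i) (v \in labels p).
Proof.
apply: (iffP imsetP) => -[i ip ->]; exists i => //.
  by move: ip; rewrite mem_drow => /eqP.
by rewrite mem_drow ip.
Qed.

Hypothesis pl : pairing.

Lemma card_labels p : #|labels p| = d.
Proof.
rewrite card_in_imset ?card_drow// => i j; rewrite !mem_drow => /eqP ip /eqP jp.
by apply: pl.2; rewrite ip.
Qed.

Lemma pairing_fiber v : exists i j,
  [/\ l i = v, l j = v, rowof i != rowof j &
      forall k, l k = v -> k = i \/ k = j].
Proof.
have /eqP/cards2P[i [j [ij E]]] := pl.1 v.
have li : l i = v by apply/eqP; have := set21 i j; rewrite -E inE.
have lj : l j = v by apply/eqP; have := set22 i j; rewrite -E inE.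
exists i, j; split=> //.
  by apply: contraNneq ij => r; apply/eqP; apply: pl.2 => //; rewrite li lj.
move=> k lk; have : k \in [set i; j]%SET by rewrite -E inE lk.
by rewrite !inE => /orP[]/eqP; [left|right].
Qed.

Lemma pairing_two v : exists p q, p != q /\
  forall u, (v \in labels u) = (u == p) || (u == q).
Proof.
have [i [j [li lj ij ijP]]] := pairing_fiber v.
exists (rowof i), (rowof j); split=> // u; apply/labelsP/orP.
  by move=> [k <- /esym/ijP[]->]; rewrite eqxx; [left|right].
by move=> []/eqP->; [exists i|exists j].
Qed.

End Labeling.

Section M2Labels.
Variables (m : nat) (sigma : {set {set 'I_(n * d)}}) (l : 'I_(n * d) -> 'I_m).
Hypotheses (n0 : (0 < n)%N) (d0 : (0 < d)%N) (ps : is_part sigma) (ls : labels_of l sigma).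

Lemma pblock_labels i : pblock sigma i = [set j | l j == l i]%SET.
Proof. by apply/setP => j; rewrite inE ls eq_sym. Qed.

Lemma labels_M2 : pairing l -> connected_rows l -> sigma \in M2 n d.
Proof.
move=> pl cl; rewrite inE ps /=; apply/and3P; split.
- have pj := pjoin_part sigma (pi_star n d).
  have sub i j : j \in pblock (pjoin sigma (pi_star n d)) i.
    rewrite mem_pblock_pjoin; set e := [rel _ _ | _].
    pose J := [set p | [exists k, (rowof k == p) && connect e i k]]%SET.
    have inJ k : connect e i k -> rowof k \in J.
      by move=> ik; rewrite inE; apply/existsP; exists k; rewrite eqxx.
    have row_e k k' : rowof k = rowof k' -> connect e k k'.
      move=> kk'; apply: connect1; rewrite /= orbC eq_pblock ?is_part_cover//.
      + by rewrite pblock_pi_star kk' eqxx.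
      + by have /and3P[] := pi_star_part n d0.
      + exact: pi_star_part.
    have JT : J = [set: 'I_n]%SET.
      apply: cl; first by apply/set0Pn; exists (rowof i); apply: inJ.
      move=> p q v; rewrite inE => /existsP[k /andP[/eqP kp ik]].
      move=> /labelsP[k1 k1p ->] /labelsP[k2 k2q k12].
      rewrite -k2q; apply: inJ; apply: connect_trans ik _.
      apply: (@connect_trans _ _ k1); first by apply: row_e; rewrite kp.
      apply: connect1; rewrite /= eq_pblock ?is_part_cover//; last by have /and3P[] := ps.
      by rewrite ls k12 eqxx.
    have : rowof j \in J by rewrite JT inE.
    rewrite inE => /existsP[k /andP[/eqP kj ik]].
    by apply: connect_trans ik _; exact: row_e.
  have pT i : pblock (pjoin sigma (pi_star n d)) i = [set: 'I_(n * d)]%SET.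
    by apply/setP => j; rewrite sub inE.
  apply/eqP/setP => b; rewrite inE; apply/idP/eqP => [bj|->].
    have [_ tj nj] := and3P pj.
    have [b0|[i ib]] := set_0Vmem b; first by rewrite -b0 bj in nj.
    by rewrite -(def_pblock tj bj ib) pT.
  rewrite -(pT (dpos (Ordinal n0) (Ordinal d0))); apply: pblock_mem.
  exact: is_part_cover.
- have pm := pmeet_part ps (pi_star_part n d0).
  have pbm i : pblock (pmeet sigma (pi_star n d)) i = [set i]%SET.
    rewrite pblock_pmeet//; last exact: pi_star_part.
    apply/setP => j; rewrite !inE pblock_pi_star ls.
    apply/andP/eqP => [[/eqP ij /eqP rij]|->]; last by [].
    by apply: pl.2.
  apply/eqP/setP => b; apply/idP/imsetP => [bj|[i _ ->]].
    have [_ tj nj] := and3P pm.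
    have [b0|[i ib]] := set_0Vmem b; first by rewrite -b0 bj in nj.
    by exists i => //; rewrite -(def_pblock tj bj ib) pbm.
  by rewrite -pbm; apply: pblock_mem; exact: is_part_cover.
- apply/forall_inP => b bs; have [_ ts ns] := and3P ps.
  have [b0|[i ib]] := set_0Vmem b; first by rewrite -b0 bs in ns.
  by rewrite -(def_pblock ts bs ib) pblock_labels pl.1.
Qed.

Lemma M2_pairing : m = (n * d)./2 -> sigma \in M2 n d -> pairing l /\ connected_rows l.
Proof.
move=> mE; rewrite inE => /and4P[_ /eqP jT /eqP mB /forall_inP s2].
have fib2 i : #|[set j | l j == l i]%SET| = 2%N.
  by rewrite -pblock_labels; apply/eqP/s2/pblock_mem/is_part_cover.
split; first split.
(* A label has two positions or none. As [m] is half the number of positions, counting shows that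
   every label is used. *)
- have fibE v : #|[set i | l i == v]%SET| = (2 * (v \in codom l))%N.
    have [/codomP[i ->]|vl] := boolP (v \in codom l); first by rewrite fib2.
    apply/eqP; rewrite muln0 cards_eq0; apply/eqP/setP => i; rewrite !inE.
    by apply: contraNF vl => /eqP <-; exact: codom_f.
  have := sum1_card 'I_(n * d); rewrite card_ord (partition_big l xpredT)//=.
  under eq_bigr do rewrite sum1dep_card fibE.
  rewrite -big_distrr /= -big_mkcond /= sum1_card => nE.
  have cm : #|codom l| = #|'I_m|.
    by have := congr1 half nE; rewrite mul2n doubleK card_ord -mE.
  move=> v; rewrite fibE; suff -> : v \in codom l by [].
  by move/subset_cardP: cm => /(_ (fintype.subset_predT _)) ->.
- move=> i j rij lij; apply/esym.
  have : j \in pblock (pmeet sigma (pi_star n d)) i.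
    rewrite pblock_pmeet//; last exact: pi_star_part.
    by rewrite inE ls lij eqxx pblock_pi_star rij eqxx.
  have /and3P[_ tb _] := pbot_part 'I_(n * d).
  rewrite mB (def_pblock tb (imset_f _ (_ : i \in 'I_(n * d))) _) ?inE//.
  by move/eqP.
move=> J /set0Pn[u uJ] Jcl; apply/setP => w; rewrite [RHS]inE.
pose i := dpos u (Ordinal d0); pose j := dpos w (Ordinal d0).
have : j \in pblock (pjoin sigma (pi_star n d)) i.
  have T0 : (0 < #|'I_(n * d)|)%N by rewrite card_ord muln_gt0 n0.
  have /and3P[_ tT _] := ptop_part T0.
  by rewrite jT (def_pblock tT (set11 _)) ?inE.
rewrite mem_pblock_pjoin -{1}(rowof_dpos w (Ordinal d0)) -/j.
have : rowof i \in J by rewrite rowof_dpos.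
(* Along a path generating the join, a step inside a block keeps the label and a step inside a row
   keeps the row, so the path never leaves the rows in [J]. *)
move=> + /connectP[p]; elim: p (i) => [|k p IH] i' i'J /=; first by move=> _ ->.
move=> /andP[+ kp] jE => /orP[]/eqP ik; apply: IH kp jE.
  apply: (Jcl _ _ (l i') i'J); apply/labelsP; [by exists i'|].
  exists k => //; apply/eqP; rewrite -ls ik mem_pblock; exact: is_part_cover.
suff /eqP <- : rowof i' == rowof k by [].
rewrite -pblock_pi_star ik mem_pblock; apply: is_part_cover; exact: pi_star_part.
Qed.

End M2Labels.

End Labelings.

Section MoreLabelings.
Variables (n d m : nat).
Implicit Types (l : 'I_(n * d) -> 'I_m) (sigma : {set {set 'I_(n * d)}}).

Definition kernel l : {set {set 'I_(n * d)}} := preim_partition l [set: 'I_(n * d)]%SET.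

Lemma kernel_part l : is_part (kernel l).
Proof. exact: preim_partitionP. Qed.

Lemma kernel_labels l : labels_of l (kernel l).
Proof.
move=> i j; rewrite /kernel /preim_partition pblock_equivalence_partition ?inE//.
by split=> //= /eqP ->.
Qed.

Lemma labels_of_kernel l sigma : is_part sigma -> labels_of l sigma -> kernel l = sigma.
Proof.
move=> ps ls.
have bE i : pblock sigma i = pblock (kernel l) i.
  by apply/setP => j; rewrite ls kernel_labels.
have [_ ts ns] := and3P ps; have [_ tk nk] := and3P (kernel_part l).
apply/setP => b; apply/idP/idP => bs.
  have [b0|[i ib]] := set_0Vmem b; first by rewrite -b0 bs in nk.
  rewrite -(def_pblock tk bs ib) -bE; apply: pblock_mem; exact: is_part_cover.
have [b0|[i ib]] := set_0Vmem b; first by rewrite -b0 bs in ns.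
rewrite -(def_pblock ts bs ib) bE; apply: pblock_mem; apply: is_part_cover.
exact: kernel_part.
Qed.

Lemma pairing_of_sum l :
  (forall i j, rowof i = rowof j -> l i = l j -> i = j) ->
  (forall v, \sum_p (v \in labels l p) = 2)%N -> pairing l.
Proof.
move=> il two; split=> // v.
rewrite -(two v) -sum1_card (partition_big (@rowof n d) xpredT)//=.
apply: eq_bigr => p _.
have [/labelsP[i ip vi]|vp] := boolP (v \in labels l p).
  rewrite (big_pred1 i) // => j; rewrite inE; apply/andP/eqP => [[/eqP lj /eqP jp]|->].
    by apply: il; rewrite ?ip// lj.
  by rewrite vi ip.
rewrite big_pred0// => i; rewrite inE; apply: contraNF vp => /andP[/eqP <- /eqP ip].
exact: mem_labels.
Qed.

Lemma pairing_sum l v : pairing l -> (\sum_p (v \in labels l p) = 2)%N.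
Proof.
move=> pl; have [p [q [pq E]]] := pairing_two pl v.
under eq_bigr do rewrite E.
rewrite (bigD1 p)//= (bigD1 q) 1?eq_sym//= !eqxx orbT big1// => u /andP[up uq].
by rewrite (negPf up) (negPf uq).
Qed.

Lemma pairing_mem2 l v p q u : pairing l -> p != q ->
  v \in labels l p -> v \in labels l q -> (v \in labels l u) = (u == p) || (u == q).
Proof.
move=> pl pq; have [p' [q' [pq' E]]] := pairing_two pl v.
rewrite !E => /orP[]/eqP pp /orP[]/eqP qq.
- by rewrite pp qq eqxx in pq.
- by rewrite pp qq.
- by rewrite pp qq orbC.
- by rewrite pp qq eqxx in pq.
Qed.

(** By cardinality the two label sets are equal, and each label occurs in just two rows, so [p] and
    [q] form a connected component. With three or more rows, two rows thus share fewer than [d]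
    labels. *)
Lemma labels_subset_rows l p q : pairing l -> connected_rows l -> p != q ->
  labels l p \subset labels l q -> [set p; q]%SET = [set: 'I_n]%SET.
Proof.
move=> pl cl pq pqS.
have pqE : labels l p = labels l q by apply/eqP; rewrite eqEcard pqS !card_labels /=.
apply: cl; first by apply/set0Pn; exists p; rewrite set21.
move=> u w v uJ vu vw.
have vq : v \in labels l q by move: uJ vu; rewrite !inE => /orP[]/eqP->; rewrite ?pqE.
have vp : v \in labels l p by rewrite pqE.
by rewrite !inE -(pairing_mem2 _ pl pq vp vq).
Qed.

Lemma relabel l l' sigma : pairing l -> pairing l' ->
  labels_of l sigma -> labels_of l' sigma ->
  exists s : {perm 'I_m}, forall i, l' i = s (l i).
Proof.
move=> pl pl' ls ls'.
have ll' i j : (l i == l j) = (l' i == l' j) by rewrite -ls ls'.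
have lP v : exists i, l i == v.
  have /set0Pn[i] : [set i | l i == v]%SET != finset.set0.
    by rewrite -card_gt0 pl.1.
  by rewrite inE; exists i.
pose g v := l' (xchoose (lP v)).
have gl i : g (l i) = l' i by apply/eqP; rewrite -ll'; exact: (xchooseP (lP (l i))).
have ig : injective g.
  move=> v w; have /eqP <- := xchooseP (lP v); have /eqP <- := xchooseP (lP w).
  by rewrite !gl => /eqP; rewrite -ll' => /eqP.
by exists (perm ig) => i; rewrite permE gl.
Qed.

Lemma links_labels l sigma p q : pairing l -> is_part sigma -> labels_of l sigma ->
  p != q -> forall v, links p q [set i | l i == v]%SET =
                      (v \in labels l p) && (v \in labels l q).
Proof.
move=> pl ps ls pq v; apply/exists_inP/andP.
  move=> [i ip /exists_inP[j jq /eqP E]].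
  have : i \in [set i | l i == v]%SET by rewrite E set21.
  have : j \in [set i | l i == v]%SET by rewrite E set22.
  rewrite !inE => /eqP <- /eqP lij; split; last exact: imset_f.
  by rewrite -lij; exact: imset_f.
move=> [/labelsP[i ip vi] /labelsP[j jq vj]].
exists i; first by rewrite mem_drow ip.
apply/exists_inP; exists j; first by rewrite mem_drow jq.
rewrite eq_sym eqEcard pl.1 cards2; apply/andP; split.
  apply/fintype.subsetP => k; rewrite !inE => /orP[]/eqP->; first by rewrite vi.
  by rewrite vj.
by case: eqVneq => // ij; rewrite -ip -jq ij eqxx in pq.
Qed.

End MoreLabelings.

(** * Diagrams with four rows *)

Definition row0 : 'I_4 := @Ordinal 4 0 isT.
Definition row1 : 'I_4 := @Ordinal 4 1 isT.
Definition row2 : 'I_4 := @Ordinal 4 2 isT.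
Definition row3 : 'I_4 := @Ordinal 4 3 isT.

Lemma row4P (P : 'I_4 -> Prop) : P row0 -> P row1 -> P row2 -> P row3 -> forall p, P p.
Proof.
move=> P0 P1 P2 P3 [[|[|[|[|//]]]] ip].
- by rewrite (_ : Ordinal ip = row0)//; exact: val_inj.
- by rewrite (_ : Ordinal ip = row1)//; exact: val_inj.
- by rewrite (_ : Ordinal ip = row2)//; exact: val_inj.
- by rewrite (_ : Ordinal ip = row3)//; exact: val_inj.
Qed.

Lemma big_row4 (S : Type) (idx : S) (op : Monoid.law idx) (F : 'I_4 -> S) :
  \big[op/idx]_p F p = op (op (F row0) (F row1)) (op (F row2) (F row3)).
Proof.
rewrite !big_ord_recl big_ord0 Monoid.mulm1 Monoid.mulmA.
by congr (op (op (F _) (F _)) (op (F _) (F _))); apply: val_inj.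
Qed.

Lemma ordS_row : (ordS row0 = row1) * (ordS row1 = row2) * (ordS row2 = row3) *
  (ordS row3 = row0).
Proof. by do !split; apply: val_inj. Qed.

Section FourRows.
Variables (d m : nat).
Hypotheses (d0 : (0 < d)%N) (mE : m = (4 * d)./2).
Implicit Types (l : 'I_(4 * d) -> 'I_m) (sigma : {set {set 'I_(4 * d)}}).

Let m2d : m = (2 * d)%N.
Proof. by rewrite mE (_ : 4 * d = (2 * d).*2)%N ?doubleK//; lia. Qed.

Lemma pairing_sum4 l v : pairing l ->
  ((v \in labels l row0) + (v \in labels l row1) +
  ((v \in labels l row2) + (v \in labels l row3)) = 2)%N.
Proof. by move=> pl; have := pairing_sum v pl; rewrite big_row4. Qed.

Lemma connected_rows02 l v w u :
  v \in labels l row0 -> v \in labels l row2 ->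
  w \in labels l row1 -> w \in labels l row3 ->
  (u \in labels l row0) || (u \in labels l row2) ->
  (u \in labels l row1) || (u \in labels l row3) -> connected_rows l.
Proof.
move=> v0 v2 w1 w3 u02 u13 J /set0Pn[p pJ] cJ.
have J02 : row0 \in J -> row2 \in J by move=> h; exact: cJ h v0 v2.
have J20 : row2 \in J -> row0 \in J by move=> h; exact: cJ h v2 v0.
have J13 : row1 \in J -> row3 \in J by move=> h; exact: cJ h w1 w3.
have J31 : row3 \in J -> row1 \in J by move=> h; exact: cJ h w3 w1.
have Ju p' q : p' \in J -> u \in labels l p' -> u \in labels l q -> q \in J by exact: cJ.
have all4 : [&& row0 \in J, row1 \in J, row2 \in J & row3 \in J].
  have [h0|h1] : row0 \in J \/ row1 \in J.
    move: p pJ; apply: row4P => pJ; [by left|by right| |].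
      by left; exact: J20.
    by right; exact: J31.
  - have h2 := J02 h0; rewrite h0 h2 /=.
    have [h1|h3] : row1 \in J \/ row3 \in J.
      case/orP: u02 => hu; case/orP: u13 => hu';
        [left|right|left|right]; first [exact: (Ju row0)|exact: (Ju row2)].
    + by rewrite h1 J13.
    + by rewrite h3 J31.
  - have h3 := J13 h1; rewrite h1 h3 /=.
    have [h0|h2] : row0 \in J \/ row2 \in J.
      case/orP: u13 => hu; case/orP: u02 => hu';
        [left|right|left|right]; first [exact: (Ju row1)|exact: (Ju row3)].
    + by rewrite h0 J02.
    + by rewrite h2 J20.
apply/setP; move: all4 => /and4P[h0 h1 h2 h3].
by apply: row4P; rewrite !inE.
Qed.

Lemma connected_rows_circ l u v w :
  u \in labels l row0 -> u \in labels l row1 ->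
  v \in labels l row1 -> v \in labels l row2 ->
  w \in labels l row2 -> w \in labels l row3 -> connected_rows l.
Proof.
move=> u0 u1 v1 v2 w2 w3 J /set0Pn[p pJ] cJ.
have h1 : row1 \in J.
  move: p pJ; apply: row4P => // pJ.
  - exact: cJ pJ u0 u1.
  - exact: cJ pJ v2 v1.
  - by apply: cJ (cJ _ _ _ pJ w3 w2) v2 v1.
have h2 : row2 \in J by exact: cJ h1 v1 v2.
apply/setP; apply: row4P; rewrite inE ?h1 ?h2//.
- exact: cJ h1 u1 u0.
- exact: cJ h2 w2 w3.
Qed.

(** There are [2d] labels and [d] in each row; those missing from rows 0 and 2 are exactly those
    shared by rows 1 and 3. *)
Lemma card_meet13 l : pairing l ->
  #|(labels l row1 :&: labels l row3)%SET| = #|(labels l row0 :&: labels l row2)%SET|.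
Proof.
move=> pl; have h := cardsUI (labels l row0) (labels l row2).
have h' : (labels l row1 :&: labels l row3)%SET = (~: (labels l row0 :|: labels l row2))%SET.
  apply/setP => v; have := pairing_sum4 v pl; rewrite !inE.
  by case: (v \in labels l row0); case: (v \in labels l row1);
     case: (v \in labels l row2); case: (v \in labels l row3).
have := cardsC (labels l row0 :|: labels l row2); rewrite -h' card_ord.
by move: h m2d; rewrite !card_labels//; lia.
Qed.

(** Circularity means that opposite rows share nothing. Rows 0 and 2 decide this for rows 1 and 3 as
    well, by [card_meet13], and the required links between consecutive rows then follow from
    connectedness. *)
Lemma M2c_labels sigma l : is_part sigma -> labels_of l sigma -> sigma \in M2 4 d ->
  (sigma \in M2c d) = ((labels l row0 :&: labels l row2)%SET == finset.set0).
Proof.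
move=> ps ls s2; have [pl cl] := M2_pairing (isT : (0 < 4)%N) d0 ps ls mE s2.
have blockP b : b \in sigma -> exists v, b = [set i | l i == v]%SET.
  move=> bs; have [_ ts ns] := and3P ps.
  have [b0|[i ib]] := set_0Vmem b; first by rewrite -b0 bs in ns.
  by exists (l i); rewrite -(def_pblock ts bs ib) (pblock_labels ls).
have fiberP v : [set i | l i == v]%SET \in sigma.
  have /set0Pn[i] : [set i | l i == v]%SET != finset.set0 by rewrite -card_gt0 pl.1.
  rewrite inE => /eqP <-; rewrite -(pblock_labels ls); apply: pblock_mem.
  exact: is_part_cover.
have neS (p : 'I_4) : p != ordS p by move: p; apply: row4P.
have linkP := links_labels pl ps ls (neS _).
rewrite inE s2 /=; apply/andP/eqP => [[_ /forall_inP circ]|e02].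
  apply/setP => v; rewrite finset.in_set0; apply/negP => /finset.setIP[v0 v2].
  have /existsP[p] := circ _ (fiberP v).
  rewrite linkP => /andP[]; rewrite !(pairing_mem2 _ pl _ v0 v2)//.
  by move: p; apply: row4P.
have e13 : (labels l row1 :&: labels l row3)%SET = finset.set0.
  by apply/eqP; rewrite -cards_eq0 card_meet13// e02 cards0.
have not02 v : ~~ ((v \in labels l row0) && (v \in labels l row2)).
  by apply/negP => h; have := finset.in_set0 v; rewrite -e02 inE h.
have not13 v : ~~ ((v \in labels l row1) && (v \in labels l row3)).
  by apply/negP => h; have := finset.in_set0 v; rewrite -e13 inE h.
(* A row [p] without a link to [q] would have all its labels in [r]; then [p] and [r] would be the
   only rows. *)
have ex (p q r : 'I_4) : p != q -> p != r -> r != q ->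
    (forall v, v \in labels l p -> (v \in labels l q) || (v \in labels l r)) ->
    exists v, (v \in labels l p) && (v \in labels l q).
  move=> pq pr rq h; have [/existsP//|] := boolP [exists v, (v \in labels l p) && (v \in labels l q)].
  rewrite negb_exists => /forallP npq.
  have sub : labels l p \subset labels l r.
    by apply/fintype.subsetP => v vp; have := h v vp; have := npq v; rewrite vp /= => /negPf ->.
  have /setP/(_ q) := labels_subset_rows pl cl pr sub.
  by rewrite !inE eq_sym (negPf pq) eq_sym (negPf rq).
have exS p : exists v, (v \in labels l p) && (v \in labels l (ordS p)).
  move: p; apply: row4P; rewrite ordS_row;
    [apply: (@ex _ _ row3)|apply: (@ex _ _ row0)|apply: (@ex _ _ row1)|apply: (@ex _ _ row2)] => // v;
    have := pairing_sum4 v pl; have := not02 v; have := not13 v;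
    by case: (v \in labels l row0); case: (v \in labels l row1);
      case: (v \in labels l row2); case: (v \in labels l row3).
split.
  apply/forallP => p; have [v vp] := exS p; apply/exists_inP.
  by exists [set i | l i == v]%SET; [exact: fiberP|rewrite linkP].
apply/forall_inP => b /blockP[v ->]; apply/existsP.
have := pairing_sum4 v pl; have := not02 v; have := not13 v.
have L p : (v \in labels l p) && (v \in labels l (ordS p)) ->
    exists p, links p (ordS p) [set i | l i == v]%SET.
  by move=> h; exists p; rewrite linkP.
have := L row0; have := L row1; have := L row2; have := L row3; rewrite !ordS_row.
case: (v \in labels l row0); case: (v \in labels l row1);
  case: (v \in labels l row2); case: (v \in labels l row3) => //=;
  by move=> L3 L2 L1 L0 _ _ _; first [exact: L0|exact: L1|exact: L2|exact: L3].
Qed.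

End FourRows.

(** * A model circular diagram for each number of shared variables *)

Section CircularLabeling.
Variables (d m r : nat).
Hypotheses (mE : m = (2 * d)%N) (r0 : (0 < r)%N) (rd : (r < d)%N).

Let d0 : (0 < d)%N. Proof. exact: leq_ltn_trans rd. Qed.

(* Rows 0 and 1 share the labels in [0, r[, rows 1 and 2 those in [r, d[, rows 2
   and 3 those in [d, d + r[, and rows 3 and 0 those in [d + r, 2 d[. *)
Definition circ_shift (p : 'I_4) (k : nat) : bool :=
  [|| p == row3, (p == row0) && (r <= k)%N | (p == row2) && (k < r)%N].

Lemma circ_subproof (i : 'I_(4 * d)) :
  (i %% d + d * circ_shift (rowof i) (i %% d) < m)%N.
Proof.
have : (i %% d < d)%N by rewrite ltn_mod.
by case: circ_shift; rewrite mE ?muln1 ?muln0; lia.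
Qed.

Definition circ_labeling (i : 'I_(4 * d)) : 'I_m := Ordinal (circ_subproof i).

Lemma circ_labeling_dpos p (k : 'I_d) :
  circ_labeling (dpos p k) = (k + d * circ_shift p k)%N :> nat.
Proof. by rewrite /= rowof_dpos modnMDl modn_small. Qed.

Lemma circ_labels p v : (v \in labels circ_labeling p) =
  if p == row0 then (v < r)%N || (d + r <= v)%N
  else if p == row1 then (v < d)%N
  else if p == row2 then (r <= v)%N && (v < d + r)%N else (d <= v)%N.
Proof.
have vm : (v < 2 * d)%N by rewrite -mE.
apply/labelsP/idP => [[i <- ->]|].
  have [k ->] := dpos_rowof i; rewrite circ_labeling_dpos rowof_dpos.
  have := ltn_ord k; move: (rowof i); apply: row4P; rewrite /circ_shift /=; case: ltnP; lia.
have ex k (kd : (k < d)%N) : (k + d * circ_shift p k = v)%N ->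
    exists2 i, rowof i = p & v = circ_labeling i.
  move=> kv; exists (dpos p (Ordinal kd)); first exact: rowof_dpos.
  by apply: ord_inj; rewrite [RHS]circ_labeling_dpos /= kv.
have [vd|vd] := ltnP v d.
  by move=> h; apply: (ex v) => //; move: h; move: p {ex}; apply: row4P; rewrite /circ_shift /=; lia.
move=> h; have vd' : (v - d < d)%N by lia.
by apply: (ex _ vd'); move: h; move: p {ex}; apply: row4P; rewrite /circ_shift /=; lia.
Qed.

Lemma circ_pairing : pairing circ_labeling.
Proof.
apply: pairing_of_sum => [i j|v].
  have [k ik] := dpos_rowof i; have [k' jk'] := dpos_rowof j => ij.
  rewrite ik jk' -ij => /(congr1 (@nat_of_ord m)); rewrite !circ_labeling_dpos => kk'.
  congr dpos; apply: val_inj => /=.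
  have := ltn_ord k; have := ltn_ord k'; move: kk'.
  by case: circ_shift; case: circ_shift; lia.
rewrite big_row4 !circ_labels /=.
have : (v < 2 * d)%N by rewrite -mE.
by case: ltnP; case: ltnP; case: ltnP; case: ltnP; lia.
Qed.

Lemma circ_connected : connected_rows circ_labeling.
Proof.
have km k : (k < 2 * d)%N -> (k < m)%N by rewrite mE.
have h0 : (0 < 2 * d)%N by lia.
have hr : (r < 2 * d)%N by lia.
have hd : (d < 2 * d)%N by lia.
apply: (@connected_rows_circ _ _ _ (Ordinal (km _ h0)) (Ordinal (km _ hr)) (Ordinal (km _ hd)));
  by rewrite circ_labels /=; lia.
Qed.

Lemma circ_M2 : kernel circ_labeling \in M2 4 d.
Proof.
apply: (@labels_M2 _ _ _ _ circ_labeling) => //.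
- exact: kernel_part.
- exact: kernel_labels.
- exact: circ_pairing.
- exact: circ_connected.
Qed.

(** Every [r] with [0 < r < d] is thus realized by a circular partition, so item 2 controls the
    norms of all the contractions of these orders. *)
Lemma circ_M2c : kernel circ_labeling \in M2c d.
Proof.
have mE' : m = (4 * d)./2.
  by rewrite mE (_ : 4 * d = (2 * d).*2)%N ?doubleK//; lia.
rewrite (M2c_labels d0 mE' (kernel_part _) (kernel_labels _) circ_M2).
apply/eqP/setP => v; rewrite finset.in_set0 inE !circ_labels /=; lia.
Qed.

Lemma card_circ_meet : #|(labels circ_labeling row0 :&: labels circ_labeling row1)%SET| = r.
Proof.
have rm : (r <= m)%N by rewrite mE; lia.
rewrite (_ : (_ :&: _)%SET = (widen_ord rm @: [set: 'I_r])%SET).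
  by rewrite card_imset ?cardsT ?card_ord// => i j /(congr1 val)/= /val_inj.
apply/setP => v; rewrite inE !circ_labels /=; apply/idP/imsetP => [h|[i _ ->] /=].
  have vr : (v < r)%N by lia.
  exists (Ordinal vr); [by rewrite inE|exact: ord_inj].
by have := ltn_ord i; lia.
Qed.

End CircularLabeling.

(** * Diagrams of a bounded symmetric kernel *)

Section DiagramIntegral.
Context (disp : measure_display) (T : measurableType disp) (R : realType).
Variable rho : {finite_measure set T -> \bar R}.
Variables (d : nat) (f : d.-tuple T -> R).
Hypotheses (bf : bmeas f) (d0 : (0 < d)%N).
Hypothesis symf : forall (s : 'S_d) x, f (tuple_perm s x) = f x.

Definition diagram n m (l : 'I_(n * d) -> 'I_m) (x : m.-tuple T) : R :=
  spint rho [set: 'I_m]%SET (fun y => \prod_p onset f (labels l p) y) x.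

Lemma diagram_perm n m (l l' : 'I_(n * d) -> 'I_m) (s : {perm 'I_m}) x :
  pairing l -> (forall i, l' i = s (l i)) -> diagram l' x = diagram l x.
Proof.
move=> pl ll'; rewrite /diagram.
have lE p : labels l' p = (s @: labels l p)%SET.
  rewrite /labels -(imset_comp s l); apply: eq_imset => i /=; exact: ll'.
rewrite (_ : (fun y => _) = (fun y => \prod_p onset f (labels l p) y) \o pull s).
  have sT : (s @: [set: 'I_m] = [set: 'I_m])%SET.
    by apply/eqP; rewrite eqEcard finset.subsetT (card_imset _ (@perm_inj _ s)) leqnn.
  rewrite -[in LHS]sT spint_imset//=; last 2 first.
  - exact: perm_inj.
  - by apply: bmeas_prod => p; apply: onset_bmeas => //; exact: card_labels.
  exact: spintT_cst.
apply/funext => y /=; apply: eq_bigr => p _.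
by rewrite lE onset_pull//; [exact: perm_inj|exact: card_labels].
Qed.

Lemma diagram_labels n m (l l' : 'I_(n * d) -> 'I_m) sigma x :
  pairing l -> pairing l' -> labels_of l sigma -> labels_of l' sigma ->
  diagram l' x = diagram l x.
Proof.
by move=> pl pl' ls ls'; have [s] := relabel pl pl' ls ls'; exact: diagram_perm.
Qed.

Lemma diagram_circular m (l : 'I_(4 * d) -> 'I_m) x : m = (4 * d)./2 ->
  pairing l -> (labels l row0 :&: labels l row2)%SET = finset.set0 ->
  diagram l x = contraction_norm2 rho f (labels l row0) (labels l row1) x.
Proof.
move=> mE pl e02.
have e13 : (labels l row1 :&: labels l row3)%SET = finset.set0.
  by apply/eqP; rewrite -cards_eq0 (card_meet13 d0 mE pl) e02 cards0.
rewrite -(@spintT_circular _ _ _ rho _ f bf symf _ _ _ (labels l row2) (labels l row3)).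
- by rewrite /diagram; congr (spint _ _ _); apply/funext => y; rewrite big_row4.
- exact: card_labels.
- exact: card_labels.
- exact: card_labels.
- exact: card_labels.
move=> v; have := finset.in_set0 v; rewrite -{1}e02 inE.
have := finset.in_set0 v; rewrite -{1}e13 inE.
have := pairing_sum4 v pl.
by case: (v \in labels l row0); case: (v \in labels l row1);
  case: (v \in labels l row2); case: (v \in labels l row3).
Qed.

(** The contraction norm produced by [diagram_bound] depends only on [r]. It may be computed on rows
    0 and 1 of the model diagram, where it is the whole circular integral. *)
Lemma diagram_le_circular n m (l : 'I_(n * d) -> 'I_m) p q m' r
    (mE' : m' = (2 * d)%N) (r0 : (0 < r)%N) (rd : (r < d)%N) x y z :
  pairing l -> p != q -> #|(labels l p :&: labels l q)%SET| = r ->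
  diagram l x ^+ 2 <= diagram (circ_labeling mE' r0 rd) y *
    spint rho [set: 'I_d]%SET (fun t => f t ^+ 2) z ^+ (n - 2).
Proof.
move=> pl pq pqr.
have m4 : m' = (4 * d)./2.
  by rewrite mE' (_ : 4 * d = (2 * d).*2)%N ?doubleK//; lia.
have pc := circ_pairing mE' r0 rd.
rewrite (diagram_circular _ m4 pc); last first.
  apply/eqP; rewrite -(M2c_labels d0 m4 (kernel_part _) (kernel_labels _)).
    exact: circ_M2c.
  exact: circ_M2.
rewrite -(@contraction_norm2_card _ _ _ rho _ f bf symf _ _ (labels l p) (labels l q) _ _ x)//.
- apply: diagram_bound => //; first by move=> j; exact: card_labels.
  by move=> v; exact: pairing_two.
- exact: card_labels.
- exact: card_labels.
- exact: card_labels.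
- exact: card_labels.
- by rewrite pqr card_circ_meet.
Qed.

End DiagramIntegral.

Lemma M2_labeling n d (sigma : {set {set 'I_(n * d)}}) : sigma \in M2 n d ->
  exists2 l : 'I_(n * d) -> 'I_(n * d)./2, labels_of l sigma &
    forall i, l i = block_index sigma i :> nat.
Proof.
move=> s2; exists (fun i => Ordinal (block_index_lt i s2)) => // i j.
by rewrite -eq_block_index//; move: s2; rewrite inE => /andP[].
Qed.

(** * Permutations of the variables of rows 0 and 2 *)

Section Relabel02.
Variables (d m : nat).
Hypotheses (d0 : (0 < d)%N) (mE : m = (4 * d)./2).
Implicit Types (l : {ffun 'I_(4 * d) -> 'I_m}) (s : {perm 'I_m}).

(** Rows 1 and 3 keep their labels, so the way the pairs of rows are glued together changes, and
    with it the partition. Finite functions are used so that labelings can be summed over. *)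
Definition relabel02 s l : {ffun 'I_(4 * d) -> 'I_m} :=
  [ffun i => if (rowof i == row0) || (rowof i == row2) then s (l i) else l i].

Definition noncircular l := (kernel l \in M2 4 d) && (kernel l \notin M2c d).

Definition free_labels l : {set 'I_m} :=
  ((labels l row0 :\: labels l row2) :|: (labels l row2 :\: labels l row0))%SET.

Lemma labels_relabel02 s l p : labels (relabel02 s l) p =
  if (p == row0) || (p == row2) then (s @: labels l p)%SET else labels l p.
Proof.
apply/setP => v; apply/labelsP/idP => [[i <- ->]|].
  rewrite ffunE; case: ifP => _; last exact: mem_labels.
  by rewrite mem_imset ?mem_labels//; exact: perm_inj.
case: ifP => p02.
  by move=> /imsetP[_ /labelsP[i ip ->] ->]; exists i => //; rewrite ffunE ip p02.
by move=> /labelsP[i ip ->]; exists i => //; rewrite ffunE ip p02.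
Qed.

Lemma relabel02K s : cancel (relabel02 s) (relabel02 s^-1%g).
Proof. by move=> l; apply/ffunP => i; rewrite !ffunE; case: (_ || _); rewrite ?permK. Qed.

Lemma noncircularP l : reflect
  [/\ pairing l, connected_rows l &
      (labels l row0 :&: labels l row2)%SET != finset.set0] (noncircular l).
Proof.
have kp := kernel_part l; have kl := kernel_labels l.
apply: (iffP andP) => [[k2]|[pl cl l02]].
  rewrite (M2c_labels d0 mE kp kl k2) => l02.
  by have [pl cl] := M2_pairing (isT : (0 < 4)%N) d0 kp kl mE k2.
have k2 : kernel l \in M2 4 d by apply: (labels_M2 _ _ kp kl).
by rewrite (M2c_labels d0 mE kp kl k2).
Qed.

Lemma in_free_labels l v :
  (v \in free_labels l) = ((v \in labels l row0) != (v \in labels l row2)).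
Proof.
by rewrite !inE; case: (v \in labels l row0); case: (v \in labels l row2).
Qed.

(** A label shared by rows 0 and 2 is not free and stays in place; noncircularity provides one, and
    [card_meet13] provides one shared by rows 1 and 3. With a free label joining the two pairs, the
    diagram stays connected. The set of free labels, hence the acting group, is constant along an
    orbit. *)
Lemma relabel02_noncircular s l : perm_on (free_labels l) s -> noncircular l ->
  noncircular (relabel02 s l) /\ free_labels (relabel02 s l) = free_labels l.
Proof.
move=> sX /noncircularP[pl cl l02]; set l' := relabel02 s l.
have is_ : injective s by exact: perm_inj.
have L0 : labels l' row0 = (s @: labels l row0)%SET by rewrite labels_relabel02.
have L2 : labels l' row2 = (s @: labels l row2)%SET by rewrite labels_relabel02.
have L1 : labels l' row1 = labels l row1 by rewrite labels_relabel02.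
have L3 : labels l' row3 = labels l row3 by rewrite labels_relabel02.
have X' : free_labels l' = free_labels l.
  rewrite /free_labels L0 L2 -!(imsetD_inj _ _ is_) -imsetU.
  exact: im_perm_on.
have sum4 v := pairing_sum4 v pl.
have outX (E : {set 'I_m}) v : v \notin free_labels l -> (v \in (s @: E)%SET) = (v \in E).
  by move=> vX; rewrite -{1}(out_perm sX vX) mem_imset.
have pl' : pairing l'.
  apply: pairing_of_sum => [i j rij|v].
    by rewrite !ffunE rij; case: ifP => _ => [/perm_inj|]; apply: pl.2.
  rewrite big_row4 L0 L1 L2 L3 /=.
  have [vX|vX] := boolP (v \in free_labels l); last by rewrite !outX// sum4.
  have := vX; rewrite -X' in_free_labels L0 L2; move: vX; rewrite in_free_labels.
  have := sum4 v.
  by do 6! case: (v \in _).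
split=> //; apply/noncircularP; split=> //.
  have /set0Pn[v /finset.setIP[v0 v2]] := l02.
  have vX : v \notin free_labels l by rewrite in_free_labels v0 v2.
  have /set0Pn[w /finset.setIP[w1 w3]] :
      (labels l row1 :&: labels l row3)%SET != finset.set0.
    by rewrite -card_gt0 (card_meet13 d0 mE pl) card_gt0.
  (* Without free labels, rows 0 and 2 would carry the same labels and be disconnected from row
     1. *)
  have /set0Pn[u uX] : free_labels l != finset.set0.
    apply/eqP => X0.
    have sub : labels l row0 \subset labels l row2.
      apply/fintype.subsetP => k k0; have := in_free_labels l k.
      by rewrite X0 finset.in_set0 k0; case: (k \in labels l row2).
    have /setP/(_ row1) := labels_subset_rows pl cl (isT : row0 != row2) sub.
    by rewrite !inE.
  apply: (@connected_rows02 _ _ l' v w u); rewrite ?L0 ?L1 ?L2 ?L3//.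
  - by rewrite outX.
  - by rewrite outX.
  - have : u \in free_labels l' by rewrite X'.
    by rewrite in_free_labels L0 L2; do 2! case: (u \in _).
  - have := sum4 u; move: uX; rewrite in_free_labels.
    by do 4! case: (u \in _).
have /set0Pn[v /finset.setIP[v0 v2]] := l02.
have vX : v \notin free_labels l by rewrite in_free_labels v0 v2.
by apply/set0Pn; exists v; rewrite inE L0 L2 !outX// v0 v2.
Qed.

End Relabel02.

(** * Nonnegativity of the noncircular sum *)

Section NoncircularSum.
Context (disp : measure_display) (T : measurableType disp) (R : realType).
Variable rho : {finite_measure set T -> \bar R}.
Variables (d : nat) (f : d.-tuple T -> R).
Hypotheses (bf : bmeas f) (d0 : (0 < d)%N).
Hypothesis symf : forall (s : 'S_d) x, f (tuple_perm s x) = f x.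
Variables (m : nat) (x : m.-tuple T).
Hypothesis mE : m = (4 * d)./2.
Local Notation lab := {ffun 'I_(4 * d) -> 'I_m}.
Local Notation diagram l := (diagram rho f l x).

(** The two pairs are the opposite rows 0, 2 and 1, 3: as each label occurs in two rows, a label in
    just one of the first pair is in just one of the second. *)
Lemma diagram_orbit (l : lab) : noncircular l ->
  0 <= \sum_(s : {perm 'I_m} | perm_on (free_labels l) s) diagram (relabel02 s l).
Proof.
move=> /(noncircularP d0 mE)[pl cl l02].
have sum4 v := pairing_sum4 v pl.
have X13 : ((labels l row1 :\: labels l row3) :|: (labels l row3 :\: labels l row1))%SET =
    free_labels l.
  apply/setP => v; have := sum4 v; rewrite !inE.
  by case: (v \in labels l row0); case: (v \in labels l row1);
     case: (v \in labels l row2); case: (v \in labels l row3).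
apply: le_trans (@diagram_orbit_ge0 _ _ _ rho _ f bf symf _ (labels l row0) (labels l row2)
  (labels l row1) (labels l row3) x _ _ _ _ X13 _ _ _) _.
- exact: card_labels.
- exact: card_labels.
- exact: card_labels.
- exact: card_labels.
- rewrite disjoint_subset; apply/fintype.subsetP => v; have := sum4 v; rewrite !inE.
  by case: (v \in labels l row0); case: (v \in labels l row1);
     case: (v \in labels l row2); case: (v \in labels l row3).
- rewrite disjoint_subset; apply/fintype.subsetP => v; have := sum4 v; rewrite !inE.
  by case: (v \in labels l row0); case: (v \in labels l row1);
     case: (v \in labels l row2); case: (v \in labels l row3).
- apply/setP => v; have := sum4 v; rewrite !inE.
  by case: (v \in labels l row0); case: (v \in labels l row1);
     case: (v \in labels l row2); case: (v \in labels l row3).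
rewrite le_eqVlt; apply/orP; left; apply/eqP; apply: eq_bigr => s _.
congr (spint _ _ _); apply/funext => y.
by rewrite big_row4 !labels_relabel02 /= mulrACA.
Qed.

Lemma sum_labelings_ge0 : 0 <= \sum_(l : lab | noncircular l) diagram l.
Proof.
rewrite (partition_big (@free_labels d m) xpredT)//=; apply: sumr_ge0 => X _.
have n0 : 0 < (#|[pred s : {perm 'I_m} | perm_on X s]|)%:R :> R.
  by rewrite ltr0n; apply/card_gt0P; exists 1%g; rewrite inE perm_on1.
rewrite -(pmulr_rge0 _ n0) mulr_natl -sumr_const.
(* Each [s] permutes the noncircular labelings with free set [X], so the sum can be repeated once
   per [s]; exchanging the two sums leaves orbit sums. *)
rewrite (eq_bigr (fun s : {perm 'I_m} =>
   \sum_(l : lab | noncircular l && (free_labels l == X)) diagram (relabel02 s l))); last first.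
  move=> s sX; rewrite (reindex_inj (can_inj (relabel02K s))) /=; apply: eq_bigl => l.
  apply/andP/andP => [[nl /eqP lX]|[nl /eqP lX]].
    have := @relabel02_noncircular _ _ d0 mE s^-1%g (relabel02 s l).
    by rewrite relabel02K lX => /(_ (perm_onV sX) nl)[-> ->].
  by have := @relabel02_noncircular _ _ d0 mE s l; rewrite lX => /(_ sX nl)[-> ->].
rewrite exchange_big /=; apply: sumr_ge0 => l /andP[nl /eqP lX].
by have := diagram_orbit nl; rewrite lX.
Qed.

(** The labelings of a given partition form one free orbit under renaming of the variables, and all
    have the same integral. Hence the factor [m]!. *)
Lemma sum_noncircular_ge0 (F : {set {set 'I_(4 * d)}} -> R) :
  (forall sigma (l : lab), sigma \in M2 4 d -> pairing l -> labels_of l sigma ->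
     F sigma = diagram l) ->
  0 <= \sum_(sigma in M2 4 d | sigma \notin M2c d) F sigma.
Proof.
move=> FE.
have n0 : 0 < (#|{perm 'I_m}|)%:R :> R by rewrite ltr0n; apply/card_gt0P; exists 1%g.
rewrite -(pmulr_rge0 _ n0).
have -> : (#|{perm 'I_m}|)%:R * \sum_(sigma in M2 4 d | sigma \notin M2c d) F sigma =
    \sum_(l : lab | noncircular l) diagram l; last exact: sum_labelings_ge0.
rewrite (partition_big (fun l : lab => kernel l)
  (fun sigma => (sigma \in M2 4 d) && (sigma \notin M2c d)))//=.
rewrite mulr_sumr; apply: eq_bigr => sigma /andP[s2 sc].
have ps : is_part sigma by move: s2; rewrite inE => /andP[].
have pairP (l : lab) : labels_of l sigma -> pairing l.
  by move=> ls; have [] := M2_pairing (isT : (0 < 4)%N) d0 ps ls mE s2.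
have [l0 ls0] : exists l0 : lab, labels_of l0 sigma.
  have [l ls _] := M2_labeling s2.
  by exists [ffun i => cast_ord (esym mE) (l i)] => i j; rewrite !ffunE (inj_eq (@cast_ord_inj _ _ _)).
have pl0 := pairP _ ls0.
have ls (s : {perm 'I_m}) : labels_of [ffun i => s (l0 i)] sigma.
  by move=> i j; rewrite !ffunE (inj_eq (@perm_inj _ s)) ls0.
rewrite (eq_bigl (fun l => l \in [set [ffun i => s (l0 i)] | s : {perm 'I_m}]%SET)); last first.
  move=> l; apply/andP/imsetP => [[_ /eqP kl]|[s _ ->]].
    have lsl : labels_of l sigma by rewrite -kl; exact: kernel_labels.
    have [s lE] := relabel pl0 (pairP _ lsl) ls0 lsl.
    by exists s => //; apply/ffunP => i; rewrite ffunE lE.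
  by rewrite /noncircular !(labels_of_kernel ps (ls s)) s2 sc.
rewrite big_imset /=.
  rewrite (eq_bigr (fun=> F sigma)) ?sumr_const ?mulr_natl// => s _.
  by rewrite (FE sigma _ s2 (pairP _ (ls s)) (ls s)).
move=> s s' _ _ /ffunP ss'; apply/permP => v.
have [i [_ [<- _ _ _]]] := pairing_fiber pl0 v.
by have := ss' i; rewrite !ffunE.
Qed.

End NoncircularSum.

(** * Passage to square integrable kernels *)

Section FsigmaBounded.
Context (disp : measure_display) (T : measurableType disp) (R : realType).

Lemma fsigma_pull n d m (f : d.-tuple T -> R) (sigma : {set {set 'I_(n * d)}})
    (l : 'I_(n * d) -> 'I_m) (y : m.-tuple T) :
  (forall i, l i = block_index sigma i :> nat) ->
  fsigma f sigma y = \prod_p f (pull (fun k => l (dpos p k)) y).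
Proof.
move=> lE; apply: eq_bigr => p _; congr f; apply: eq_from_tnth => k.
by rewrite !tnth_mktuple -lE -tnth_nth.
Qed.

Lemma fsigma_onset n d m (f : d.-tuple T -> R) (sigma : {set {set 'I_(n * d)}})
    (l : 'I_(n * d) -> 'I_m) (y : m.-tuple T) :
  (forall (s : 'S_d) x, f (tuple_perm s x) = f x) -> pairing l ->
  (forall i, l i = block_index sigma i :> nat) ->
  fsigma f sigma y = \prod_p onset f (labels l p) y.
Proof.
move=> symf pl lE; rewrite (fsigma_pull _ _ lE); apply: eq_bigr => p _.
have il : injective (fun k => l (dpos p k)).
  by move=> j k /(pl.2 (dpos p j) (dpos p k)); rewrite !rowof_dpos => /(_ erefl)/dpos_inj.
rewrite -(onset_inj symf _ il); congr (onset f _ y).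
by rewrite /labels /drow -imset_comp; apply/setP => v; apply/imsetP/imsetP => -[k _ ->]; exists k.
Qed.

Lemma diagram_CS (rho : {finite_measure set T -> \bar R}) n d m
    (f : d.-tuple T -> R) (l : 'I_(n * d) -> 'I_m) x y :
  bmeas f -> (forall (s : 'S_d) x, f (tuple_perm s x) = f x) -> pairing l ->
  diagram rho f l x ^+ 2 <= spint rho [set: 'I_d]%SET (fun t => f t ^+ 2) y ^+ n.
Proof.
move=> bf symf pl.
apply: (le_trans (@spint_gCS _ _ _ rho _ _ (labels l) (fun p => onset f (labels l p)) _ x _ _ _ _)).
- by move=> p; apply: onset_bmeas => //; exact: card_labels.
- by move=> i p _; exact: onset_indep.
- by move=> p; exact: finset.subsetT.
- by move=> v _; exact: pairing_two.
under eq_bigr => p _ do rewrite (spint_onset_sqr rho bf symf _ y (card_labels pl p)).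
by rewrite prodr_const card_ord.
Qed.

Variable nu : {sigma_finite_measure set T -> \bar R}.
Variables (D : set T) (mD : measurable D) (Doo : (nu D < +oo)%E).

Lemma fsigma_bmeas n d m (f : d.-tuple T -> R) (sigma : {set {set 'I_(n * d)}})
    (l : 'I_(n * d) -> 'I_m) : bmeas f ->
  (forall i, l i = block_index sigma i :> nat) ->
  bmeas (fun y : m.-tuple T => fsigma f sigma y).
Proof.
move=> bf lE; under eq_fun do rewrite (fsigma_pull _ _ lE).
apply: bmeas_prod => p; apply: bmeas_comp bf => //; exact: measurable_pull.
Qed.

Lemma Rintegral_fsigma n d m (f : d.-tuple T -> R)
    (sigma : {set {set 'I_(n * d)}}) (l : 'I_(n * d) -> 'I_m) x :
  bmeas f -> (forall (s : 'S_d) x, f (tuple_perm s x) = f x) ->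
  (forall x, ~ box D d x -> f x = 0) ->
  pairing l -> (forall i, l i = block_index sigma i :> nat) ->
  \int[power_measure nu m]_y fsigma f sigma y = diagram (restricted mD Doo) f l x.
Proof.
move=> bf symf f0 pl lE.
rewrite (@Rintegral_power_measure _ _ _ nu D mD Doo _ _ x).
- rewrite /diagram; congr (spint _ _ _); apply/funext => y.
  exact: fsigma_onset.
- exact: fsigma_bmeas bf lE.
move=> y yD; rewrite (fsigma_pull _ _ lE).
(* Every variable occurs in some row, so a coordinate outside [D] makes one kernel vanish. *)
have [v vD] : exists v, ~ D (tnth y v) by apply/existsNP.
have [i [_ [lv _ _ _]]] := pairing_fiber pl v.
have [k ik] := dpos_rowof i.
rewrite (bigD1 (rowof i))//= f0 ?mul0r// => /(_ k); rewrite tnth_pull -ik lv.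
exact: vD.
Qed.

End FsigmaBounded.

(** * Truncation and convergence of diagram integrals *)

Section Truncation.
Context (disp : measure_display) (T : measurableType disp) (R : realType).
Variable nu : {sigma_finite_measure set T -> \bar R}.
Variable B : nat -> set T.
Hypotheses (UB : forall z, exists i, B i z)
  (ndB : forall i j, (i <= j)%N -> B i `<=` B j)
  (mB : forall i, measurable (B i)) (Boo : forall i, (nu (B i) < +oo)%E).
Variables (d : nat) (f : d.-tuple T -> R).
Hypothesis mf : measurable_fun setT f.
Hypothesis symf : forall (s : 'S_d) x, f (tuple_perm s x) = f x.

(** Both conditions are invariant under permutations of the coordinates, so truncation preserves
    symmetry while giving a bounded kernel supported in a cube of finite measure. *)
Definition trunc_set k : set (d.-tuple T) :=
  box (B k) d `&` [set x | `|f x| <= k%:R].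

Definition trunc k (x : d.-tuple T) : R := f x * \1_(trunc_set k) x.

Lemma measurable_trunc_set k : measurable (trunc_set k).
Proof.
apply: measurableI; first exact: measurable_box.
rewrite (_ : [set x | _] = (fun x => `|f x|) @^-1` [set` `]-oo, (k%:R : R)]]); last first.
  by apply/seteqP; split => x /=; rewrite in_itv.
rewrite -[X in measurable X]setTI.
have mn : measurable_fun setT (fun x => `|f x|) by exact: measurableT_comp.
exact: mn.
Qed.

Lemma trunc_in k x : trunc_set k x -> trunc k x = f x.
Proof. by move=> kx; rewrite /trunc indicE mem_set ?mulr1. Qed.

Lemma trunc_out k x : ~ trunc_set k x -> trunc k x = 0.
Proof. by move=> kx; rewrite /trunc indicE memNset ?mulr0. Qed.

Lemma trunc_bmeas k : bmeas (trunc k).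
Proof.
split.
  by apply: measurable_funM => //; apply: measurable_indic; exact: measurable_trunc_set.
exists k%:R => x; have [kx|kx] := pselect (trunc_set k x).
  by rewrite trunc_in//; case: kx.
by rewrite trunc_out// normr0.
Qed.

Lemma trunc_set_perm k (s : 'S_d) x : trunc_set k (tuple_perm s x) <-> trunc_set k x.
Proof.
rewrite /trunc_set /= symf; split => -[xB fx]; split=> // i.
  by have := xB (s^-1%g i); rewrite tnth_mktuple permKV.
by rewrite tnth_mktuple.
Qed.

Lemma trunc_perm k (s : 'S_d) x : trunc k (tuple_perm s x) = trunc k x.
Proof.
have [kx|kx] := pselect (trunc_set k x).
  by rewrite !trunc_in ?symf//; apply/trunc_set_perm.
by rewrite !trunc_out//; apply: contra_not kx => /trunc_set_perm.
Qed.

Lemma trunc_box k x : ~ box (B k) d x -> trunc k x = 0.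
Proof. by move=> kx; apply: trunc_out => -[]. Qed.

Lemma trunc_set_nd k k' : (k <= k')%N -> trunc_set k `<=` trunc_set k'.
Proof.
move=> kk' x [xB fx]; split=> [i|]; first exact: ndB (xB i).
by apply: le_trans fx _; rewrite ler_nat.
Qed.

Lemma le_trunc k x : `|trunc k x| <= `|f x|.
Proof.
have [kx|kx] := pselect (trunc_set k x); first by rewrite trunc_in.
by rewrite trunc_out// normr0.
Qed.

Lemma trunc_nd k k' x : (k <= k')%N -> `|trunc k x| <= `|trunc k' x|.
Proof.
move=> kk'; have [kx|kx] := pselect (trunc_set k x).
  by rewrite !trunc_in//; exact: trunc_set_nd kx.
by rewrite trunc_out// normr0.
Qed.

(** The sets [B] increase and exhaust the space, and [x] has finitely many coordinates. Pointwise
    convergence is thus eventual equality. *)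
Lemma trunc_eventually x : exists K, forall k, (K <= k)%N -> trunc k x = f x.
Proof.
have [g gB] := choice UB.
exists (maxn (Num.bound `|f x|) (\max_(i < d) g (tnth x i))) => k.
rewrite geq_max => /andP[k1 k2]; apply: trunc_in; split=> [i|/=].
  apply: ndB (gB _); apply: leq_trans k2; exact: (leq_bigmax i).
by rewrite (le_trans (ltW (archi_boundP _)))// ler_nat.
Qed.

Lemma trunc_eventually_fin (I : finType) (x : I -> d.-tuple T) :
  exists K, forall k, (K <= k)%N -> forall i, trunc k (x i) = f (x i).
Proof.
have [K KP] := choice (fun i => trunc_eventually (x i)).
exists (\max_i K i) => k Kk i; apply: KP; apply: leq_trans Kk; exact: leq_bigmax.
Qed.

Hypothesis if2 : (power_measure nu d).-integrable setT (EFin \o (fun x => f x ^+ 2)).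

Local Notation rho k := (restricted (mB k) (Boo k)).
Local Notation norm2 := (\int[power_measure nu d]_x f x ^+ 2).

Lemma spint_trunc_le k x :
  spint (rho k) [set: 'I_d]%SET (fun t => trunc k t ^+ 2) x <= norm2.
Proof.
have b2 : bmeas (fun t => trunc k t ^+ 2) by exact/bmeas_sqr/trunc_bmeas.
have o2 t : ~ box (B k) d t -> trunc k t ^+ 2 = 0.
  by move=> kt; rewrite trunc_box// expr0n.
rewrite -(Rintegral_power_measure (mB k) (Boo k) x b2 o2).
apply: le_Rintegral => // [|t _]; first exact: (box_integrable (mB k) (Boo k) b2 o2).
rewrite -[X in X <= _]real_normK ?num_real// -[X in _ <= X]real_normK ?num_real//.
by rewrite lerXn2r ?nnegrE// le_trunc.
Qed.

Variables (n : nat) (sigma : {set {set 'I_(n * d)}}).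
Variables (m : nat) (l : 'I_(n * d) -> 'I_m).
Hypotheses (pl : pairing l) (lE : forall i, l i = block_index sigma i :> nat).

Lemma measurable_fsigma (g : d.-tuple T -> R) : measurable_fun setT g ->
  measurable_fun setT (fun y : m.-tuple T => fsigma g sigma y).
Proof.
move=> mg; under eq_fun do rewrite (fsigma_pull _ _ lE).
apply: measurable_prod => p _; apply: measurableT_comp mg _; exact: measurable_pull.
Qed.

Lemma fsigma_norm (g : d.-tuple T -> R) (y : m.-tuple T) :
  `|fsigma g sigma y| = fsigma (fun x => `|g x|) sigma y.
Proof. by rewrite !(fsigma_pull _ _ lE) normr_prod. Qed.

Lemma le_fsigma_norm (g h : d.-tuple T -> R) (y : m.-tuple T) :
  (forall x, `|g x| <= `|h x|) -> `|fsigma g sigma y| <= `|fsigma h sigma y|.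
Proof.
move=> gh; rewrite !fsigma_norm !(fsigma_pull _ _ lE); apply: ler_prod => p _.
by rewrite normr_ge0 gh.
Qed.

Lemma fsigma_trunc_cvg (y : m.-tuple T) (h : R -> R) :
  (h (fsigma (trunc k) sigma y))%:E @[k --> \oo] --> (h (fsigma f sigma y))%:E.
Proof.
have [K KP] := trunc_eventually_fin (fun p : 'I_n => pull (fun k => l (dpos p k)) y).
apply: cvg_near_cst; exists K => // k Kk /=; congr (h _)%:E.
by rewrite !(fsigma_pull _ _ lE); apply: eq_bigr => p _; exact: KP.
Qed.

Lemma Rintegral_fsigma_trunc k x :
  \int[power_measure nu m]_y fsigma (trunc k) sigma y = diagram (rho k) (trunc k) l x.
Proof.
apply: Rintegral_fsigma => //; [exact: trunc_bmeas|exact: trunc_perm|].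
exact: trunc_box.
Qed.

(** The bound is uniform in [k]. It is [diagram_CS] for the kernel [|trunc k|], which is still
    bounded and symmetric and has norm at most that of [f]. *)
Lemma integral_fsigma_trunc_le k :
  (\int[power_measure nu m]_y (`|fsigma (trunc k) sigma y|)%:E <= (norm2 ^+ n + 1)%:E)%E.
Proof.
pose g x := `|trunc k x|.
have bg : bmeas g by exact/bmeas_norm/trunc_bmeas.
have sg (s : 'S_d) x : g (tuple_perm s x) = g x by rewrite /g trunc_perm.
have g0 x : ~ box (B k) d x -> g x = 0 by move=> kx; rewrite /g trunc_box// normr0.
under eq_integral do rewrite fsigma_norm.
have bF := fsigma_bmeas (m := m) bg lE.
have F0 (y : m.-tuple T) : ~ box (B k) m y -> fsigma g sigma y = 0.
  move=> yB; rewrite (fsigma_pull _ _ lE).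
  have [v vB] : exists v, ~ B k (tnth y v) by apply/existsNP.
  have [i [_ [lv _ _ _]]] := pairing_fiber pl v.
  have [j ij] := dpos_rowof i.
  rewrite (bigD1 (rowof i))//= g0 ?mul0r// => /(_ j); rewrite tnth_pull -ij lv.
  exact: vB.
rewrite -(EFin_Rintegral measurableT (box_integrable (mB k) (Boo k) bF F0)) lee_fin.
pose x : m.-tuple T := [tuple point | _ < m].
pose x' : d.-tuple T := [tuple point | _ < d].
rewrite (Rintegral_fsigma (mB k) (Boo k) x bg sg g0 pl lE).
have := diagram_CS (restricted (mB k) (Boo k)) x x' bg sg pl.
set a := diagram _ _ _ _ => a2.
have {}a2 : a ^+ 2 <= norm2 ^+ n.
  apply: le_trans a2 _; rewrite lerXn2r ?nnegrE//.
  - by apply: spint_ge0 => t; exact: sqr_ge0.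
  - by apply: Rintegral_ge0 => t _; exact: sqr_ge0.
  rewrite (_ : (fun t => g t ^+ 2) = (fun t => trunc k t ^+ 2)); last first.
    by apply/funext => t; rewrite /g real_normK ?num_real.
  exact: spint_trunc_le.
(* The term 1 comes from [a <= a ^+ 2 + 1], which avoids a square root. *)
by have := sqr_ge0 (a - 1); nra.
Qed.

(** Monotone convergence along [|trunc k|], with the uniform bound above: square integrability of
    [f] makes the diagram of [|f|] finite. *)
Lemma integrable_fsigma :
  (power_measure nu m).-integrable setT (EFin \o (fun y => fsigma f sigma y)).
Proof.
apply/integrableP; split; first by apply/measurable_EFinP; apply: measurable_fsigma.
have mF k : measurable_fun setT (fun y : m.-tuple T => (`|fsigma (trunc k) sigma y|)%:E).
  apply/measurable_EFinP/measurableT_comp => //.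
  by apply: measurable_fsigma; case: (trunc_bmeas k).
have F0 k (y : m.-tuple T) : setT y -> (0 <= (`|fsigma (trunc k) sigma y|)%:E)%E.
  by rewrite lee_fin.
have ndF (y : m.-tuple T) : setT y ->
    {homo (fun k => (`|fsigma (trunc k) sigma y|)%:E) : i j / (i <= j)%N >-> (i <= j)%E}.
  by move=> _ i j ij; rewrite lee_fin; apply: le_fsigma_norm => x; exact: trunc_nd.
have cF := cvg_monotone_convergence (mu := power_measure nu m) measurableT mF F0 ndF.
rewrite (eq_integral (fun y => limn (fun k => (`|fsigma (trunc k) sigma y|)%:E))); last first.
  move=> y _; apply/esym/cvg_lim => //.
  rewrite -[X in _ --> X]/((`|fsigma f sigma y|)%:E); exact: (@fsigma_trunc_cvg y (fun z => `|z|)).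
rewrite -(cvg_lim _ cF)//; apply: le_lt_trans (ltry (norm2 ^+ n + 1)).
apply: lime_le; first by apply/cvg_ex; eexists; exact: cF.
by apply: nearW => k; exact: integral_fsigma_trunc_le.
Qed.

Lemma Rintegral_fsigma_trunc_cvg :
  \int[power_measure nu m]_y fsigma (trunc k) sigma y @[k --> \oo] -->
  \int[power_measure nu m]_y fsigma f sigma y.
Proof.
apply: fine_cvg; rewrite EFin_Rintegral//; last exact: integrable_fsigma.
have [|||||_ _ //] := @dominated_convergence _ _ _ (power_measure nu m) setT measurableT
  (fun k y => (fsigma (trunc k) sigma y)%:E) (fun y => (fsigma f sigma y)%:E)
  (fun y => `|(fsigma f sigma y)%:E|%E).
- move=> k; apply/measurable_EFinP; apply: measurable_fsigma.
  by case: (trunc_bmeas k).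
- by apply/measurable_EFinP; apply: measurable_fsigma.
- by apply: aeW => y _; exact: (@fsigma_trunc_cvg y id).
- exact: integrable_abse integrable_fsigma.
- by apply: aeW => y k _; rewrite lee_fin; apply: le_fsigma_norm => x; exact: le_trunc.
Qed.

End Truncation.

(** * Diagram integrals of square integrable kernels *)

Section SquareIntegrable.
Context (disp : measure_display) (T : measurableType disp) (R : realType).
Variable nu : {sigma_finite_measure set T -> \bar R}.

Lemma sigma_finite_exhaustion : exists B : nat -> set T,
  [/\ forall z, exists i, B i z, forall i j, (i <= j)%N -> B i `<=` B j,
      forall i, measurable (B i) & forall i, (nu (B i) < +oo)%E].
Proof.
have /sigma_finiteP[B [BT ndB mB]] := sigma_finiteT nu.
exists B; split=> [z|i j ij|i|i].
- have [i _ Bi] : (\bigcup_i B i) z by rewrite -BT.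
  by exists i.
- by apply/subsetPset; exact: ndB.
- by have [] := mB i.
- by have [] := mB i.
Qed.

Definition diagram_integral n d m (f : d.-tuple T -> R)
    (sigma : {set {set 'I_(n * d)}}) : R :=
  \int[power_measure nu m]_y fsigma f sigma y.

Definition sqnorm d (f : d.-tuple T -> R) : R :=
  \int[power_measure nu d]_x f x ^+ 2.

(** Unlike in [L2s], symmetry holds at every point, so that truncations of [f] are kernels to which
    the contraction calculus applies. *)
Definition symL2 d (f : d.-tuple T -> R) :=
  [/\ measurable_fun setT f, forall (s : 'S_d) x, f (tuple_perm s x) = f x &
      (power_measure nu d).-integrable setT (EFin \o (fun x => f x ^+ 2))].

Lemma M2_labels n d m (sigma : {set {set 'I_(n * d)}}) :
  (0 < n)%N -> (0 < d)%N -> m = (n * d)./2 -> sigma \in M2 n d ->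
  exists l : 'I_(n * d) -> 'I_m, [/\ pairing l, connected_rows l,
    labels_of l sigma & forall i, l i = block_index sigma i :> nat].
Proof.
move=> n0 d0 mE s2; subst m; have [l ls lE] := M2_labeling s2; exists l.
have ps : is_part sigma by move: s2; rewrite inE => /andP[].
by have [] := M2_pairing n0 d0 ps ls erefl s2.
Qed.

Lemma half4 d : (4 * d)./2 = (2 * d)%N.
Proof. by rewrite (_ : 4 * d = (2 * d).*2)%N ?doubleK//; lia. Qed.

Lemma diagram_integral_circ_ge0 d (f : d.-tuple T -> R)
    (sigma : {set {set 'I_(4 * d)}}) : (0 < d)%N -> symL2 f ->
  sigma \in M2c d -> 0 <= diagram_integral (2 * d) f sigma.
Proof.
move=> d0 [mf sf if2] sc.
have s2 : sigma \in M2 4 d by move: sc; rewrite inE => /andP[].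
have [l [pl cl ls lE]] := M2_labels (isT : (0 < 4)%N) d0 (esym (half4 d)) s2.
have ps : is_part sigma by move: s2; rewrite inE => /andP[].
have [B [UB ndB mB Boo]] := sigma_finite_exhaustion.
have cv := Rintegral_fsigma_trunc_cvg UB ndB mB Boo mf sf if2 pl lE.
apply: (cvgr_to_ge cv); apply: nearW => k.
pose x : (2 * d).-tuple T := [tuple point | _ < 2 * d].
rewrite (Rintegral_fsigma_trunc mB Boo mf sf pl lE k x) diagram_circular//.
- exact: contraction_norm2_ge0.
- exact: trunc_bmeas.
- exact: trunc_perm.
- by rewrite half4.
- by apply/eqP; rewrite -(M2c_labels d0 (esym (half4 d)) ps ls s2).
Qed.

Lemma sum_noncirc_integral_ge0 d (f : d.-tuple T -> R) : (0 < d)%N -> symL2 f ->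
  0 <= \sum_(sigma in M2 4 d | sigma \notin M2c d) diagram_integral (2 * d) f sigma.
Proof.
move=> d0 [mf sf if2].
have [B [UB ndB mB Boo]] := sigma_finite_exhaustion.
have cv : \sum_(sigma in M2 4 d | sigma \notin M2c d)
      diagram_integral (2 * d) (trunc B f k) sigma @[k --> \oo] -->
    \sum_(sigma in M2 4 d | sigma \notin M2c d) diagram_integral (2 * d) f sigma.
  apply: cvg_big; first exact: add_continuous.
  move=> sigma /andP[s2 _].
  have [l [pl cl ls lE]] := M2_labels (isT : (0 < 4)%N) d0 (esym (half4 d)) s2.
  exact: (Rintegral_fsigma_trunc_cvg UB ndB mB Boo mf sf if2 pl lE).
apply: (cvgr_to_ge cv); apply: nearW => k.
pose x : (2 * d).-tuple T := [tuple point | _ < 2 * d].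
apply: (@sum_noncircular_ge0 _ _ _ (restricted (mB k) (Boo k)) _ (trunc B f k) _ d0 _ _ x).
- exact: trunc_bmeas.
- exact: trunc_perm.
- by rewrite half4.
move=> sigma l s2 pl ls.
have [l' [pl' _ ls' lE']] := M2_labels (isT : (0 < 4)%N) d0 (esym (half4 d)) s2.
rewrite /diagram_integral (Rintegral_fsigma_trunc mB Boo mf sf pl' lE' k x).
by apply: diagram_labels pl pl' ls ls'; [exact: trunc_bmeas|exact: trunc_perm].
Qed.

(** The circular partition [tau] is chosen from [sigma] alone, before the kernel, so one instance of
    item 2 serves the whole sequence. *)
Lemma diagram_integral_le n d (sigma : {set {set 'I_(n * d)}}) :
  (0 < d)%N -> (3 <= n)%N -> sigma \in M2 n d ->
  exists2 tau, tau \in M2c d & forall f : d.-tuple T -> R, symL2 f ->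
    diagram_integral (n * d)./2 f sigma ^+ 2 <=
    diagram_integral (2 * d) f tau * sqnorm f ^+ (n - 2).
Proof.
move=> d0 n3 s2; have n0 : (0 < n)%N by exact: leq_trans n3.
have [l [pl cl ls lE]] := M2_labels n0 d0 erefl s2.
(* Any label gives two rows with a common variable; here it is the one at the first position. Then
   [0 < r], and [r = d] would leave only these two rows, against [3 <= n]. *)
pose v := l (dpos (Ordinal n0) (Ordinal d0)).
have [p [q [pq vpq]]] := pairing_two pl v.
pose r := #|(labels l p :&: labels l q)%SET|.
have r0 : (0 < r)%N.
  by apply/card_gt0P; exists v; rewrite inE !vpq !eqxx orbT.
have rd : (r < d)%N.
  rewrite ltn_neqAle -{2}(card_labels pl p) subset_leq_card ?subsetIl// andbT.
  apply/eqP => rE.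
  have sub : labels l p \subset labels l q.
    by apply/finset.setIidPl/eqP; rewrite eqEcard subsetIl (card_labels pl) -/r rE leqnn.
  have /(congr1 (fun A : {set 'I_n} => #|A|)) := labels_subset_rows pl cl pq sub.
  by rewrite cards2 pq cardsT card_ord => nE; move: n3; rewrite -nE.
pose lc := circ_labeling (erefl (2 * d)%N) r0 rd.
have pc : pairing lc by exact: circ_pairing.
have tc : kernel lc \in M2c d by exact: circ_M2c.
exists (kernel lc) => // f symf; have [mf sf if2] := symf.
have t2 : kernel lc \in M2 4 d by move: (tc); rewrite inE => /andP[].
have [l' [pl' _ ls' lE']] := M2_labels (isT : (0 < 4)%N) d0 (esym (half4 d)) t2.
have [B [UB ndB mB Boo]] := sigma_finite_exhaustion.
have cvs := Rintegral_fsigma_trunc_cvg UB ndB mB Boo mf sf if2 pl lE.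
have cvt := Rintegral_fsigma_trunc_cvg UB ndB mB Boo mf sf if2 pl' lE'.
rewrite expr2.
(* The inequality is proved for each truncation, whose norm is at most that of [f], and passes to
   the limit. *)
apply: (ler_cvg_to (cvgM cvs cvs) (cvgM cvt (cvg_cst (sqnorm f ^+ (n - 2))))).
apply: nearW => k /=.
pose x : (n * d)./2.-tuple T := [tuple point | _ < (n * d)./2].
pose x' : (2 * d).-tuple T := [tuple point | _ < 2 * d].
pose z : d.-tuple T := [tuple point | _ < d].
have bt := @trunc_bmeas _ _ _ B mB _ f mf k.
have st := @trunc_perm _ _ _ B _ f sf k.
rewrite !(Rintegral_fsigma_trunc mB Boo mf sf pl lE k x).
rewrite !(Rintegral_fsigma_trunc mB Boo mf sf pl' lE' k x') -expr2.
have := diagram_le_circular (restricted (mB k) (Boo k)) bt d0 st (erefl (2 * d)%N)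
  r0 rd x x' z pl pq erefl.
move=> /le_trans; apply.
rewrite (diagram_labels (restricted (mB k) (Boo k)) bt st x' pc pl' (kernel_labels _) ls').
apply: ler_wpM2l.
  rewrite diagram_circular//; first exact: contraction_norm2_ge0.
    by rewrite half4.
  apply/eqP; rewrite -(M2c_labels d0 (esym (half4 d)) (kernel_part _) (kernel_labels _) t2).
  exact: tc.
rewrite lerXn2r ?nnegrE//.
- by apply: spint_ge0 => t; exact: sqr_ge0.
- by apply: Rintegral_ge0 => t _; exact: sqr_ge0.
exact: (spint_trunc_le mB Boo mf if2 k z).
Qed.

End SquareIntegrable.

(** * From almost everywhere symmetric kernels to symmetric ones *)

Section Symmetrization.
Context (disp : measure_display) (T : measurableType disp) (R : realType).
Variable nu : {sigma_finite_measure set T -> \bar R}.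

(** The remaining coordinates may have infinite measure, so the preimage is cut into boxes of finite
    measure. On each of them, integrating first over the image of [e] already gives 0. *)
Lemma pull_null d m (e : 'I_d -> 'I_m) (A : set (d.-tuple T)) : injective e ->
  measurable A -> power_measure nu d A = 0%E ->
  power_measure nu m (pull e @^-1` A) = 0%E.
Proof.
move=> ie mA A0; have [B [UB ndB mB Boo]] := sigma_finite_exhaustion nu.
have mP : measurable (pull e @^-1` A).
  by rewrite -[X in measurable X]setTI; exact: measurable_pull.
apply/(negligibleP _ mP).
have -> : pull e @^-1` A = \bigcup_k (pull e @^-1` A `&` box (B k) m).
  rewrite -setI_bigcupr (_ : \bigcup_k _ = setT) ?setIT//.
  apply/seteqP; split=> // y _; have [g gB] := choice UB.
  exists (\max_(i < m) g (tnth y i)) => // i.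
  by apply: ndB (gB _); exact: (leq_bigmax i).
apply: negligible_bigcup => k.
have mPk : measurable (pull e @^-1` A `&` box (B k) m).
  by apply: measurableI => //; exact: measurable_box.
apply/(negligibleP _ mPk).
set Pk := _ `&` _ in mPk *; pose Ak := A `&` box (B k) d.
have mAk : measurable Ak by apply: measurableI => //; exact: measurable_box.
have bind m' (C : set (m'.-tuple T)) : measurable C -> bmeas (\1_C : _ -> R).
  move=> mC; split; first exact: measurable_indic.
  by exists 1 => x; rewrite indicE; case: (_ \in _); rewrite ?normr1 ?normr0.
pose x : m.-tuple T := [tuple point | _ < m].
have fin0 : \int[power_measure nu m]_y (\1_Pk y : R) = 0.
  have P0 y : ~ box (B k) m y -> \1_Pk y = 0 :> R.
    by move=> yB; rewrite indicE memNset// => -[].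
  rewrite (Rintegral_power_measure (mB k) (Boo k) x (bind _ _ mPk) P0).
  apply/eqP; rewrite eq_le; apply/andP; split; last first.
    by apply: spint_ge0 => y; rewrite indicE ler0n.
  have bg : bmeas ((\1_Ak : _ -> R) \o pull e).
    by apply: bmeas_comp (bind _ _ mAk); exact: measurable_pull.
  apply: (@le_trans _ _ (spint (restricted (mB k) (Boo k)) [set: 'I_m]%SET
      ((\1_Ak : _ -> R) \o pull e) x)).
    apply: le_spint => // [|y]; first exact: bind.
    rewrite /= !indicE ler_nat; have [yP|yP] := boolP (y \in Pk); last first.
      by case: (_ \in Ak).
    move: yP; rewrite inE => -[yA yB].
    by rewrite mem_set//; split=> // i; rewrite tnth_pull.
  (* The set integrated first is the right-hand one, that is the image of [e]. *)
  rewrite (_ : [set: 'I_m] = ~: (e @: [set: 'I_d]) :|: (e @: [set: 'I_d]))%SET; last first.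
    by rewrite finset.setUC finset.setUCr.
  rewrite spintU//; last first.
    by rewrite disjoint_sym disjoint_subset; apply/fintype.subsetP => i; rewrite !inE negbK.
  rewrite spint_imset//; last exact: bind.
  rewrite (_ : spint _ _ (\1_Ak : _ -> R) \o pull e = fun=> 0) ?spint0//.
  apply/funext => y /=.
  rewrite -(Rintegral_power_measure (mB k) (Boo k) _ (bind _ _ mAk)); last first.
    by move=> t tB; rewrite indicE memNset// => -[].
  rewrite /Rintegral integral_indic// setIT.
  by rewrite (subset_measure0 mAk mA _ A0)//; exact: subIsetl.
have : fine (power_measure nu m Pk) = 0.
  by rewrite -fin0 /Rintegral integral_indic// setIT.
(* [fine] also sends [+oo] to 0; finiteness of the measure of the box excludes this case. *)
move=> P0; rewrite -[LHS]fineK ?P0// ge0_fin_numE//.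
apply: le_lt_trans (power_measure_box_lty (mB k) (Boo k) m).
by apply: le_measure; rewrite ?inE//; [exact: measurable_box|exact: subIsetr].
Qed.

Lemma ae_pull d m (e : 'I_d -> 'I_m) (P : d.-tuple T -> Prop) : injective e ->
  {ae power_measure nu d, forall x, P x} ->
  {ae power_measure nu m, forall y, P (pull e y)}.
Proof.
move=> ie [A [mA A0 PA]]; exists (pull e @^-1` A); split.
- by rewrite -[X in measurable X]setTI; exact: measurable_pull.
- exact: pull_null.
- by move=> y /= yP; apply: PA.
Qed.

(** The positions of one row carry distinct labels, so each factor is [f] composed with an injective
    selection of coordinates, and exceptional null sets stay null. *)
Lemma diagram_integral_ae n d m (f g : d.-tuple T -> R)
    (sigma : {set {set 'I_(n * d)}}) : (0 < n)%N -> (0 < d)%N ->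
  m = (n * d)./2 -> sigma \in M2 n d ->
  measurable_fun setT f -> measurable_fun setT g ->
  {ae power_measure nu d, forall x, f x = g x} ->
  diagram_integral nu m f sigma = diagram_integral nu m g sigma.
Proof.
move=> n0 d0 mE s2 mf mg fg; have [l [pl _ _ lE]] := M2_labels n0 d0 mE s2.
rewrite /diagram_integral /Rintegral; congr fine; apply: ae_eq_integral => //.
- by apply/measurable_EFinP; apply: measurable_fsigma lE _ _.
- by apply/measurable_EFinP; apply: measurable_fsigma lE _ _.
have il p : injective (fun k => l (dpos p k)).
  by move=> j k /(pl.2 (dpos p j) (dpos p k)); rewrite !rowof_dpos => /(_ erefl)/dpos_inj.
have fgp : {ae power_measure nu m, forall y, forall p,
    f (pull (fun k => l (dpos p k)) y) = g (pull (fun k => l (dpos p k)) y)}.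
  by apply: filter_forall => p; exact: (ae_pull (il p) fg).
rewrite /ae_eq; apply: filterS fgp => y fgy _; rewrite !(fsigma_pull _ _ lE); congr EFin.
by apply: eq_bigr => p _; exact: fgy.
Qed.

Definition symmetrization d (f : d.-tuple T -> R) (x : d.-tuple T) : R :=
  d`!%:R^-1 * \sum_(s : 'S_d) f (tuple_perm s x).

Lemma L2s_symmetrization d (f : d.-tuple T -> R) : L2s nu f ->
  [/\ symL2 nu (symmetrization f),
      {ae power_measure nu d, forall x, f x = symmetrization f x} &
      sqnorm nu (symmetrization f) = sqnorm nu f].
Proof.
move=> [f2 fs].
have mf : measurable_fun setT f by move: f2; rewrite inE => /andP[]; rewrite inE.
have mg : measurable_fun setT (symmetrization f).
  apply: measurable_funM; first exact: measurable_cst.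
  apply: measurable_sum => s; apply: (measurableT_comp mf).
  exact: (measurable_pull s).
have fg : {ae power_measure nu d, forall x, f x = symmetrization f x}.
  have fs' : {ae power_measure nu d, forall x, forall s, f (tuple_perm s x) = f x}.
    exact: filter_forall.
  apply: filterS fs' => x fx.
  rewrite /symmetrization (eq_bigr (fun=> f x)) => [|s _]; last exact: fx.
  rewrite sumr_const (_ : #|_| = d`!); last by rewrite -card_Sn.
  by rewrite -[f x *+ _]mulr_natl mulKf// pnatr_eq0 -lt0n fact_gt0.
have if2 := Lfun2_integrable_sqr f2.
have m2 (h : d.-tuple T -> R) : measurable_fun setT h ->
    measurable_fun setT (fun x => (h x ^+ 2)%:E).
  by move=> mh; apply/measurable_EFinP; exact: measurable_funX.
split=> //; last first.
  rewrite /sqnorm /Rintegral; congr fine; apply: ae_eq_integral => //.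
  - exact: m2.
  - exact: m2.
  - by apply: filterS fg => x /= -> _.
split=> //.
  move=> s x; rewrite /symmetrization; congr (_ * _).
  rewrite [RHS](reindex_inj (mulIg s)) /=; apply: eq_bigr => t _; congr f.
  by apply: eq_from_tnth => i; rewrite !tnth_mktuple permM.
apply/integrableP; split; first exact: m2.
move/integrableP : if2 => [_]; apply: le_lt_trans.
rewrite le_eqVlt; apply/orP; left; apply/eqP; apply: ae_eq_integral => //.
- by apply: measurableT_comp => //; exact: m2.
- by apply: measurableT_comp => //; exact: m2.
- by apply: filterS fg => x /= -> _.
Qed.

Lemma L2s_Lnorm d (f : d.-tuple T -> R) :
  fine ('N[power_measure nu d]_2%:E [EFin \o f]) ^+ 2 = sqnorm nu f.
Proof.
rewrite -powR_mulrn ?fine_ge0 ?Lnorm_ge0// -fine_poweR poweR_Lnorm//.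
rewrite /sqnorm /Rintegral; congr fine; apply: eq_integral => x _.
by rewrite /= powR_mulrn// real_normK ?num_real.
Qed.

End Symmetrization.

(** * The equivalence *)

Lemma cvg_sqr0 (R : realType) (u : nat -> R) :
  u k ^+ 2 @[k --> \oo] --> (0 : R) -> u k @[k --> \oo] --> (0 : R).
Proof.
move=> u2; apply: norm_cvg0; rewrite -[X in _ --> X](@sqrtr0 R).
rewrite (_ : (fun k => `|u k|) = Num.sqrt \o (fun k => u k ^+ 2)).
  by apply: continuous_cvg u2; exact: sqrt_continuous.
by apply/funext => k /=; rewrite sqrtr_sqr.
Qed.

Lemma cvg_sum (R : realType) (I : Type) (r : seq I) (P : pred I)
    (u : I -> nat -> R) (a : I -> R) :
  (forall i, P i -> u i k @[k --> \oo] --> a i) ->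
  \sum_(i <- r | P i) u i k @[k --> \oo] --> \sum_(i <- r | P i) a i.
Proof. by move=> ua; apply: cvg_big => //; exact: add_continuous. Qed.

Theorem proposition9p1 (R : realType) (Z : ptopologicalType)
    (polish_Z : polish R Z)
    (nu : {sigma_finite_measure set (borel Z) -> \bar R})
    (nu_non_atomic : non_atomic nu)
    (d : nat) (d_ge2 : (2 <= d)%N)
    (f : nat -> d.-tuple (borel Z) -> R)
    (f_L2s : forall k, L2s nu (f k))
    (f_norm : (d`!%:R * fine ('N[power_measure nu d]_2%:E [EFin \o f k]) ^+ 2)
                @[k --> \oo] --> (1 : R)) :
  (forall n : nat, (3 <= n)%N ->
     (\sum_(sigma in M2 n d)
        \int[power_measure nu (n * d)./2]_y fsigma (f k) sigma y)
       @[k --> \oo] --> (0 : R))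
  <->
  (forall sigma : {set {set 'I_(4 * d)}}, sigma \in M2c d ->
     (\int[power_measure nu (2 * d)]_y fsigma (f k) sigma y)
       @[k --> \oo] --> (0 : R)).
Proof.
have d0 : (0 < d)%N by exact: leq_trans d_ge2.
pose g k := symmetrization (f k).
have sg k : symL2 nu (g k) by have [] := L2s_symmetrization (f_L2s k).
(* From here on the kernels [f k] are exchanged for their symmetrizations [g k]. *)
have DE n m sigma k : (0 < n)%N -> m = (n * d)./2 -> sigma \in M2 n d ->
    \int[power_measure nu m]_y fsigma (f k) sigma y =
    diagram_integral nu m (g k) sigma.
  move=> n0 mE s2; have [[mg _ _] fg _] := L2s_symmetrization (f_L2s k).
  apply: (diagram_integral_ae n0 d0 mE s2 _ mg fg).
  by have [] := f_L2s k; rewrite inE => /andP[]; rewrite inE.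
have M2cM2 sigma : sigma \in M2c d -> sigma \in M2 4 d.
  by rewrite inE => /andP[].
have c1 : sqnorm nu (g k) @[k --> \oo] --> (d`!%:R^-1 : R).
  have fact0 : d`!%:R != 0 :> R by rewrite pnatr_eq0 -lt0n fact_gt0.
  have -> : (fun k => sqnorm nu (g k)) = (fun k => d`!%:R^-1 *
      (d`!%:R * fine ('N[power_measure nu d]_2%:E [EFin \o f k]) ^+ 2)).
    apply/funext => k; have [_ _ ->] := L2s_symmetrization (f_L2s k).
    by rewrite L2s_Lnorm mulKf.
  rewrite -[X in _ --> X]mulr1; apply: cvgM f_norm; exact: cvg_cst.
split=> [h sigma sc|h n n3].
  under eq_fun do rewrite (DE 4 _ _ _ isT (esym (half4 d)) (M2cM2 _ sc)).
  have h4 := h 4 isT.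
  (* A circular term lies between 0 and the full sum, since the other circular terms and the sum of
     the noncircular ones are nonnegative. *)
  apply: (squeeze_cvgr _ (cvg_cst (0 : R)) h4); apply: nearW => k /=.
  rewrite half4 diagram_integral_circ_ge0//=.
  rewrite (bigID (fun tau => tau \in M2c d))/= (bigD1 sigma) /= ?M2cM2//.
  rewrite (DE 4 _ _ _ isT (esym (half4 d)) (M2cM2 _ sc)) -addrA lerDl.
  apply: addr_ge0.
    apply: sumr_ge0 => tau /andP[/andP[t2 tc] _].
    rewrite (DE 4 _ _ _ isT (esym (half4 d)) t2).
    exact: diagram_integral_circ_ge0.
  rewrite (eq_bigr (diagram_integral nu (2 * d) (g k))).
    exact: sum_noncirc_integral_ge0.
  by move=> tau /andP[t2 _]; exact: (DE 4 _ _ _ isT (esym (half4 d)) t2).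
have n0 : (0 < n)%N by exact: leq_trans n3.
rewrite -[X in _ --> X](@big1_eq R 0 +%R _ (index_enum _) (fun sigma => sigma \in M2 n d)).
apply: (cvg_sum (u := fun sigma k => \int[power_measure nu (n * d)./2]_y fsigma (f k) sigma y)
  (a := fun=> 0)) => sigma s2.
have [tau tc le_tau] := diagram_integral_le nu d0 n3 s2.
under eq_fun do rewrite (DE n _ _ _ n0 erefl s2).
(* [le_tau] controls the square of the integral: a circular term tending to 0 times a power of the
   norm, which converges by [c1]. *)
apply: cvg_sqr0.
have cn : sqnorm nu (g k) ^+ (n - 2) @[k --> \oo] --> (d`!%:R^-1 : R) ^+ (n - 2).
  exact: (continuous_cvg _ (@exprn_continuous R (n - 2) _) c1).
have bound : (\int[power_measure nu (2 * d)]_y fsigma (f k) tau y) *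
    sqnorm nu (g k) ^+ (n - 2) @[k --> \oo] --> (0 : R).
  rewrite -[X in _ --> X](mul0r ((d`!%:R^-1 : R) ^+ (n - 2))).
  exact: (cvgM (h tau tc) cn).
apply: (squeeze_cvgr _ (cvg_cst (0 : R)) bound); apply: nearW => k /=.
rewrite sqr_ge0 /= (DE 4 _ _ _ isT (esym (half4 d)) (M2cM2 _ tc)).
exact: le_tau.
Qed.
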